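(* For all integers $n\geq 1$ let \[u_n=\frac{\overline{p}(n-1)\,\overline{p}(n+1)}{\overline{p}(n)^2}.\] Then for all $n\geq 16$, \[4(1-u_n)(1-u_{n+1})-(1-u_nu_{n+1})^2>0.\]
   Context: An overpartition of a nonnegative integer $n$ is a partition of $n$ in which the first occurrence of each distinct part may be overlined. $\overline{p}(n)$ denotes the number of overpartitions of $n$, with $\overline{p}(0)=1$. *)

(* Defs.v *)
From mathcomp Require Import all_boot all_order all_algebra.
Set Implicit Arguments. Unset Strict Implicit. Unset Printing Implicit Defensive.
Import Order.TTheory GRing.Theory Num.Theory.

(* An overpartition is encoded as a sequence of (part, overlined?) pairs, listed
   in a canonical order: parts weakly decreasing, and among equal parts the
   (unique, optional) overlined copy -- the "first occurrence" -- comes first.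
   [op_rel a b] says that a may immediately precede b. *)
Definition op_rel (a b : nat * bool) : bool :=
  (b.1 < a.1) || ((a.1 == b.1) && ~~ b.2).

Definition is_overpartition (n : nat) (s : seq (nat * bool)) : bool :=
  [&& sorted op_rel s, all (fun x => 0 < x.1) s & sumn (map fst s) == n].

Fixpoint cands (n k : nat) : seq (seq (nat * bool)) :=
  match k with
  | 0 => [:: [::]]
  | k'.+1 => [seq x :: s | x <- [seq (i, b) | i <- iota 1 n, b <- [:: true; false]],
                           s <- cands n k']
  end.

(* Every overpartition of n has length <= n and parts in 1..n, so it occurs
   (exactly once) in this list; hence this is the number of overpartitions. *)
Definition all_cands (n : nat) : seq (seq (nat * bool)) :=
  flatten [seq cands n k | k <- iota 0 n.+1].

Definition overpbar (n : nat) : nat :=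
  size (undup [seq s <- all_cands n | is_overpartition n s]).

Definition u (n : nat) : rat :=
  ((overpbar n.-1)%:R * (overpbar n.+1)%:R) / ((overpbar n)%:R ^+ 2).

Lemma overpbar_small : [:: overpbar 0; overpbar 1; overpbar 2; overpbar 3] = [:: 1; 2; 4; 8]%N.
Proof. vm_compute. reflexivity. Qed.

(* Main.v *)
(** The generating function of overpartitions is the product over [k >= 1] of
    [(1 + q^k) / (1 - q^k)].  On a circle [|q| = exp (- sg)] whose radius is chosen so that
    the mean of the associated distribution is [n + 1/2], its logarithm has a Taylor
    expansion with cumulants [kappa2], [kappa3], [kappa4] of order [sg^-3], [sg^-4], [sg^-5],
    and positivity of the coefficients bounds the Taylor remainders on the whole circle.
    Hence the Fourier integrals for [p (n - 1)], ..., [p (n + 2)] are nearly those of a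
    Gaussian with third cumulant small against [kappa2^(3/2)].  The expression to be bounded
    is, up to a positive factor, the discriminant of the cubic with coefficients
    [p (n - 1)], ..., [p (n + 2)]; for the Gaussian it is the (positive) discriminant of a
    Hermite polynomial, and the estimates are sharp enough for every [n >= 5063].  The
    remaining [n] are checked by computation, with Gauss' identity
    [1 + 2 sum (-1)^s q^(s^2) = prod (1 - q^k) / (1 + q^k)] as a fast recurrence. *)

From Stdlib Require Import Reals Lra Lia Psatz ZArith List Ranalysis5.
From Coquelicot Require Import Coquelicot.
Import ListNotations.

Open Scope R_scope.

(** * Integrals and truncated Gaussian moments *)

(** For a Gaussian profile the discriminant is smaller than the fourth power of the profile by a
    factor of order [kappa2 ^ 3], so estimating the four coefficients one at a time would require
    that relative accuracy. Centring at the half-integer [n + 1/2] turns them into the values of one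
    profile at [-3/2], [-1/2], [1/2], [3/2]; the triple-angle formulas then express the second and
    third differences as integrals whose kernels have size [x ^ 2] and [x ^ 3], and these need only
    be known within some per cent. All products are finite, over [k <= N]: their coefficients agree
    with those of the infinite product up to index [N], so no convergence question arises. Nor is
    Fourier inversion used: the integrals and the counts obey the same recurrence, which has only
    one suitably bounded solution. The threshold comes from the range [sg <= 1/45]: at [sg = 1/45]
    the first cumulant is at most [5/2 * 45 ^ 2 = 5062.5], and there several of the estimates hold
    with almost no room to spare. *)

Definition smooth (f : R -> R) := forall x, ex_derive f x.

Lemma smooth_ex_RInt f a b : smooth f -> ex_RInt f a b.
Proof.
  intros H; apply (ex_RInt_continuous (V := R_CompleteNormedModule)).
  intros z _; apply (@ex_derive_continuous R_AbsRing R_NormedModule), H.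
Qed.

Ltac smoothness := intros ?; auto_derive; intuition auto.

Lemma RInt_lin (f g : R -> R) (p q a b : R) : smooth f -> smooth g ->
  RInt (fun x => p * f x + q * g x) a b = p * RInt f a b + q * RInt g a b.
Proof.
  intros Hf Hg.
  pose proof (RInt_plus (V := R_CompleteNormedModule) (fun x => p * f x) (fun x => q * g x) a b)
    as E.
  unfold plus in E; simpl in E; rewrite E; try (apply smooth_ex_RInt; smoothness).
  pose proof (RInt_scal (V := R_CompleteNormedModule) f a b p) as E1.
  pose proof (RInt_scal (V := R_CompleteNormedModule) g a b q) as E2.
  unfold scal, mult in E1, E2; simpl in E1, E2; unfold mult in E1, E2; simpl in E1, E2.
  rewrite E1, E2; auto using smooth_ex_RInt.
Qed.

Lemma RInt_split (f : R -> R) (a b c : R) : smooth f ->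
  RInt f a c = RInt f a b + RInt f b c.
Proof.
  intros Hf. symmetry.
  apply (RInt_Chasles (V := R_CompleteNormedModule)); auto using smooth_ex_RInt.
Qed.

Lemma RInt_mono (f g : R -> R) (a b : R) : a <= b -> smooth f -> smooth g ->
  (forall x, a <= x <= b -> f x <= g x) -> RInt f a b <= RInt g a b.
Proof.
  intros Hab Hf Hg H; apply RInt_le; auto using smooth_ex_RInt.
  intros x Hx; apply H; lra.
Qed.

Lemma RInt_FTC (f df : R -> R) (a b : R) : smooth df ->
  (forall x, is_derive f x (df x)) -> RInt df a b = f b - f a.
Proof.
  intros Hs H; apply is_RInt_unique.
  apply (is_RInt_derive (V := R_CompleteNormedModule) f df); intros x _; auto.
  apply (@ex_derive_continuous R_AbsRing R_NormedModule), Hs.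
Qed.

Lemma RInt_cst (c a b : R) : RInt (fun _ => c) a b = (b - a) * c.
Proof. exact (RInt_const (V := R_CompleteNormedModule) a b c). Qed.

Lemma deriv_nonneg_le (f df : R -> R) (a b : R) : a <= b ->
  (forall x, a <= x <= b -> is_derive f x (df x)) ->
  (forall x, a <= x <= b -> 0 <= df x) -> f a <= f b.
Proof.
  intros Hab Hd Hp.
  destruct (MVT_gen f a b df) as [c [Hc E]].
  - rewrite Rmin_left, Rmax_right by lra. intros; apply Hd; lra.
  - rewrite Rmin_left, Rmax_right by lra. intros x Hx.
    apply continuity_pt_filterlim, (@ex_derive_continuous R_AbsRing R_NormedModule).
    exists (df x); auto.
  - rewrite Rmin_left, Rmax_right in Hc by lra.
    specialize (Hp c Hc). nra.
Qed.

Definition gauss (c x : R) := exp (- (c * x ^ 2 / 2)).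

Lemma gauss_pos c x : 0 < gauss c x. Proof. apply exp_pos. Qed.

Lemma gauss_is_derive c x : is_derive (gauss c) x (- (c * x) * gauss c x).
Proof. unfold gauss; auto_derive; [easy|]. unfold Rdiv; simpl pow. field. Qed.

Lemma gauss_ex_derive c x : ex_derive (gauss c) x.
Proof. eexists; apply gauss_is_derive. Qed.
#[local] Hint Resolve gauss_ex_derive : core.

Definition gmom (c L : R) (j : nat) : R := RInt (fun x => gauss c x * x ^ j) 0 L.

(** Integration by parts. The boundary term is kept because [mu2_lower] needs the second moment
    exactly; [gmom_step] discards it. *)
Lemma gmom_step_eq c L j : 0 < c ->
  gmom c L (S (S j)) = INR (S j) / c * gmom c L j - L ^ S j / c * gauss c L.
Proof.
  intros Hc.
  assert (E : RInt (fun x => 1 * (gauss c x * x ^ S (S j))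
    + (- (INR (S j) / c)) * (gauss c x * x ^ j)) 0 L
    = - (L ^ S j / c * gauss c L) - - (0 ^ S j / c * gauss c 0)).
  { apply (RInt_FTC (fun x => - (x ^ S j / c * gauss c x))).
    - intros x. auto_derive; repeat split; auto.
    - intros x. auto_derive; [auto|].
      replace (Derive (fun x0 : R => gauss c x0) x) with (- (c * x) * gauss c x) by (symmetry;
        apply is_derive_unique, gauss_is_derive).
      rewrite S_INR; simpl pred. change (x ^ S (S j)) with (x * (x * x ^ j)).
      replace (match j with 0%nat => 1 | S _ => INR j + 1 end) with (INR j + 1) by (destruct j;
        simpl; lra).
      simpl pow. field. lra. }
  rewrite RInt_lin in E by smoothness.
  fold (gmom c L (S (S j))) (gmom c L j) in E.
  rewrite pow_ne_zero in E by lia. lra.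
Qed.

Lemma gmom_step c L j : 0 < c -> 0 <= L ->
  gmom c L (S (S j)) <= INR (S j) / c * gmom c L j.
Proof.
  intros Hc HL. rewrite gmom_step_eq by auto.
  assert (0 <= L ^ S j / c * gauss c L).
  { apply Rmult_le_pos; [|apply Rlt_le, gauss_pos].
    apply Rle_mult_inv_pos; auto. apply pow_le; auto. }
  lra.
Qed.

Lemma gmom_nonneg c L j : 0 <= L -> 0 <= gmom c L j.
Proof.
  intros HL. apply RInt_ge_0; auto.
  - apply smooth_ex_RInt; smoothness.
  - intros x Hx. apply Rmult_le_pos; [apply Rlt_le, gauss_pos| apply pow_le; lra].
Qed.

(** The double factorial [(2 i - 1)!!], that is, the moment of order [2 i] of the standard
    Gaussian. *)
Fixpoint dfact (i : nat) : R := match i with O => 1 | S i' => INR (2 * i' + 1) * dfact i' end.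

Lemma gmom_even c L i : 0 < c -> 0 <= L ->
  gmom c L (2 * i) <= dfact i / c ^ i * gmom c L 0.
Proof.
  intros Hc HL; induction i as [|i IH].
  - simpl. lra.
  - replace (2 * S i)%nat with (S (S (2 * i))) by lia.
    eapply Rle_trans; [apply gmom_step; auto|].
    replace (S (2 * i)) with (2 * i + 1)%nat by lia.
    assert (0 < INR (2 * i + 1)) by (apply lt_0_INR; lia).
    eapply Rle_trans. { apply Rmult_le_compat_l; [|apply IH].
      apply Rlt_le, Rdiv_lt_0_compat; auto. }
    right. change (dfact (S i)) with (INR (2 * i + 1) * dfact i). cbn [pow]. field.
      split; [apply pow_nonzero|]; lra.
Qed.

(** The substitution [x = s * y] turns the wider Gaussian into the original one on [[0, L / s]], an
    interval inside [[0, L]]. *)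
Lemma gmom0_widen c s L : 0 < c -> 1 <= s -> 0 <= L ->
  gmom (c / s ^ 2) L 0 <= s * gmom c L 0.
Proof.
  intros Hc Hs HL.
  assert (E : RInt (fun y => s * (gauss (c / s ^ 2) (s * y + 0) * (s * y
    + 0) ^ 0)) 0 (L / s) = gmom (c / s ^ 2) L 0).
  { pose proof (RInt_comp_lin (V := R_CompleteNormedModule) (fun x => gauss (c / s ^ 2) x * x ^
    0) s 0 0 (L / s)) as E.
    unfold scal in E; simpl in E; unfold mult in E; simpl in E.
    unfold gmom; simpl pow. rewrite E.
    - f_equal; field; lra.
    - apply smooth_ex_RInt; smoothness. }
  rewrite <- E.
  rewrite (RInt_ext _ (fun y => s * (gauss c y * y ^ 0) + 0 * 0)).
  2:{ intros x _. rewrite !pow_O. replace (gauss (c / s ^ 2) (s * x + 0)) with (gauss c x); [lra|].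
      unfold gauss. f_equal. field. lra. }
  rewrite (RInt_lin (fun y => gauss c y * y ^ 0) (fun _ => 0)) by smoothness.
  rewrite RInt_cst.
  assert (RInt (fun y => gauss c y * y ^ 0) 0 (L / s) <= gmom c L 0).
  { unfold gmom. rewrite (RInt_split _ 0 (L / s) L) by smoothness.
    assert (L / s <= L). { apply Rle_div_l; [lra|]. nra. }
    assert (0 <= RInt (fun x : R => gauss c x * x ^ 0) (L / s) L).
    { apply RInt_ge_0; auto. apply smooth_ex_RInt; smoothness.
      intros x Hx. simpl. pose proof (gauss_pos c x). lra. }
    lra. }
  nra.
Qed.

(** The Gaussian lies above [1 - t^2 x^2 / 2], which is integrated up to [1.4 / t], just before its
    zero at [sqrt 2 / t]; the value is [(1.4 - 1.4^3 / 6) / t]. *)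
Lemma gmom0_lower t L : 0 < t -> 14 / 10 / t <= L -> 94 / 100 / t <= gmom (t ^ 2) L 0.
Proof.
  intros Ht HL.
  assert (0 < 14 / 10 / t) by (apply Rdiv_lt_0_compat; lra).
  unfold gmom. rewrite (RInt_split _ 0 (14 / 10 / t) L) by smoothness.
  assert (0 <= RInt (fun x : R => gauss (t ^ 2) x * x ^ 0) (14 / 10 / t) L).
  { apply RInt_ge_0; auto. apply smooth_ex_RInt; smoothness.
    intros x Hx. simpl. pose proof (gauss_pos (t * (t * 1)) x). lra. }
  assert (RInt (fun x => 1 - t ^ 2 * x ^ 2 / 2) 0 (14 / 10 / t)
    <= RInt (fun x : R => gauss (t ^ 2) x * x ^ 0) 0 (14 / 10 / t)).
  { apply RInt_mono; [lra|smoothness|smoothness|].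
    intros x _. unfold gauss. rewrite pow_O, Rmult_1_r.
    pose proof (exp_ineq1_le (- (t ^ 2 * x ^ 2 / 2))). lra. }
  rewrite (RInt_FTC (fun x => x - t ^ 2 * x ^ 3 / 6)) in H1.
  - apply Rle_trans with (14 / 10 / t - t ^ 2 * (14 / 10 / t) ^ 3 / 6 - (0 - t ^ 2 * 0 ^ 3 / 6));
    [|lra].
    replace (14 / 10 / t - t ^ 2 * (14 / 10 / t) ^ 3 / 6 - (0 - t ^ 2 * 0 ^ 3 / 6))
      with ((14/10 - (14/10)^3 / 6) / t) by (field; lra).
    apply Rmult_le_compat_r; [apply Rlt_le, Rinv_0_lt_compat; auto|]. lra.
  - smoothness.
  - intros x; auto_derive; [easy|]. simpl; field.
Qed.

Lemma RInt_eq (f g : R -> R) a b : (forall x, f x = g x) -> RInt f a b = RInt g a b :> R.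
Proof. intros H; apply RInt_ext; auto. Qed.

(** * Elementary bounds for exp, sin and cos, and the perturbed discriminant *)

Lemma exp_le_quad y : 0 <= y -> exp y <= 1 + y + y ^ 2 / 2 * exp y.
Proof.
  intros Hy.
  pose proof (deriv_nonneg_le (fun y => 1 + y + y ^ 2 / 2 * exp y - exp y)
    (fun y => 1 + (y + y ^ 2 / 2 - 1) * exp y) 0 y Hy) as H.
  simpl in H. rewrite exp_0 in H.
  cut (1 + 0 + 0 * (0 * 1) / 2 * 1 - 1 <= 1 + y + y * (y * 1) / 2 * exp y - exp y); [simpl; lra|].
  apply H.
  - intros x Hx; auto_derive; [easy|]. field.
  - intros x Hx.
    assert (Hx1 : exp (- x) >= 1 - x) by (pose proof (exp_ineq1_le (- x)); lra).
    assert (exp x * exp (- x) = 1) by (rewrite <- exp_plus, Rplus_opp_r; apply exp_0).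
    pose proof (exp_pos x). nra.
Qed.

Lemma cos_ge_quad x : 1 - x ^ 2 / 2 <= cos x.
Proof.
  assert (P : forall x, 0 <= x -> 1 - x ^ 2 / 2 <= cos x).
  { clear x; intros x Hx.
    pose proof (deriv_nonneg_le (fun y => cos y - (1 - y ^ 2 / 2)) (fun y => y - sin y) 0 x Hx)
      as H.
    cbv beta in H. rewrite cos_0 in H.
    cut (1 - (1 - 0 ^ 2 / 2) <= cos x - (1 - x ^ 2 / 2)); [lra|].
    apply H.
    - intros y _; auto_derive; [easy|]; field.
    - intros y Hy. destruct (Req_dec y 0) as [->|]; [rewrite sin_0; lra|].
      pose proof (sin_lt_x y); lra. }
  destruct (Rle_dec 0 x) as [H|H]; [auto|].
  rewrite <- cos_neg. replace (x ^ 2) with ((- x) ^ 2) by ring. apply P; lra.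
Qed.

Lemma sin_le_id x : 0 <= x -> sin x <= x.
Proof.
  intros Hx; destruct (Req_dec x 0) as [->|]; [rewrite sin_0; lra|].
  pose proof (sin_lt_x x); lra.
Qed.

Lemma sin_ge_cubic x : 0 <= x -> x - x ^ 3 / 6 <= sin x.
Proof.
  intros Hx.
  pose proof (deriv_nonneg_le (fun y => sin y - (y - y ^ 3 / 6)) (fun y => cos y - (1 - y ^ 2 /
    2)) 0 x Hx) as H.
  cbv beta in H. rewrite sin_0 in H.
  cut (0 - (0 - 0 ^ 3 / 6) <= sin x - (x - x ^ 3 / 6)); [lra|].
  apply H.
  - intros y _; auto_derive; [easy|]; field.
  - intros y _; pose proof (cos_ge_quad y); lra.
Qed.

Lemma abs_sin_le x : Rabs (sin x) <= Rabs x.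
Proof.
  destruct (Rle_dec 0 x) as [H|H].
  - rewrite (Rabs_right x) by lra. apply Rabs_le. split; [|apply sin_le_id; auto].
    pose proof (SIN_bound x). destruct (Rle_dec 1 x); [lra|].
    assert (0 <= sin x) by (apply sin_ge_0; pose proof PI2_1; lra). lra.
  - rewrite <- Rabs_Ropp, <- sin_neg, (Rabs_left x) by lra.
    apply Rabs_le. split; [|apply sin_le_id; lra].
    pose proof (SIN_bound (- x)). destruct (Rle_dec 1 (- x)); [lra|].
    assert (0 <= sin (- x)) by (apply sin_ge_0; pose proof PI2_1; lra). lra.
Qed.

(* [A] and [D] come from the even part of a profile sampled at four points with unit
   spacing, [al] and [ga] from its odd part; for [al = ga = 0] the discriminant is
   [D ^ 3 * (4 * A - D)]. *)
Lemma cubic_discriminant_pos (A D al ga t : R) :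
  0 < A -> 10 <= t -> 84 / 100 * A <= D * t ^ 2 -> D <= A / 100 ->
  Rabs al * t <= 75 / 1000 * A -> Rabs ga * t ^ 3 <= 45 / 100 * A ->
  let a := A - D - (3 * al + ga) in let b := A - al in
  let c := A + al in let d := A - D + (3 * al + ga) in
  0 < 4 * (b ^ 2 - a * c) * (c ^ 2 - b * d) - (b * c - a * d) ^ 2.
Proof.
  intros HA Ht HD HD2 Hal Hga a b c d.
  (* Everything is rescaled to order one. For a Gaussian profile [d1] is near 1, [x] and [g] vanish,
     and the bracket in [E] is close to [4 * d1 ^ 3]; [e] carries the corrections of relative order
     [1 / t ^ 2]. *)
  set (d1 := D * t ^ 2 / A). set (x := al * t / A). set (g := ga * t ^ 3 / A).
  set (e := 1 / t ^ 2).
  assert (Ht2 : 0 < t ^ 2) by (apply pow_lt; lra).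
  assert (He : 0 < e) by (apply Rdiv_lt_0_compat; lra).
  assert (He2 : e <= 1 / 100).
  { unfold e. apply Rle_div_l; [auto|]. nra. }
  assert (E : 4 * (b ^ 2 - a * c) * (c ^ 2 - b * d) - (b * c - a * d) ^ 2 =
    A ^ 4 / t ^ 6 * ((d1 ^ 2 - 4 * x * g - g ^ 2 * e) * (4 * d1 + 16 * x ^ 2
      + 4 * x * g * e - (d1 ^ 2 - 4 * x * g - g ^ 2 * e) * e) - 4 * (x * d1 + g) ^ 2)).
  { unfold a, b, c, d, d1, x, g, e. field. lra. }
  rewrite E. apply Rmult_lt_0_compat.
  { apply Rdiv_lt_0_compat; apply pow_lt; lra. }
  assert (Hd : 84 / 100 <= d1) by (unfold d1; apply (Rle_div_r (84 / 100) (D * t ^ 2) A); lra).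
  assert (Hde : d1 * e <= 1 / 100).
  { unfold d1, e. replace (D * t ^ 2 / A * (1 / t ^ 2)) with (D / A) by (field; lra).
    apply Rle_div_l; lra. }
  assert (Hx : Rabs x <= 75 / 1000).
  { unfold x, Rdiv. rewrite 2!Rabs_mult, Rabs_inv, (Rabs_right t), (Rabs_right A) by lra.
    apply Rle_div_l; lra. }
  assert (Hg : Rabs g <= 45 / 100).
  { assert (0 < t ^ 3) by (apply pow_lt; lra).
    unfold g, Rdiv. rewrite 2!Rabs_mult, Rabs_inv, (Rabs_right (t ^ 3)), (Rabs_right A) by lra.
      apply Rle_div_l; lra. }
  clearbody d1 x g e. clear - Hd Hde Hx Hg He He2.
  apply Rabs_le_between in Hx. apply Rabs_le_between in Hg.
  assert (X2 : 0 <= x ^ 2 <= 5625 / 1000000) by nra.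
  assert (G2 : 0 <= g ^ 2 <= 2025 / 10000) by nra.
  assert (XG : - (33750 / 1000000) <= x * g <= 33750 / 1000000) by nra.
  assert (ge : 0 <= g ^ 2 * e <= 2025 / 1000000) by nra.
  assert (S : (x * d1 + g) ^ 2 <= (75 / 1000 * d1 + 45 / 100) ^ 2).
  { apply pow_maj_Rabs. apply Rabs_le. nra. }
  set (P := d1 ^ 2 - 4 * x * g - g ^ 2 * e) in *.
  assert (HP : d1 ^ 2 - 1371 / 10000 <= P <= d1 ^ 2 + 135 / 1000) by (unfold P; lra).
  set (R1 := 4 * d1 + 16 * x ^ 2 + 4 * x * g * e - P * e).
  assert (Pe : P * e <= d1 / 100 + 135 / 100000).
  { apply Rle_trans with ((d1 ^ 2 + 135 / 1000) * e); [nra|].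
    replace ((d1 ^ 2 + 135 / 1000) * e) with (d1 * (d1 * e) + 135 / 1000 * e) by ring. nra. }
  assert (HR : 399 / 100 * d1 - 3 / 1000 <= R1) by (unfold R1; nra).
  assert (Hf : (d1 ^ 2 - 1371 / 10000) * (399 / 100 * d1 - 3 / 1000) > 4 * (75 / 1000 * d1
    + 45 / 100) ^ 2) by nra.
  assert (0 < d1 ^ 2 - 1371 / 10000) by nra.
  assert ((d1 ^ 2 - 1371 / 10000) * (399 / 100 * d1 - 3 / 1000) <= P * R1)
    by (apply Rmult_le_compat; lra).
  lra.
Qed.

(** * Discriminant of a nearly Gaussian profile *)

Lemma exp_mult_INR n x : exp (INR n * x) = exp x ^ n.
Proof.
  induction n as [|n IH]; [simpl; rewrite Rmult_0_l; apply exp_0|].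
  rewrite S_INR, Rmult_plus_distr_r, exp_plus, IH, Rmult_1_l. simpl; ring.
Qed.

(* The constants are those that the bounds on the cumulants give for [t ^ 2 = kappa2],
   [sg <= 1/45] and [L = 0.44 sg]; [s] below is such that
   [k4 * L ^ 2 / 12 <= (1 - 1 / s ^ 2) * t ^ 2]. *)
Section LocalLimit.

Variables (U W : R -> R) (t k3 k4 L sg e2 e3 : R).

Hypothesis Usm : smooth U.
Hypothesis Wsm : smooth W.
Hypothesis Ht : 10 <= t.
Hypothesis HtL : 6 <= t * L.
Hypothesis HL2 : L ^ 2 <= / 1000.
Hypothesis HLS : 0 < L <= sg.
Hypothesis HSpi : sg <= PI.
Hypothesis Ulow : forall x, 0 <= x -> - (t ^ 2 * x ^ 2 / 2) <= U x.
Hypothesis Uup : forall x, 0 <= x -> U x <= - (t ^ 2 * x ^ 2 / 2) + k4 * x ^ 4 / 24.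
Hypothesis Umono : forall x y, 0 <= x <= y ->
  U x + t ^ 2 * x ^ 2 / 2 <= U y + t ^ 2 * y ^ 2 / 2.
Hypothesis Wb : forall x, 0 <= x -> Rabs (W x) <= k3 * x ^ 3 / 6.
Hypothesis tail2 : forall x, L <= x <= sg -> exp (U x) <= e2.
Hypothesis tail3 : forall x, sg <= x <= PI -> exp (U x) <= e3.
Hypothesis Hk3 : 0 <= k3 <= 2328 / 10000 * t ^ 3.
Hypothesis Hk4 : 0 <= k4 <= 665 / 10000 * t ^ 4.
Hypothesis HkL : k4 * L ^ 2 <= 2658 / 1000 * t ^ 2.

(** Bounds the integral of [exp (U x) * x ^ j] over [[L, PI]]: the interval is split at [sg], and
    the two pieces have lengths at most [sg] and 4. *)
Let tl (j : nat) := e2 * sg ^ (j + 1) + e3 * 4 ^ (j + 1).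

Hypothesis Htl3 : t ^ 4 * tl 3 <= 44 / 1000.
Hypothesis Htl2 : t ^ 3 * tl 2 <= 3 / 1000.
Hypothesis Htl1 : t ^ 2 * tl 1 <= 25 / 10000.
Hypothesis Htl0 : t * tl 0 <= 25 / 10000.

Let Uex : forall x, ex_derive U x := Usm.
Let Wex : forall x, ex_derive W x := Wsm.
#[local] Hint Resolve Uex Wex gauss_ex_derive : core.

Let mu (j : nat) : R := RInt (fun x => exp (U x) * x ^ j) 0 L.
Let M : R := gmom (t ^ 2) L 0.

Lemma t2_pos : 0 < t ^ 2. Proof. apply pow_lt; lra. Qed.
#[local] Hint Resolve t2_pos : core.

Lemma gauss_le_expU x : 0 <= x -> gauss (t ^ 2) x <= exp (U x).
Proof.
  intros Hx; unfold gauss. pose proof (Ulow x Hx) as H.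
  destruct H as [H|H]; [left; apply exp_increasing; auto|rewrite H; lra].
Qed.

Lemma gmom0_le_mu0 : M <= mu 0.
Proof.
  unfold M, gmom, mu. apply RInt_mono; try (smoothness); [lra|].
  intros x Hx. rewrite pow_O. pose proof (gauss_le_expU x). lra.
Qed.

Lemma gmom0_scaled_lower : 94 / 100 <= t * M.
Proof.
  assert (94 / 100 / t <= M).
  { apply gmom0_lower; [lra|]. apply Rle_div_l; lra. }
  apply Rle_div_l in H; lra.
Qed.

Lemma gmom0_pos : 0 < M.
Proof. pose proof gmom0_scaled_lower. nra. Qed.

Let s := 1134 / 1000.
Let q := k4 / 24.

(** The quartic excess [y = q * x ^ 4] is expanded to second order. The factor [exp y] left in the
    remainder is absorbed by widening the Gaussian by [s]: on [[0, L]], [y] is at most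
    [k4 * L^2 * x^2 / 24], a small multiple of [t^2 * x^2]. *)
Lemma expU_le_quad x : 0 <= x <= L ->
  exp (U x) <= gauss (t ^ 2) x + q * (gauss (t ^ 2) x * x ^ 4)
    + q ^ 2 / 2 * (gauss (t ^ 2 / s ^ 2) x * x ^ 8).
Proof.
  intros Hx.
  assert (Hx2 : 0 <= x ^ 2) by (apply pow2_ge_0).
  assert (Hx4 : 0 <= x ^ 4) by (apply pow_le; lra).
  set (y := q * x ^ 4).
  assert (Hy : 0 <= y) by (unfold y, q; apply Rmult_le_pos; lra).
  assert (H1 : exp (U x) <= gauss (t ^ 2) x * exp y).
  { unfold gauss. rewrite <- exp_plus.
    pose proof (Uup x (proj1 Hx)) as H.
    replace (k4 * x ^ 4 / 24) with y in H by (unfold y, q; field).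
    destruct H as [H|H]; [left; apply exp_increasing; auto|rewrite H; lra]. }
  assert (H2 : gauss (t ^ 2) x * exp y <= gauss (t ^ 2 / s ^ 2) x).
  { unfold gauss. rewrite <- exp_plus.
    assert (H : - (t ^ 2 * x ^ 2 / 2) + y <= - (t ^ 2 / s ^ 2 * x ^ 2 / 2)).
    { assert (y <= 2658 / 24000 * t ^ 2 * x ^ 2).
      { unfold y, q. replace (x ^ 4) with (x ^ 2 * x ^ 2) by ring.
        assert (x ^ 2 <= L ^ 2) by (apply pow_incr; lra).
        assert (k4 * x ^ 2 <= 2658 / 1000 * t ^ 2) by nra. nra. }
      assert (0 <= t ^ 2 * x ^ 2) by nra.
      unfold s. replace (t ^ 2 / (1134 / 1000) ^ 2 * x ^ 2 / 2)
        with (t ^ 2 * x ^ 2 * (1000 ^ 2 / 1134 ^ 2 / 2)) by field.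
      lra. }
    destruct H as [H|H]; [left; apply exp_increasing; auto|rewrite H; lra]. }
  pose proof (exp_le_quad y Hy) as H3.
  pose proof (gauss_pos (t ^ 2) x) as H4.
  apply Rle_trans with (gauss (t ^ 2) x * (1 + y + y ^ 2 / 2 * exp y)).
  { eapply Rle_trans; [apply H1|]. apply Rmult_le_compat_l; lra. }
  replace (gauss (t ^ 2) x * (1 + y + y ^ 2 / 2 * exp y)) with
    (gauss (t ^ 2) x + q * (gauss (t ^ 2) x * x ^ 4) + y ^ 2 / 2 * (gauss (t ^ 2) x * exp y))
    by (unfold y; ring).
  replace (q ^ 2 / 2 * (gauss (t ^ 2 / s ^ 2) x * x ^ 8))
    with (y ^ 2 / 2 * gauss (t ^ 2 / s ^ 2) x) by (unfold y; field).
  apply Rplus_le_compat_l, Rmult_le_compat_l; [|auto].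
  pose proof (pow2_ge_0 y); lra.
Qed.

Lemma mu_le_gmom j :
  mu j <= gmom (t ^ 2) L j + q * gmom (t ^ 2) L (j + 4)
    + q ^ 2 / 2 * gmom (t ^ 2 / s ^ 2) L (j + 8).
Proof.
  unfold mu.
  apply Rle_trans with (RInt (fun x => 1 * (1 * (gauss (t ^ 2) x * x ^ j)
    + q * (gauss (t ^ 2) x * x ^ (j + 4))) + q ^ 2 / 2 * (gauss (t ^ 2 / s ^ 2) x * x ^ (j
      + 8))) 0 L).
  - apply RInt_mono; [lra|smoothness|smoothness|].
    intros x Hx. rewrite !pow_add.
    assert (0 <= x ^ j) by (apply pow_le; lra).
    pose proof (expU_le_quad x Hx) as H1.
    apply (Rmult_le_compat_r (x ^ j)) in H1; [|auto]. nra.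
  - rewrite RInt_lin, RInt_lin by smoothness. unfold gmom. lra.
Qed.

(** The three terms of [mu_le_gmom] in units of [M / t ^ (2 * i)]. The constant [0.0027709] is
    [0.0665 / 24] rounded up and bounds [q / t ^ 4]; of the exponent [2 i + 9], [2 (i + 4)] comes
    from the variance of the wide Gaussian and 1 from [gmom0_widen]. *)
Let C (i : nat) := dfact i + 27709 / 10000000 * dfact (i + 2)
  + (27709 / 10000000) ^ 2 / 2 * (dfact (i + 4) * s ^ (2 * i + 9)).

Lemma dfact_pos i : 0 < dfact i.
Proof. induction i; cbn [dfact]; [lra|]. apply Rmult_lt_0_compat; auto. apply lt_0_INR; lia. Qed.

Lemma dfact_num i : (i < 9)%nat ->
  dfact i = nth i [1; 1; 3; 15; 105; 945; 10395; 135135; 2027025] 0.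
Proof.
  intros Hi. do 9 (destruct i as [|i]; [cbn [dfact nth]; rewrite ?INR_IZR_INZ; simpl IZR; lra|]).
    lia.
Qed.

Lemma mu_even i : mu (2 * i) * t ^ (2 * i) <= C i * M.
Proof.
  pose proof gmom0_pos as HM. pose proof t2_pos as Ht2.
  assert (Hs : 0 < s) by (unfold s; lra).
  assert (Hs2 : 0 < s ^ 2) by (apply pow_lt; auto).
  assert (HL : 0 <= L) by lra.
  assert (Hti : 0 < (t ^ 2) ^ i) by (apply pow_lt; auto).
  rewrite pow_mult.
  eapply Rle_trans. { apply Rmult_le_compat_r; [lra|]. apply mu_le_gmom. }
  assert (G0 : gmom (t ^ 2) L (2 * i) * (t ^ 2) ^ i <= dfact i * M).
  { eapply Rle_trans. { apply Rmult_le_compat_r; [lra|apply gmom_even; auto]. }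
    right; unfold M; field; lra. }
  assert (Hq : 0 <= q * / t ^ 4 <= 27709 / 10000000).
  { assert (0 < t ^ 4) by (apply pow_lt; lra). unfold q. split.
    - apply Rmult_le_pos; [lra|]. apply Rlt_le, Rinv_0_lt_compat; auto.
    - apply Rle_div_l; lra. }
  assert (G1 : q * gmom (t ^ 2) L (2 * i + 4) * (t ^ 2) ^ i
    <= 27709 / 10000000 * dfact (i + 2) * M).
  { assert (H : gmom (t ^ 2) L (2 * i + 4) * (t ^ 2) ^ i * t ^ 4 <= dfact (i + 2) * M).
    { replace (2 * i + 4)%nat with (2 * (i + 2))%nat by lia.
      eapply Rle_trans. { apply Rmult_le_compat_r, Rmult_le_compat_r; [apply pow_le;
        lra|lra|apply gmom_even; auto]. }
      right; unfold M. rewrite pow_add. field. split; lra. }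
    replace (q * gmom (t ^ 2) L (2 * i + 4) * (t ^ 2) ^ i) with
      ((q * / t ^ 4) * (gmom (t ^ 2) L (2 * i + 4) * (t ^ 2) ^ i * t ^ 4)) by (field; lra).
    rewrite (Rmult_assoc _ _ M). apply Rmult_le_compat; [lra| |lra|auto].
    apply Rmult_le_pos; [apply Rmult_le_pos; [apply gmom_nonneg; lra|lra]|apply pow_le; lra]. }
  assert (G2 : q ^ 2 / 2 * gmom (t ^ 2 / s ^ 2) L (2 * i + 8) * (t ^ 2) ^ i <=
     (27709 / 10000000) ^ 2 / 2 * (dfact (i + 4) * s ^ (2 * i + 9)) * M).
  { assert (H : gmom (t ^ 2 / s ^ 2) L (2 * i + 8) * (t ^ 2) ^ i * t ^ 8
    <= dfact (i + 4) * s ^ (2 * i + 9) * M).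
    { replace (2 * i + 8)%nat with (2 * (i + 4))%nat by lia.
      assert (Hc : 0 < t ^ 2 / s ^ 2) by (apply Rdiv_lt_0_compat; auto).
      eapply Rle_trans. { apply Rmult_le_compat_r, Rmult_le_compat_r; [apply pow_le;
        lra|lra|apply gmom_even; auto]. }
      assert (Hw : gmom (t ^ 2 / s ^ 2) L 0 <= s * M) by (apply gmom0_widen; auto; unfold s; lra).
      replace (dfact (i + 4) / (t ^ 2 / s ^ 2) ^ (i + 4) * gmom (t ^ 2 / s ^ 2) L 0 * (t ^ 2) ^ i
        * t ^ 8)
        with (dfact (i + 4) * (s ^ 2) ^ (i + 4) * gmom (t ^ 2 / s ^ 2) L 0).
      2:{ unfold Rdiv at 3. rewrite Rpow_mult_distr, pow_inv.
          rewrite (pow_add (t ^ 2)). assert ((s ^ 2) ^ (i + 4) <> 0) by (apply pow_nonzero; lra).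
            field. repeat split; lra. }
      replace (s ^ (2 * i + 9)) with ((s ^ 2) ^ (i + 4) * s).
      2:{ rewrite <- pow_mult. replace (2 * i + 9)%nat with (2 * (i + 4) + 1)%nat by lia.
        rewrite pow_add. ring. }
      replace (dfact (i + 4) * ((s ^ 2) ^ (i + 4) * s) * M)
        with (dfact (i + 4) * (s ^ 2) ^ (i + 4) * (s * M)) by ring.
      apply Rmult_le_compat_l; auto. apply Rmult_le_pos; [apply Rlt_le, dfact_pos| apply pow_le;
        lra]. }
    replace (q ^ 2 / 2 * gmom (t ^ 2 / s ^ 2) L (2 * i + 8) * (t ^ 2) ^ i) with
      (((q * / t ^ 4) ^ 2 / 2) * (gmom (t ^ 2 / s ^ 2) L (2 * i + 8) * (t ^ 2) ^ i * t ^ 8))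
        by (field; lra).
    rewrite (Rmult_assoc _ _ M). apply Rmult_le_compat; [|  | |auto].
    - pose proof (pow2_ge_0 (q * / t ^ 4)); lra.
    - apply Rmult_le_pos; [apply Rmult_le_pos; [apply gmom_nonneg; lra|lra]|apply pow_le; lra].
    - assert ((q * / t ^ 4) ^ 2 <= (27709 / 10000000) ^ 2) by (apply pow_incr; auto). lra. }
  unfold C. lra.
Qed.

Let Z : R := mu 0.

Lemma mu_even_num c i : C i <= c -> mu (2 * i) * t ^ (2 * i) <= c * Z.
Proof.
  intros Hc. pose proof (mu_even i). pose proof gmom0_pos. pose proof gmom0_le_mu0. fold Z in H1.
  assert (0 <= C i).
  { unfold C. pose proof (dfact_pos i). pose proof (dfact_pos (i + 2)).
    pose proof (dfact_pos (i + 4)).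
    assert (0 < s ^ (2 * i + 9)) by (apply pow_lt; unfold s; lra). nra. }
  nra.
Qed.

Lemma mu4_le : mu 4 * t ^ 4 <= 3499 / 1000 * Z.
Proof.
  apply (mu_even_num _ 2). unfold C. rewrite !dfact_num by lia.
  unfold s; simpl Nat.add; simpl Nat.mul; simpl nth. lra.
Qed.

Lemma mu6_le : mu 6 * t ^ 6 <= 2105 / 100 * Z.
Proof.
  apply (mu_even_num _ 3). unfold C. rewrite !dfact_num by lia.
  unfold s; simpl Nat.add; simpl Nat.mul; simpl nth. lra.
Qed.

Lemma mu8_le : mu 8 * t ^ 8 <= 1999 / 10 * Z.
Proof.
  apply (mu_even_num _ 4). unfold C. rewrite !dfact_num by lia.
  unfold s; simpl Nat.add; simpl Nat.mul; simpl nth. lra.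
Qed.

Lemma mu0_scaled_lower : 94 / 100 <= t * Z.
Proof. pose proof gmom0_scaled_lower. pose proof gmom0_le_mu0. fold Z in H0. nra. Qed.

Lemma mu0_pos : 0 < Z.
Proof. pose proof mu0_scaled_lower. nra. Qed.

(* Chebyshev's correlation inequality: [exp (U x + t^2 x^2 / 2)] is nondecreasing, so the
   second moment of [exp U] is at least that of the Gaussian. *)
Lemma mu2_lower : Z * (999 / 1000) <= mu 2 * t ^ 2.
Proof.
  pose proof t2_pos as Ht2.
  set (E := fun x => exp (U x + t ^ 2 * x ^ 2 / 2)).
  assert (H : E (/ t) * RInt (fun x => 1 * (gauss (t ^ 2) x * x ^ 2)
    + (- / t ^ 2) * (gauss (t ^ 2) x * x ^ 0)) 0 L
     <= RInt (fun x => 1 * (exp (U x) * x ^ 2) + (- / t ^ 2) * (exp (U x) * x ^ 0)) 0 L).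
  { set (f0 := fun x => 1 * (gauss (t ^ 2) x * x ^ 2) + (- / t ^ 2) * (gauss (t ^ 2) x * x ^ 0)).
    apply Rle_trans with (E (/ t) * RInt f0 0 L + 0 * RInt f0 0 L); [lra|].
    assert (Hf0 : smooth f0) by (unfold f0; smoothness).
    rewrite <- RInt_lin by auto. unfold f0.
    apply RInt_mono; [lra|smoothness|smoothness|].
    intros x Hx. rewrite pow_O.
    assert (Eq : exp (U x) = E x * gauss (t ^ 2) x).
    { unfold E, gauss. rewrite <- exp_plus. f_equal. ring. }
    rewrite Eq.
    replace (E (/ t) * (1 * (gauss (t ^ 2) x * x ^ 2) + - / t ^ 2 * (gauss (t ^ 2) x * 1))
      + 0 * (1 * (gauss (t ^ 2) x * x ^ 2) + - / t ^ 2 * (gauss (t ^ 2) x * 1)))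
      with (gauss (t ^ 2) x * (E (/ t) * (x ^ 2 - / t ^ 2))) by ring.
    replace (1 * (E x * gauss (t ^ 2) x * x ^ 2) + - / t ^ 2 * (E x * gauss (t ^ 2) x * 1))
      with (gauss (t ^ 2) x * (E x * (x ^ 2 - / t ^ 2))) by ring.
    apply Rmult_le_compat_l; [apply Rlt_le, gauss_pos|].
    assert (Hit : 0 < / t) by (apply Rinv_0_lt_compat; lra).
    replace (x ^ 2 - / t ^ 2) with ((x - / t) * (x + / t)) by (field; lra).
    destruct (Rle_dec x (/ t)) as [Hc|Hc].
    - assert (E x <= E (/ t)).
      { unfold E. pose proof (Umono x (/ t) (conj (proj1 Hx) Hc)) as [K|K]; [left;
        apply exp_increasing; auto|rewrite K; lra]. }
      assert (0 <= (/ t - x) * (x + / t)) by (apply Rmult_le_pos; lra). nra.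
    - assert (E (/ t) <= E x).
      { unfold E. assert (K : U (/ t) + t ^ 2 * (/ t) ^ 2 / 2 <= U x + t ^ 2 * x ^ 2 / 2)
        by (apply Umono; lra).
        destruct K as [K|K]; [left; apply exp_increasing; auto|rewrite K; lra]. }
      assert (0 <= (x - / t) * (x + / t)) by (apply Rmult_le_pos; lra). nra. }
  rewrite 2!RInt_lin in H by smoothness.
  fold (mu 2) (mu 0) (gmom (t ^ 2) L 2) (gmom (t ^ 2) L 0) in H. fold Z in H.
  rewrite (gmom_step_eq (t ^ 2) L 0 Ht2) in H.
  replace (1 * (INR 1 / t ^ 2 * gmom (t ^ 2) L 0 - L ^ 1 / t ^ 2 * gauss (t ^ 2) L)
    + - / t ^ 2 * gmom (t ^ 2) L 0)
    with (- (L / t ^ 2 * gauss (t ^ 2) L)) in H by (simpl; field; lra).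
  assert (HE : E (/ t) <= 101 / 100).
  { unfold E. assert (Hit : 0 <= / t) by (apply Rlt_le, Rinv_0_lt_compat; lra).
    pose proof (Uup (/ t) Hit) as K.
    assert (K2 : U (/ t) + t ^ 2 * (/ t) ^ 2 / 2 <= 3 / 1000).
    { replace (k4 * (/ t) ^ 4 / 24) with (k4 / t ^ 4 / 24) in K by (field; lra).
      assert (k4 / t ^ 4 <= 665 / 10000) by (apply Rle_div_l; [apply pow_lt|]; lra). lra. }
    apply Rle_trans with (exp (3 / 1000)).
    { destruct K2 as [K2|K2]; [left; apply exp_increasing; auto|rewrite K2; lra]. }
    pose proof (exp_ineq1_le (- (3 / 1000))) as K3.
    assert (exp (3 / 1000) * exp (- (3 / 1000)) = 1) by (rewrite <- exp_plus, Rplus_opp_r;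
      apply exp_0).
    pose proof (exp_pos (3 / 1000)). nra. }
  set (y := t * L) in *.
  assert (HG : y * gauss (t ^ 2) L <= 6 / 10000).
  { unfold gauss. replace (t ^ 2 * L ^ 2 / 2) with (y ^ 2 / 2) by (unfold y; field).
    (* Write [exp (y^2 / 2)] as an eighth power, at least [(1 + y^2 / 16) ^ 8]. Since [y >= 6],
       seven factors are at least 3.25, and [3.25 ^ 7] exceeds 3829; the eighth is at least
       [y / 2]. *)
    assert (K : 3829 * (y / 2) <= exp (y ^ 2 / 2)).
    { replace (y ^ 2 / 2) with (INR 8 * (y ^ 2 / 16)) by (simpl; field).
      rewrite exp_mult_INR.
      assert (K0 : 1 + y ^ 2 / 16 <= exp (y ^ 2 / 16)) by apply exp_ineq1_le.
      assert (K1 : y / 2 <= 1 + y ^ 2 / 16) by nra.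
      assert (K2 : 325 / 100 <= 1 + y ^ 2 / 16) by nra.
      apply Rle_trans with ((1 + y ^ 2 / 16) ^ 8); [|apply pow_incr; nra].
      replace ((1 + y ^ 2 / 16) ^ 8) with ((1 + y ^ 2 / 16) ^ 7 * (1 + y ^ 2 / 16)) by ring.
      apply Rmult_le_compat; [lra|lra| |lra].
      apply Rle_trans with ((325 / 100) ^ 7); [lra|apply pow_incr; lra]. }
    assert (exp (y ^ 2 / 2) * exp (- (y ^ 2 / 2)) = 1) by (rewrite <- exp_plus, Rplus_opp_r;
      apply exp_0).
    pose proof (exp_pos (- (y ^ 2 / 2))). nra. }
  assert (H2 : - (101 / 100 * (y * gauss (t ^ 2) L)) <= (mu 2 * t ^ 2 - Z) * t).
  { assert (Hp : 0 <= y * gauss (t ^ 2) L) by (apply Rmult_le_pos; [lra|apply Rlt_le, gauss_pos]).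
    assert (E (/ t) * - (y * gauss (t ^ 2) L) <= (mu 2 * t ^ 2 - Z) * t).
    { replace ((mu 2 * t ^ 2 - Z) * t) with ((1 * mu 2 + - / t ^ 2 * Z) * t ^ 3) by (field; lra).
      replace (E (/ t) * - (y * gauss (t ^ 2) L)) with (E (/ t) * - (L / t ^ 2 * gauss (t ^ 2) L)
        * t ^ 3) by (unfold y; field; lra).
      apply Rmult_le_compat_r; [apply pow_le; lra|auto]. }
    nra. }
  pose proof mu0_scaled_lower. nra.
Qed.

Lemma PI_le_4 : PI <= 4. Proof. exact PI_4. Qed.

Lemma e2_nonneg : 0 <= e2.
Proof. apply Rle_trans with (exp (U L)); [apply Rlt_le, exp_pos|apply tail2; lra]. Qed.

Lemma e3_nonneg : 0 <= e3.
Proof. apply Rle_trans with (exp (U PI)); [apply Rlt_le, exp_pos|apply tail3; lra]. Qed.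

Lemma tail_bound (f : R -> R) c j : smooth f -> 0 <= c ->
  (forall x, L <= x <= PI -> Rabs (f x) <= c * (exp (U x) * x ^ j)) ->
  Rabs (RInt f L PI) <= c * tl j.
Proof.
  intros Hf Hc H. pose proof e2_nonneg as E2. pose proof e3_nonneg as E3. pose proof PI_le_4 as EP.
  rewrite (RInt_split f L sg PI) by auto.
  eapply Rle_trans; [apply Rabs_triang|].
  assert (H2 : Rabs (RInt f L sg) <= (sg - L) * (c * (e2 * sg ^ j))).
  { apply abs_RInt_le_const; [lra|apply smooth_ex_RInt; auto|].
    intros x Hx. eapply Rle_trans; [apply H; lra|].
    apply Rmult_le_compat_l; auto.
    apply Rmult_le_compat; [apply Rlt_le, exp_pos|apply pow_le; lra|apply tail2;
      lra|apply pow_incr; lra]. }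
  assert (H3 : Rabs (RInt f sg PI) <= (PI - sg) * (c * (e3 * 4 ^ j))).
  { apply abs_RInt_le_const; [lra|apply smooth_ex_RInt; auto|].
    intros x Hx. eapply Rle_trans; [apply H; lra|].
    apply Rmult_le_compat_l; auto.
    apply Rmult_le_compat; [apply Rlt_le, exp_pos|apply pow_le; lra|apply tail3;
      lra|apply pow_incr; lra]. }
  assert (0 <= c * (e2 * sg ^ j)) by (repeat apply Rmult_le_pos; auto; apply pow_le; lra).
  assert (0 <= c * (e3 * 4 ^ j)) by (repeat apply Rmult_le_pos; auto; apply pow_le; lra).
  assert ((sg - L) * (c * (e2 * sg ^ j)) <= sg * (c * (e2 * sg ^ j)))
    by (apply Rmult_le_compat_r; lra).
  assert ((PI - sg) * (c * (e3 * 4 ^ j)) <= 4 * (c * (e3 * 4 ^ j))) by (apply Rmult_le_compat_r;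
    lra).
  unfold tl. rewrite !pow_add, !pow_1. lra.
Qed.

(** By the triple-angle formulas the profile is [A - al], [A + al] at [-1/2], [1/2] and
    [A - D -+ (3 al + ga)] at [-3/2], [3/2]. Thus [D] and [ga] are, up to constants, its second and
    third differences, and their smallness shows in the kernels instead of arising by
    cancellation. *)
Let A : R := RInt (fun x => exp (U x) * cos (W x) * cos (x / 2)) 0 PI.
Let al : R := RInt (fun x => exp (U x) * sin (W x) * sin (x / 2)) 0 PI.
Let D : R := RInt (fun x => exp (U x) * cos (W x) * (4 * sin (x / 2) ^ 2 * cos (x / 2))) 0 PI.
Let ga : R := RInt (fun x => exp (U x) * sin (W x) * (- 4 * sin (x / 2) ^ 3)) 0 PI.

Lemma half_trig x : 0 <= x -> Rabs (sin (x / 2)) <= x / 2.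
Proof. intros Hx. rewrite <- (Rabs_right (x / 2)) at 2 by lra. apply abs_sin_le. Qed.

Lemma abs_cos_le1 x : Rabs (cos x) <= 1.
Proof. apply Rabs_le; pose proof (COS_bound x); lra. Qed.

Lemma abs_sin_le1 x : Rabs (sin x) <= 1.
Proof. apply Rabs_le; pose proof (SIN_bound x); lra. Qed.

Lemma Rabs_mult_le a b x y : Rabs a <= x -> Rabs b <= y -> Rabs (a * b) <= x * y.
Proof. intros. rewrite Rabs_mult. apply Rmult_le_compat; auto using Rabs_pos. Qed.

Lemma Rabs_exp_le x : Rabs (exp x) <= exp x.
Proof. rewrite Rabs_right; [lra|apply Rle_ge, Rlt_le, exp_pos]. Qed.

Lemma sin_half_pow_le x n : 0 <= x -> Rabs (sin (x / 2) ^ n) <= (x / 2) ^ n.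
Proof. intros Hx. rewrite <- RPow_abs. apply pow_incr. split; [apply Rabs_pos|apply half_trig;
  auto]. Qed.

Lemma W2_le x : 0 <= x -> W x ^ 2 <= k3 ^ 2 / 36 * x ^ 6.
Proof.
  intros Hx. replace (k3 ^ 2 / 36 * x ^ 6) with ((k3 * x ^ 3 / 6) ^ 2) by field.
  apply pow_maj_Rabs, Wb; auto.
Qed.

Lemma A_upper : A <= Z + tl 0.
Proof.
  unfold A. rewrite (RInt_split _ 0 L PI) by smoothness.
  apply Rplus_le_compat.
  - unfold Z, mu. apply RInt_mono; [lra|smoothness|smoothness|].
    intros x Hx. rewrite pow_O, Rmult_1_r.
    eapply Rle_trans; [apply Rle_abs|].
    rewrite <- (Rmult_1_r (exp (U x))) at 2. rewrite <- (Rmult_1_r (exp (U x))) at 2.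
    apply Rabs_mult_le; [|apply abs_cos_le1]. apply Rabs_mult_le;
      [apply Rabs_exp_le|apply abs_cos_le1].
  - eapply Rle_trans; [apply Rle_abs|]. rewrite <- (Rmult_1_l (tl 0)).
    apply tail_bound; [smoothness|lra|].
    intros x Hx. rewrite pow_O, Rmult_1_l.
    apply Rabs_mult_le; [|apply abs_cos_le1]. rewrite <- (Rmult_1_r (exp (U x))) at 2.
    apply Rabs_mult_le; [apply Rabs_exp_le|apply abs_cos_le1].
Qed.

(** As both cosines are at most 1, [cos (W x) * cos (x / 2)] is at least the sum of the two minus 1.
    The phase therefore costs at most [W^2 / 2], whence the sixth moment, and the half angle at most
    [L^2 / 8]. *)
Lemma A_lower : Z * (1 - L ^ 2 / 8) - k3 ^ 2 / 72 * mu 6 - tl 0 <= A.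
Proof.
  unfold A. rewrite (RInt_split _ 0 L PI) by smoothness.
  assert (H1 : Z * (1 - L ^ 2 / 8) - k3 ^ 2 / 72 * mu 6
    <= RInt (fun x => exp (U x) * cos (W x) * cos (x / 2)) 0 L).
  { apply Rle_trans with (RInt (fun x => (1 - L ^ 2 / 8) * (exp (U x) * x ^ 0)
    + (- (k3 ^ 2 / 72)) * (exp (U x) * x ^ 6)) 0 L).
    - rewrite RInt_lin by smoothness. fold (mu 0) (mu 6). fold Z. lra.
    - apply RInt_mono; [lra|smoothness|smoothness|].
      intros x Hx. rewrite pow_O.
      replace ((1 - L ^ 2 / 8) * (exp (U x) * 1) + - (k3 ^ 2 / 72) * (exp (U x) * x ^ 6))
        with (exp (U x) * (1 - L ^ 2 / 8 - k3 ^ 2 / 72 * x ^ 6)) by ring.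
      rewrite (Rmult_assoc (exp (U x)) (cos (W x))). apply Rmult_le_compat_l;
        [apply Rlt_le, exp_pos|].
      pose proof (cos_ge_quad (W x)). pose proof (cos_ge_quad (x / 2)).
      pose proof (W2_le x (proj1 Hx)). pose proof (COS_bound (W x)). pose proof (COS_bound (x / 2)).
      assert (x ^ 2 <= L ^ 2) by (apply pow_incr; lra).
      assert (cos (W x) * cos (x / 2) >= cos (W x) - (1 - cos (x / 2))) by nra.
      lra. }
  assert (H2 : Rabs (RInt (fun x => exp (U x) * cos (W x) * cos (x / 2)) L PI) <= 1 * tl 0).
  { apply tail_bound; [smoothness|lra|].
    intros x Hx. rewrite pow_O, Rmult_1_l.
    apply Rabs_mult_le; [|apply abs_cos_le1]. rewrite <- (Rmult_1_r (exp (U x))) at 2.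
    apply Rabs_mult_le; [apply Rabs_exp_le|apply abs_cos_le1]. }
  apply Rabs_le_between in H2. lra.
Qed.

Lemma al_bound : Rabs al <= k3 / 12 * mu 4 + tl 1.
Proof.
  unfold al. rewrite (RInt_split _ 0 L PI) by smoothness.
  eapply Rle_trans; [apply Rabs_triang|]. apply Rplus_le_compat.
  - eapply Rle_trans; [apply abs_RInt_le; [lra|apply smooth_ex_RInt; smoothness]|].
    apply Rle_trans with (RInt (fun x => k3 / 12 * (exp (U x) * x ^ 4)
      + 0 * (exp (U x) * x ^ 4)) 0 L).
    2:{ rewrite RInt_lin by smoothness. fold (mu 4). lra. }
    apply RInt_le; [lra| |apply smooth_ex_RInt; smoothness|].
    { apply (ex_RInt_continuous (V := R_CompleteNormedModule)). intros z _.
      apply continuous_comp; [|apply continuous_Rabs].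
      apply (@ex_derive_continuous R_AbsRing R_NormedModule). auto_derive; auto. }
    intros x Hx.
    replace (k3 / 12 * (exp (U x) * x ^ 4) + 0 * (exp (U x) * x ^ 4))
      with (exp (U x) * (k3 * x ^ 3 / 6) * (x / 2)) by field.
    apply Rabs_mult_le; [|apply half_trig; lra]. apply Rabs_mult_le; [apply Rabs_exp_le|].
    eapply Rle_trans; [apply abs_sin_le|]. apply Wb; lra.
  - rewrite <- (Rmult_1_l (tl 1)). apply tail_bound; [smoothness|lra|].
    intros x Hx. rewrite pow_1, Rmult_1_l.
    apply Rabs_mult_le; [|eapply Rle_trans; [apply half_trig; lra|lra]].
    rewrite <- (Rmult_1_r (exp (U x))) at 2.
    apply Rabs_mult_le; [apply Rabs_exp_le|apply abs_sin_le1].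
Qed.

Lemma ga_bound : Rabs ga <= k3 / 12 * mu 6 + / 2 * tl 3.
Proof.
  unfold ga. rewrite (RInt_split _ 0 L PI) by smoothness.
  assert (H4 : forall x, 0 <= x -> Rabs (- 4 * sin (x / 2) ^ 3) <= x ^ 3 / 2).
  { intros x Hx. replace (x ^ 3 / 2) with (4 * (x / 2) ^ 3) by field.
    apply Rabs_mult_le; [|apply sin_half_pow_le; auto]. rewrite Rabs_left; lra. }
  eapply Rle_trans; [apply Rabs_triang|]. apply Rplus_le_compat.
  - eapply Rle_trans; [apply abs_RInt_le; [lra|apply smooth_ex_RInt; smoothness]|].
    apply Rle_trans with (RInt (fun x => k3 / 12 * (exp (U x) * x ^ 6)
      + 0 * (exp (U x) * x ^ 6)) 0 L).
    2:{ rewrite RInt_lin by smoothness. fold (mu 6). lra. }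
    apply RInt_le; [lra| |apply smooth_ex_RInt; smoothness|].
    { apply (ex_RInt_continuous (V := R_CompleteNormedModule)). intros z _.
      apply continuous_comp; [|apply continuous_Rabs].
      apply (@ex_derive_continuous R_AbsRing R_NormedModule). auto_derive; auto. }
    intros x Hx.
    replace (k3 / 12 * (exp (U x) * x ^ 6) + 0 * (exp (U x) * x ^ 6))
      with (exp (U x) * (k3 * x ^ 3 / 6) * (x ^ 3 / 2)) by field.
    apply Rabs_mult_le; [|apply H4; lra]. apply Rabs_mult_le; [apply Rabs_exp_le|].
    eapply Rle_trans; [apply abs_sin_le|]. apply Wb; lra.
  - apply tail_bound; [smoothness|lra|].
    intros x Hx. replace (/ 2 * (exp (U x) * x ^ 3)) with (exp (U x) * 1 * (x ^ 3 / 2)) by field.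
    apply Rabs_mult_le; [|apply H4; lra].
    apply Rabs_mult_le; [apply Rabs_exp_le|apply abs_sin_le1].
Qed.

Lemma D_kernel_le x : 0 <= x -> Rabs (4 * sin (x / 2) ^ 2 * cos (x / 2)) <= x ^ 2.
Proof.
  intros Hx. replace (x ^ 2) with (4 * (x / 2) ^ 2 * 1) by field.
  apply Rabs_mult_le; [|apply abs_cos_le1]. apply Rabs_mult_le; [rewrite Rabs_right;
    lra|apply sin_half_pow_le; auto].
Qed.

Lemma D_kernel_ge x : 0 <= x <= L -> x ^ 2 * (1 - L ^ 2 / 4) <= 4 * sin (x / 2) ^ 2 * cos (x / 2).
Proof.
  intros Hx.
  assert (x ^ 2 <= L ^ 2) by (apply pow_incr; lra).
  set (y := x / 2). assert (Ey : x = 2 * y) by (unfold y; lra). rewrite Ey in *. clearbody y.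
  assert (K1 := sin_ge_cubic y ltac:(lra)). assert (K2 := cos_ge_quad y).
  assert (y ^ 2 <= / 1000) by nra.
  assert (K3 : y * (1 - y ^ 2 / 6) <= sin y) by (replace (y * (1 - y ^ 2 / 6))
    with (y - y ^ 3 / 6) by field; auto).
  assert (K4 : (y * (1 - y ^ 2 / 6)) ^ 2 <= sin y ^ 2) by (apply pow_incr; split;
    [apply Rmult_le_pos; lra|auto]).
  assert (K5 : y ^ 2 * (1 - y ^ 2 / 3) <= sin y ^ 2).
  { eapply Rle_trans; [|apply K4]. replace ((y * (1 - y ^ 2 / 6)) ^ 2)
    with (y ^ 2 * (1 - y ^ 2 / 3 + y ^ 4 / 36)) by field.
    apply Rmult_le_compat_l; [apply pow2_ge_0|]. assert (0 <= y ^ 4) by (apply pow_le; lra). lra. }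
  assert (0 <= y ^ 2) by apply pow2_ge_0.
  assert (K6 : y ^ 2 * (1 - y ^ 2 / 3) * (1 - y ^ 2 / 2) <= sin y ^ 2 * cos y).
  { apply Rmult_le_compat; [apply Rmult_le_pos; lra|lra|auto|auto]. }
  assert (K7 : y ^ 2 * (1 - y ^ 2) <= y ^ 2 * (1 - y ^ 2 / 3) * (1 - y ^ 2 / 2)).
  { rewrite Rmult_assoc. apply Rmult_le_compat_l; auto. nra. }
  assert (y ^ 2 <= L ^ 2 / 4) by nra.
  assert (y ^ 2 * (1 - L ^ 2 / 4) <= y ^ 2 * (1 - y ^ 2)) by (apply Rmult_le_compat_l; lra).
  nra.
Qed.

Lemma D_lower : mu 2 * (1 - L ^ 2 / 4) - k3 ^ 2 / 72 * mu 8 - tl 2 <= D.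
Proof.
  unfold D. rewrite (RInt_split _ 0 L PI) by smoothness.
  assert (H1 : mu 2 * (1 - L ^ 2 / 4) - k3 ^ 2 / 72 * mu 8
    <= RInt (fun x => exp (U x) * cos (W x) * (4 * sin (x / 2) ^ 2 * cos (x / 2))) 0 L).
  { apply Rle_trans with (RInt (fun x => (1 - L ^ 2 / 4) * (exp (U x) * x ^ 2)
    + (- (k3 ^ 2 / 72)) * (exp (U x) * x ^ 8)) 0 L).
    - rewrite RInt_lin by smoothness. fold (mu 2) (mu 8). lra.
    - apply RInt_mono; [lra|smoothness|smoothness|].
      intros x Hx.
      replace ((1 - L ^ 2 / 4) * (exp (U x) * x ^ 2) + - (k3 ^ 2 / 72) * (exp (U x) * x ^ 8))
        with (exp (U x) * (x ^ 2 * (1 - L ^ 2 / 4) - k3 ^ 2 / 72 * x ^ 6 * x ^ 2)) by ring.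
      rewrite (Rmult_assoc (exp (U x)) (cos (W x))). apply Rmult_le_compat_l;
        [apply Rlt_le, exp_pos|].
      set (sn := 4 * sin (x / 2) ^ 2 * cos (x / 2)).
      pose proof (cos_ge_quad (W x)). pose proof (W2_le x (proj1 Hx)). pose proof (COS_bound (W x)).
      pose proof (D_kernel_ge x Hx) as K1. pose proof (D_kernel_le x (proj1 Hx)) as K2.
      fold sn in K1, K2. apply Rabs_le_between in K2.
      assert (0 <= x ^ 2) by apply pow2_ge_0.
      assert (0 <= sn) by (eapply Rle_trans; [|apply K1]; apply Rmult_le_pos; lra).
      assert ((1 - cos (W x)) * sn <= k3 ^ 2 / 72 * x ^ 6 * x ^ 2) by (apply Rmult_le_compat; lra).
      lra. }
  assert (H2 : Rabs (RInt (fun x => exp (U x) * cos (W x) * (4 * sin (x / 2) ^ 2 * cos (x / 2)))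
    L PI) <= 1 * tl 2).
  { apply tail_bound; [smoothness|lra|].
    intros x Hx. rewrite Rmult_1_l.
    apply Rabs_mult_le; [|apply D_kernel_le; lra]. rewrite <- (Rmult_1_r (exp (U x))) at 2.
    apply Rabs_mult_le; [apply Rabs_exp_le|apply abs_cos_le1]. }
  apply Rabs_le_between in H2. lra.
Qed.

Lemma D_upper : D <= L ^ 2 * Z + tl 2.
Proof.
  unfold D. rewrite (RInt_split _ 0 L PI) by smoothness.
  apply Rplus_le_compat.
  - apply Rle_trans with (RInt (fun x => L ^ 2 * (exp (U x) * x ^ 0)
    + 0 * (exp (U x) * x ^ 0)) 0 L).
    2:{ rewrite RInt_lin by smoothness. fold (mu 0). fold Z. lra. }
    apply RInt_mono; [lra|smoothness|smoothness|].
    intros x Hx. rewrite pow_O.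
    replace (L ^ 2 * (exp (U x) * 1) + 0 * (exp (U x) * 1)) with (exp (U x) * 1 * L ^ 2) by ring.
    eapply Rle_trans; [apply Rle_abs|].
    apply Rabs_mult_le; [apply Rabs_mult_le; [apply Rabs_exp_le|apply abs_cos_le1]|].
    eapply Rle_trans; [apply D_kernel_le; lra|apply pow_incr; lra].
  - eapply Rle_trans; [apply Rle_abs|]. rewrite <- (Rmult_1_l (tl 2)).
    apply tail_bound; [smoothness|lra|].
    intros x Hx. rewrite Rmult_1_l.
    apply Rabs_mult_le; [|apply D_kernel_le; lra]. rewrite <- (Rmult_1_r (exp (U x))) at 2.
    apply Rabs_mult_le; [apply Rabs_exp_le|apply abs_cos_le1].
Qed.

Lemma scaled_bounds :
  0 < A /\ 84 / 100 * A <= D * t ^ 2 /\ D <= A / 100 /\ Rabs al * t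
    <= 75 / 1000 * A /\ Rabs ga * t ^ 3 <= 45 / 100 * A.
Proof.
  pose proof A_upper as A1. pose proof A_lower as A2. pose proof al_bound as B.
  pose proof ga_bound as G. pose proof D_lower as D1. pose proof D_upper as D2.
  pose proof mu4_le as M4. pose proof mu6_le as M6. pose proof mu8_le as M8.
  pose proof mu2_lower as M2. pose proof mu0_scaled_lower as Zl. pose proof mu0_pos as Zp.
  pose proof t2_pos as Ht2.
  assert (Ht3 : 0 < t ^ 3) by (apply pow_lt; lra).
  (* Since [t * Z >= 0.94], each hypothesis on the tails turns into a bound relative to [Z]. *)
  assert (T0 : tl 0 <= 27 / 10000 * Z).
  { apply Rmult_le_reg_l with t; nra. }
  assert (T1 : t * tl 1 <= 27 / 10000 * Z).
  { apply Rmult_le_reg_l with t; [lra|]. replace (t * (t * tl 1)) with (t ^ 2 * tl 1) by ring.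
    nra. }
  assert (T2 : t ^ 2 * tl 2 <= 32 / 10000 * Z).
  { apply Rmult_le_reg_l with t; [lra|]. replace (t * (t ^ 2 * tl 2)) with (t ^ 3 * tl 2)
    by ring. nra. }
  assert (T3 : t ^ 3 * tl 3 <= 469 / 10000 * Z).
  { apply Rmult_le_reg_l with t; [lra|]. replace (t * (t ^ 3 * tl 3)) with (t ^ 4 * tl 3)
    by ring. nra. }
  set (r := k3 / t ^ 3).
  assert (Hr : 0 <= r <= 2328 / 10000).
  { unfold r; split; [apply Rle_mult_inv_pos; lra|apply Rle_div_l; lra]. }
  assert (Hr2 : r ^ 2 <= (2328 / 10000) ^ 2) by (apply pow_incr; auto).
  assert (Ek : k3 = r * t ^ 3) by (unfold r; field; lra).
  assert (P4 : 0 <= mu 4 * t ^ 4).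
  { apply Rmult_le_pos; [|apply pow_le; lra]. apply RInt_ge_0; [lra|apply smooth_ex_RInt;
    smoothness|].
    intros x Hx; apply Rmult_le_pos; [apply Rlt_le, exp_pos|apply pow_le; lra]. }
  assert (P6 : 0 <= mu 6 * t ^ 6).
  { apply Rmult_le_pos; [|apply pow_le; lra]. apply RInt_ge_0; [lra|apply smooth_ex_RInt;
    smoothness|].
    intros x Hx; apply Rmult_le_pos; [apply Rlt_le, exp_pos|apply pow_le; lra]. }
  assert (P8 : 0 <= mu 8 * t ^ 8).
  { apply Rmult_le_pos; [|apply pow_le; lra]. apply RInt_ge_0; [lra|apply smooth_ex_RInt;
    smoothness|].
    intros x Hx; apply Rmult_le_pos; [apply Rlt_le, exp_pos|apply pow_le; lra]. }
  assert (Q6 : k3 ^ 2 / 72 * mu 6 <= 1585 / 100000 * Z).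
  { replace (k3 ^ 2 / 72 * mu 6) with (r ^ 2 / 72 * (mu 6 * t ^ 6)) by (rewrite Ek; field).
    apply Rle_trans with ((2328 / 10000) ^ 2 / 72 * (2105 / 100 * Z)); [|lra].
    apply Rmult_le_compat; [pose proof (pow2_ge_0 r); lra|lra|lra|lra]. }
  assert (Q8 : k3 ^ 2 / 72 * mu 8 * t ^ 2 <= 1505 / 10000 * Z).
  { replace (k3 ^ 2 / 72 * mu 8 * t ^ 2) with (r ^ 2 / 72 * (mu 8 * t ^ 8)) by (rewrite Ek; field).
    apply Rle_trans with ((2328 / 10000) ^ 2 / 72 * (1999 / 10 * Z)); [|lra].
    apply Rmult_le_compat; [pose proof (pow2_ge_0 r); lra|lra|lra|lra]. }
  assert (B4 : k3 / 12 * mu 4 * t <= 679 / 10000 * Z).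
  { replace (k3 / 12 * mu 4 * t) with (r / 12 * (mu 4 * t ^ 4)) by (rewrite Ek; field). nra. }
  assert (G6 : k3 / 12 * mu 6 * t ^ 3 <= 4084 / 10000 * Z).
  { replace (k3 / 12 * mu 6 * t ^ 3) with (r / 12 * (mu 6 * t ^ 6)) by (rewrite Ek; field). nra. }
  assert (HL0 : 0 <= L ^ 2) by apply pow2_ge_0.
  assert (AL : 981 / 1000 * Z <= A) by nra.
  assert (HT2 : 100 <= t ^ 2) by nra.
  (* The squared phase takes up to 0.1505 off the leading value 0.998; this is by far the largest
     loss in [D], and the tails take only 0.0032. *)
  assert (D3 : 843 / 1000 * Z <= D * t ^ 2).
  { assert (mu 2 * (1 - L ^ 2 / 4) * t ^ 2 - k3 ^ 2 / 72 * mu 8 * t ^ 2 - t ^ 2 * tl 2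
    <= D * t ^ 2) by nra.
    assert (998 / 1000 * Z <= mu 2 * (1 - L ^ 2 / 4) * t ^ 2) by nra. lra. }
  repeat split.
  - lra.
  - lra.
  - assert (tl 2 <= 32 / 1000000 * Z).
    { destruct (Rle_dec (tl 2) 0); [lra|].
      assert (100 * tl 2 <= t ^ 2 * tl 2) by (apply Rmult_le_compat_r; lra). lra. }
    pose proof (Rmult_le_compat_r Z _ _ (Rlt_le _ _ Zp) HL2). lra.
  - apply (Rmult_le_compat_r t) in B; lra.
  - apply (Rmult_le_compat_r (t ^ 3)) in G; lra.
Qed.

Let w (y : R) : R := RInt (fun x => exp (U x) * cos (W x - y * x)) 0 PI.

Lemma profile_values : w (- (3 / 2)) = A - D - (3 * al + ga) /\ w (- (1 / 2)) = A - al /\ w (1 /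
  2) = A + al /\ w (3 / 2) = A - D + (3 * al + ga).
Proof.
  assert (c3 : forall x, cos (3 / 2 * x) = cos (x / 2) - 4 * sin (x / 2) ^ 2 * cos (x / 2)).
  { intros x. replace (3 / 2 * x) with (2 * (x / 2) + x / 2) by field.
    rewrite cos_plus, cos_2a_sin, sin_2a. ring. }
  assert (s3 : forall x, sin (3 / 2 * x) = 3 * sin (x / 2) - 4 * sin (x / 2) ^ 3).
  { intros x. replace (3 / 2 * x) with (2 * (x / 2) + x / 2) by field.
    rewrite sin_plus, cos_2a_sin, sin_2a.
    replace (2 * sin (x / 2) * cos (x / 2) * cos (x / 2))
      with (2 * sin (x / 2) * (cos (x / 2) * cos (x / 2))) by ring.
    pose proof (sin2_cos2 (x / 2)) as E; unfold Rsqr in E.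
    replace (cos (x / 2) * cos (x / 2)) with (1 - sin (x / 2) * sin (x / 2)) by lra. ring. }
  assert (H1 : forall e, e = 1 \/ e = -1 -> w (e * (1 / 2)) = A + e * al).
  { intros e He. unfold w, A, al. rewrite <- (Rmult_1_l (RInt (fun x => exp (U x) * cos (W x) *
    cos (x / 2)) 0 PI)).
    rewrite <- RInt_lin by smoothness. apply RInt_eq. intros x.
    rewrite cos_minus. replace (e * (1 / 2) * x) with (e * (x / 2)) by field.
    destruct He as [-> | ->]; [rewrite Rmult_1_l|replace (-1 * (x / 2)) with (- (x / 2)) by ring;
      rewrite cos_neg, sin_neg]; ring. }
  assert (H3 : forall e, e = 1 \/ e = -1 -> w (e * (3 / 2)) = (1 * A + -1 * D) + e * (3 * al
    + 1 * ga)).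
  { intros e He. unfold w, A, al, D, ga. rewrite <- 2!RInt_lin by smoothness.
    rewrite <- (Rmult_1_l (RInt (fun x => 1 * _ + -1 * _) 0 PI)).
    rewrite <- RInt_lin by smoothness. apply RInt_eq. intros x.
    rewrite cos_minus. replace (e * (3 / 2) * x) with (e * (3 / 2 * x)) by field.
    destruct He as [-> | ->]; [rewrite Rmult_1_l|replace (-1 * (3 / 2 * x))
      with (- (3 / 2 * x)) by ring; rewrite cos_neg, sin_neg]; rewrite c3, s3; ring. }
  replace (- (3 / 2)) with (-1 * (3 / 2)) by ring. replace (- (1 / 2)) with (-1 * (1 / 2)) by ring.
  rewrite <- (Rmult_1_l (w (1 / 2))), <- (Rmult_1_l (w (3 / 2))).
  rewrite <- (Rmult_1_l (1 / 2)) at 2. rewrite <- (Rmult_1_l (3 / 2)) at 2.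
  rewrite !H1, !H3 by auto. repeat split; ring.
Qed.

Theorem local_limit_turan :
  0 < 4 * (w (- (1 / 2)) ^ 2 - w (- (3 / 2)) * w (1 / 2)) * (w (1 / 2) ^ 2 - w (- (1 / 2)) * w (3
    / 2))
    - (w (- (1 / 2)) * w (1 / 2) - w (- (3 / 2)) * w (3 / 2)) ^ 2.
Proof.
  destruct profile_values as [-> [-> [-> ->]]].
  destruct scaled_bounds as [S1 [S2 [S3 [S4 S5]]]].
  exact (cubic_discriminant_pos A D al ga t S1 Ht S2 S3 S4 S5).
Qed.

End LocalLimit.

(** * A single factor [(1 + z) / (1 - z)] *)

Definition artanh (x : R) := / 2 * ln ((1 + x) / (1 - x)).

Lemma artanh_derive x : -1 < x < 1 -> is_derive artanh x (/ (1 - x ^ 2)).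
Proof.
  intros Hx. unfold artanh. auto_derive.
  - split; [|split; [|easy]]; [lra|]. apply Rmult_lt_0_compat; [lra|]. apply Rinv_0_lt_compat; lra.
  - field. repeat split; nra.
Qed.

Lemma artanh_0 : artanh 0 = 0.
Proof. unfold artanh. replace ((1 + 0) / (1 - 0)) with 1 by field. rewrite ln_1. ring. Qed.

Lemma artanh_opp x : -1 < x < 1 -> artanh (- x) = - artanh x.
Proof.
  intros Hx. unfold artanh.
  replace ((1 + - x) / (1 - - x)) with (/ ((1 + x) / (1 - x))) by (field; lra).
  rewrite ln_Rinv; [ring|]. apply Rdiv_lt_0_compat; lra.
Qed.

Lemma artanh_ge_cubic x : 0 <= x < 1 -> x + x ^ 3 / 3 <= artanh x.
Proof.
  intros Hx.
  pose proof (deriv_nonneg_le (fun y => artanh y - (y + y ^ 3 / 3)) (fun y => / (1 - y ^ 2) - (1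
    + y ^ 2)) 0 x (proj1 Hx)) as H.
  cbv beta in H. rewrite artanh_0 in H.
  cut (0 - (0 + 0 ^ 3 / 3) <= artanh x - (x + x ^ 3 / 3)); [lra|].
  apply H.
  - intros y Hy. apply (is_derive_minus (V := R_NormedModule) artanh); [apply artanh_derive; lra|].
    auto_derive; [easy|]; field.
  - intros y Hy. assert (0 < 1 - y ^ 2) by nra.
    replace (/ (1 - y ^ 2) - (1 + y ^ 2)) with (y ^ 4 / (1 - y ^ 2)) by (field; lra).
    apply Rle_mult_inv_pos; auto. apply pow_le; lra.
Qed.

Lemma artanh_chord c x : 0 <= c <= 1 -> 0 <= x < 1 -> artanh (c * x) <= c * artanh x.
Proof.
  intros Hc Hx.
  pose proof (deriv_nonneg_le (fun y => c * artanh y - artanh (c * y)) (fun y => c * / (1 - y ^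
    2) - c * / (1 - (c * y) ^ 2)) 0 x (proj1 Hx)) as H.
  cbv beta in H. rewrite Rmult_0_r, artanh_0 in H.
  cut (c * 0 - 0 <= c * artanh x - artanh (c * x)); [lra|].
  apply H.
  - intros y Hy. apply (is_derive_minus (V := R_NormedModule) (fun y => c * artanh y)).
    + apply (is_derive_scal artanh). apply artanh_derive; lra.
    + apply (is_derive_comp artanh (fun y => c * y)); [apply artanh_derive; nra|].
      auto_derive; [easy|ring].
  - intros y Hy. assert (0 < 1 - y ^ 2) by nra.
    assert (0 <= c * y <= y) by nra.
    assert (1 - y ^ 2 <= 1 - (c * y) ^ 2) by nra.
    assert (/ (1 - (c * y) ^ 2) <= / (1 - y ^ 2)) by (apply Rinv_le_contravar; lra). nra.
Qed.

Section Factor.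

Variable rho : R.
Hypothesis Hrho : 0 < rho < 1.

Let q := 2 * rho / (1 + rho ^ 2).

(* [(1 + z) / (1 - z) = (1 + rho) / (1 - rho) * exp (fac_log phi + i * fac_arg phi)]
   for [z = rho * exp (i * phi)]. *)
Definition fac_log (phi : R) := artanh (q * cos phi) - artanh q.
Definition fac_arg (phi : R) := atan (2 * rho * sin phi / (1 - rho ^ 2)).

(** The squared modulus of [1 - z ^ 2] for [z = rho * exp (i * phi)], the common denominator of both
    derivatives. *)
Definition fac_den (phi : R) := (1 - rho ^ 2) ^ 2 + 4 * rho ^ 2 * sin phi ^ 2.

Lemma rho2_lt : 0 < 1 - rho ^ 2. Proof. nra. Qed.

Lemma q_bound : 0 < q < 1.
Proof.
  unfold q. assert (0 < 1 + rho ^ 2) by nra. split; [apply Rdiv_lt_0_compat; lra|].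
  apply Rlt_div_l; nra.
Qed.

Lemma q_cos_bound phi : -1 < q * cos phi < 1.
Proof. pose proof q_bound. pose proof (COS_bound phi). split; nra. Qed.

Lemma fac_den_pos phi : 0 < fac_den phi.
Proof.
  unfold fac_den. pose proof rho2_lt. pose proof (pow2_ge_0 (sin phi)).
  assert (0 < (1 - rho ^ 2) ^ 2) by (apply pow_lt; auto). nra.
Qed.

Lemma cos2_sin2 x : cos x ^ 2 = 1 - sin x ^ 2.
Proof. pose proof (sin2_cos2 x) as E; unfold Rsqr in E. simpl; lra. Qed.

Lemma fac_log_derive phi :
  is_derive fac_log phi (- (2 * rho * (1 + rho ^ 2) * sin phi / fac_den phi)).
Proof.
  pose proof (q_cos_bound phi) as Hq. pose proof (fac_den_pos phi) as Hd.
  assert (0 < 1 + rho ^ 2) by nra.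
  replace (- (2 * rho * (1 + rho ^ 2) * sin phi / fac_den phi)) with
    (minus ((- (q * sin phi)) * (/ (1 - (q * cos phi) ^ 2))) 0).
  - apply (is_derive_minus (V := R_NormedModule)); [|apply (is_derive_const (artanh q))].
    apply (is_derive_comp artanh (fun x => q * cos x)); [apply artanh_derive; auto|].
    auto_derive; [easy|ring].
  - unfold minus, plus, opp; simpl.
    assert (Hne : (1 + rho ^ 2) ^ 2 - (2 * rho * cos phi) ^ 2 = fac_den phi).
    { unfold fac_den. rewrite Rpow_mult_distr, cos2_sin2. ring. }
    rewrite <- Hne in *. unfold q. field. split; nra.
Qed.

Lemma fac_arg_derive phi :
  is_derive fac_arg phi (2 * rho * (1 - rho ^ 2) * cos phi / fac_den phi).
Proof.
  pose proof rho2_lt. pose proof (fac_den_pos phi) as Hd. unfold fac_den in Hd.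
  unfold fac_arg. auto_derive; [easy|].
  unfold fac_den. field. repeat split; try nra.
Qed.

Lemma fac_log_0 : fac_log 0 = 0.
Proof. unfold fac_log. rewrite cos_0, Rmult_1_r. ring. Qed.

Lemma fac_arg_0 : fac_arg 0 = 0.
Proof. unfold fac_arg. rewrite sin_0, Rmult_0_r. unfold Rdiv. rewrite Rmult_0_l. apply atan_0. Qed.

(** [cum1], ..., [cum4] come from applying [rho * d / d rho] one to four times to
    [ln ((1 + rho) / (1 - rho))]; as series, [cum_i] is the sum of [2 * m ^ (i - 1) * rho ^ m] over
    odd [m]. *)
Definition cum1 := 2 * rho / (1 - rho ^ 2).
Definition cum2 := 2 * rho * (1 + rho ^ 2) / (1 - rho ^ 2) ^ 2.
Definition cum3 := 2 * rho * (1 + 6 * rho ^ 2 + rho ^ 4) / (1 - rho ^ 2) ^ 3.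
Definition cum4 := 2 * rho * (1 + rho ^ 2) * (1 + 22 * rho ^ 2 + rho ^ 4) / (1 - rho ^ 2) ^ 4.

(* The common shape of the derivative bounds: [m / (1 + k s^2)] against [m (1 - k s^2)]. *)
Lemma damped_le_cum a phi y : 0 <= a -> y <= phi -> 0 <= phi ->
  a * y / fac_den phi <= a / (1 - rho ^ 2) ^ 2 * phi.
Proof.
  intros Ha Hy Hp. pose proof rho2_lt. pose proof (fac_den_pos phi) as Hd.
  assert (Hd0 : 0 < (1 - rho ^ 2) ^ 2) by (apply pow_lt; auto).
  assert (Hdd : (1 - rho ^ 2) ^ 2 <= fac_den phi).
  { unfold fac_den. pose proof (pow2_ge_0 (sin phi)). nra. }
  apply Rle_div_l; auto.
  replace (a / (1 - rho ^ 2) ^ 2 * phi * fac_den phi) with (a * (phi * (fac_den phi / (1 - rho ^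
    2) ^ 2))) by (field; lra).
  apply Rmult_le_compat_l; auto.
  assert (1 <= fac_den phi / (1 - rho ^ 2) ^ 2) by (apply Rle_div_r; lra). nra.
Qed.

(** In the derivative, [sin p <= p] and [fac_den p >= fac_den 0]. Summed over the factors, this
    monotonicity is what Chebyshev's inequality requires in [mu2_lower]. *)
Lemma cum2_mono x y : 0 <= x <= y ->
  fac_log x + cum2 * x ^ 2 / 2 <= fac_log y + cum2 * y ^ 2 / 2.
Proof.
  intros Hxy.
  apply (deriv_nonneg_le (fun p => fac_log p + cum2 * p ^ 2 / 2)
    (fun p => - (2 * rho * (1 + rho ^ 2) * sin p / fac_den p) + cum2 * p)); [lra| |].
  - intros p Hp. apply (is_derive_plus (V := R_NormedModule)); [apply fac_log_derive|].
    auto_derive; [easy|field].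
  - intros p Hp. unfold cum2.
    assert (0 <= 2 * rho * (1 + rho ^ 2)) by nra.
    pose proof (damped_le_cum (2 * rho * (1 + rho ^ 2)) p (sin p)) as K.
    assert (sin p <= p) by (apply sin_le_id; lra).
    unfold Rdiv in *. lra.
Qed.

Lemma fac_log_lower phi : 0 <= phi -> - (cum2 * phi ^ 2 / 2) <= fac_log phi.
Proof.
  intros Hp. pose proof (cum2_mono 0 phi) as H. rewrite fac_log_0 in H. lra.
Qed.

Lemma damped_ge (m phi : R) : m <= 1 ->
  m - (4 * rho ^ 2 / (1 - rho ^ 2) ^ 2) * sin phi ^ 2 <= m * (1 - rho ^ 2) ^ 2 / fac_den phi.
Proof.
  intros Hm. pose proof rho2_lt. pose proof (fac_den_pos phi) as Hd.
  assert (Hd0 : 0 < (1 - rho ^ 2) ^ 2) by (apply pow_lt; auto).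
  set (k := 4 * rho ^ 2 / (1 - rho ^ 2) ^ 2). set (s2 := sin phi ^ 2).
  assert (Hs : 0 <= s2) by apply pow2_ge_0.
  assert (Hk : 0 <= k) by (apply Rle_mult_inv_pos; nra).
  replace (m * (1 - rho ^ 2) ^ 2 / fac_den phi) with (m / (1 + k * s2)).
  2:{ unfold k, s2. assert (E : fac_den phi = (1 - rho ^ 2) ^ 2 * (1
    + 4 * rho ^ 2 / (1 - rho ^ 2) ^ 2 * sin phi ^ 2)) by (unfold fac_den; field; lra).
      rewrite E. field. split; [lra|]. change ((1 - rho ^ 2) ^ 2
        + 4 * rho ^ 2 * sin phi ^ 2) with (fac_den phi). lra. }
  assert (0 <= k * s2) by nra.
  apply Rle_div_r; [lra|].
  replace ((m - k * s2) * (1 + k * s2)) with (m - (k * s2) * (1 - m + k * s2)) by ring.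
  assert (0 <= (k * s2) * (1 - m + k * s2)) by (apply Rmult_le_pos; lra). lra.
Qed.

Lemma sin2_le_id2 p : sin p ^ 2 <= p ^ 2.
Proof. rewrite <- (pow2_abs p). apply pow_maj_Rabs, abs_sin_le. Qed.

Lemma cum1_nonneg : 0 <= cum1.
Proof. pose proof rho2_lt. unfold cum1. apply Rle_mult_inv_pos; lra. Qed.

(** The derivative of [fac_log] is [- b * sin p / (1 + k * sin^2 p)]. The sine loses at most
    [p^3 / 6] and the damping at most [k * p^3]; since [cum4 = b * (1 + 6 * k)], together they give
    the Taylor coefficient exactly, for every [phi >= 0]. [fac_arg_lower] works alike with
    [cum3 = cum1 * (1 + 2 * k)]. *)
Lemma fac_log_upper phi : 0 <= phi ->
  fac_log phi <= - (cum2 * phi ^ 2 / 2) + cum4 * phi ^ 4 / 24.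
Proof.
  intros Hp. pose proof rho2_lt as Hr.
  assert (Hd0 : 0 < (1 - rho ^ 2) ^ 2) by (apply pow_lt; auto).
  set (b := 2 * rho * (1 + rho ^ 2) / (1 - rho ^ 2) ^ 2).
  set (k := 4 * rho ^ 2 / (1 - rho ^ 2) ^ 2).
  assert (Hb : 0 <= b) by (apply Rle_mult_inv_pos; nra).
  assert (Hk : 0 <= k) by (apply Rle_mult_inv_pos; nra).
  assert (E2 : cum2 = b) by reflexivity.
  assert (E4 : cum4 = b * (1 + 6 * k)) by (unfold cum4, b, k; field; lra).
  pose proof (deriv_nonneg_le (fun p => - (cum2 * p ^ 2 / 2) + cum4 * p ^ 4 / 24 - fac_log p)
    (fun p => - (cum2 * p) + cum4 * p ^ 3 / 6 - - (2 * rho * (1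
      + rho ^ 2) * sin p / fac_den p)) 0 phi Hp) as H.
  cbv beta in H. rewrite fac_log_0 in H.
  cut (- (cum2 * 0 ^ 2 / 2) + cum4 * 0 ^ 4 / 24 - 0 <= - (cum2 * phi ^ 2 / 2)
    + cum4 * phi ^ 4 / 24 - fac_log phi); [lra|].
  apply H; clear H.
  - intros p _. apply (is_derive_minus (V := R_NormedModule) (fun p => - (cum2 * p ^ 2 / 2)
    + cum4 * p ^ 4 / 24)); [|apply fac_log_derive].
    auto_derive; [easy|field].
  - intros p Hpp. pose proof (fac_den_pos p) as Hd.
    replace (2 * rho * (1 + rho ^ 2) * sin p / fac_den p)
      with (b * (sin p * (1 * (1 - rho ^ 2) ^ 2 / fac_den p)))
      by (unfold b; field; split; lra).
    rewrite E2, E4.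
    replace (- (b * p) + b * (1 + 6 * k) * p ^ 3 / 6 - - (b * (sin p * (1 * (1 - rho ^ 2) ^ 2 /
      fac_den p))))
      with (b * (sin p * (1 * (1 - rho ^ 2) ^ 2 / fac_den p) - (p - p ^ 3 / 6 - k * p ^ 3)))
        by (field; lra).
    apply Rmult_le_pos; auto. apply -> Rminus_le_0.
    set (F := 1 * (1 - rho ^ 2) ^ 2 / fac_den p).
    pose proof (damped_ge 1 p (Rle_refl 1)) as K. fold k F in K.
    pose proof (sin_ge_cubic p (proj1 Hpp)) as S1. pose proof (sin_le_id p (proj1 Hpp)) as S2.
    pose proof (sin2_le_id2 p) as S3.
    assert (P3 : 0 <= p ^ 3) by (apply pow_le; lra).
    assert (F1 : F <= 1).
    { unfold F. apply Rle_div_l; [auto|]. unfold fac_den. pose proof (pow2_ge_0 (sin p)). nra. }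
    assert (F0 : 0 <= F) by (unfold F; apply Rle_mult_inv_pos; lra).
    destruct (Rle_dec 0 (sin p)) as [Hs|Hs].
    + assert (sin p * (1 - k * sin p ^ 2) <= sin p * F) by (apply Rmult_le_compat_l; auto).
      assert (sin p * (k * sin p ^ 2) <= p * (k * p ^ 2)).
      { apply Rmult_le_compat; auto; [apply Rmult_le_pos;
        [auto|apply pow2_ge_0]|apply Rmult_le_compat_l; auto]. }
      replace (k * p ^ 3) with (p * (k * p ^ 2)) by ring. lra.
    + assert (0 <= k * p ^ 3) by (apply Rmult_le_pos; auto). nra.
Qed.

Lemma fac_arg_upper phi : 0 <= phi -> fac_arg phi <= cum1 * phi.
Proof.
  intros Hp. pose proof rho2_lt as Hr.
  assert (Hd0 : 0 < (1 - rho ^ 2) ^ 2) by (apply pow_lt; auto).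
  pose proof (deriv_nonneg_le (fun p => cum1 * p - fac_arg p)
    (fun p => cum1 - 2 * rho * (1 - rho ^ 2) * cos p / fac_den p) 0 phi Hp) as H.
  cbv beta in H. rewrite fac_arg_0 in H.
  cut (cum1 * 0 - 0 <= cum1 * phi - fac_arg phi); [lra|].
  apply H; clear H.
  - intros p _. apply (is_derive_minus (V := R_NormedModule) (fun p => cum1 * p));
    [|apply fac_arg_derive].
    auto_derive; [easy|ring].
  - intros p _. pose proof (fac_den_pos p) as Hd. apply -> Rminus_le_0.
    apply Rle_div_l; auto. pose proof (COS_bound p). pose proof (pow2_ge_0 (sin p)).
    apply Rle_trans with (2 * rho * (1 - rho ^ 2) * 1); [apply Rmult_le_compat_l; nra|].
    replace (2 * rho * (1 - rho ^ 2) * 1) with (cum1 * (1 - rho ^ 2) ^ 2) by (unfold cum1; field;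
      lra).
    apply Rmult_le_compat_l; [apply cum1_nonneg|]. unfold fac_den. nra.
Qed.

Lemma fac_arg_lower phi : 0 <= phi -> cum1 * phi - cum3 * phi ^ 3 / 6 <= fac_arg phi.
Proof.
  intros Hp. pose proof rho2_lt as Hr.
  assert (Hd0 : 0 < (1 - rho ^ 2) ^ 2) by (apply pow_lt; auto).
  set (k := 4 * rho ^ 2 / (1 - rho ^ 2) ^ 2).
  assert (Hk : 0 <= k) by (apply Rle_mult_inv_pos; nra).
  assert (E3 : cum3 = cum1 * (1 + 2 * k)) by (unfold cum3, cum1, k; field; lra).
  pose proof (deriv_nonneg_le (fun p => fac_arg p - (cum1 * p - cum3 * p ^ 3 / 6))
    (fun p => 2 * rho * (1 - rho ^ 2) * cos p / fac_den p - (cum1 - cum3 * p ^ 2 / 2)) 0 phi Hp)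
      as H.
  cbv beta in H. rewrite fac_arg_0 in H.
  cut (0 - (cum1 * 0 - cum3 * 0 ^ 3 / 6) <= fac_arg phi - (cum1 * phi - cum3 * phi ^ 3 / 6));
    [lra|].
  apply H; clear H.
  - intros p _. apply (is_derive_minus (V := R_NormedModule) fac_arg); [apply fac_arg_derive|].
    auto_derive; [easy|field].
  - intros p Hpp. pose proof (fac_den_pos p) as Hd.
    replace (2 * rho * (1 - rho ^ 2) * cos p / fac_den p)
      with (cum1 * (cos p * (1 - rho ^ 2) ^ 2 / fac_den p))
      by (unfold cum1; field; split; lra).
    rewrite E3.
    replace (cum1 * (cos p * (1 - rho ^ 2) ^ 2 / fac_den p) - (cum1 - cum1 * (1
      + 2 * k) * p ^ 2 / 2))
      with (cum1 * (cos p * (1 - rho ^ 2) ^ 2 / fac_den p - (1 - p ^ 2 / 2 - k * p ^ 2)))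
        by (field; lra).
    apply Rmult_le_pos; [apply cum1_nonneg|]. apply -> Rminus_le_0.
    pose proof (COS_bound p). pose proof (damped_ge (cos p) p ltac:(lra)) as K. fold k in K.
    pose proof (cos_ge_quad p). pose proof (sin2_le_id2 p).
    assert (k * sin p ^ 2 <= k * p ^ 2) by (apply Rmult_le_compat_l; auto). lra.
Qed.

Lemma artanh_q : artanh q = 2 * artanh rho.
Proof.
  unfold artanh, q. replace ((1 + 2 * rho / (1 + rho ^ 2)) / (1 - 2 * rho / (1 + rho ^ 2)))
    with (((1 + rho) / (1 - rho)) * ((1 + rho) / (1 - rho))).
  - rewrite ln_mult by (apply Rdiv_lt_0_compat; lra). field.
  - field. repeat split; nra.
Qed.

(* For [cos phi < 0] the two cubic bounds on [artanh] leave the slack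
   [1/3 - z + 4/3 z^3 = (2 z - 1)^2 (z + 1) / 3] with [z = - cos phi / (1 + rho^2)]. *)
Lemma fac_log_gain phi : fac_log phi <= - (2 * rho * (1 - cos phi)).
Proof.
  pose proof q_bound as Hq. pose proof (COS_bound phi) as Hc.
  pose proof (artanh_ge_cubic rho ltac:(lra)) as Hrr.
  assert (Hr3 : 0 < rho ^ 3) by (apply pow_lt; lra).
  unfold fac_log. rewrite artanh_q.
  assert (Hw : 0 < 1 + rho ^ 2) by nra.
  destruct (Rle_dec 0 (cos phi)) as [H|H].
  (* Here the chord bound from convexity is enough: it gives [- 2 * (1 - cos phi) * artanh rho], and
     [artanh rho >= rho]. *)
  - pose proof (artanh_chord (cos phi) q ltac:(lra) ltac:(lra)) as K.
    rewrite artanh_q in K. rewrite (Rmult_comm q).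
    assert (0 <= (1 - cos phi) * (artanh rho - rho)) by (apply Rmult_le_pos; lra). lra.
  - set (c := - cos phi). assert (Hc1 : 0 <= c <= 1) by (unfold c; lra).
    replace (q * cos phi) with (- (q * c)) by (unfold c; ring).
    replace (cos phi) with (- c) by (unfold c; ring).
    rewrite artanh_opp by nra.
    pose proof (artanh_ge_cubic (q * c) ltac:(nra)) as K.
    set (z := c / (1 + rho ^ 2)).
    assert (Hz : 0 <= z) by (apply Rle_mult_inv_pos; lra).
    assert (E : q * c + (q * c) ^ 3 / 3 - 2 * rho * c + 2 * rho ^ 3 / 3 = 2 * rho ^ 3 * ((2 * z -
      1) ^ 2 * (z + 1) / 3)).
    { unfold q, z. field. lra. }
    assert (0 <= 2 * rho ^ 3 * ((2 * z - 1) ^ 2 * (z + 1) / 3)).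
    { apply Rmult_le_pos; [lra|]. apply Rmult_le_pos; [|lra].
      apply Rmult_le_pos; [apply pow2_ge_0|lra]. }
    lra.
Qed.

(** Real and imaginary parts of [(1 + z) / (1 - z)]. The real parts are compared through their
    squares, both being positive because [atan] stays inside the open right half circle; the tangent
    then yields the imaginary part. *)
Lemma fac_polar phi :
  (1 + rho) / (1 - rho) * exp (fac_log phi) * cos (fac_arg phi) =
    (1 - rho ^ 2) / (1 - 2 * rho * cos phi + rho ^ 2) /\
  (1 + rho) / (1 - rho) * exp (fac_log phi) * sin (fac_arg phi) =
    2 * rho * sin phi / (1 - 2 * rho * cos phi + rho ^ 2).
Proof.
  pose proof rho2_lt as Hr. pose proof (COS_bound phi) as Hc. pose proof q_bound as Hq.
  pose proof (q_cos_bound phi) as Hqc.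
  assert (Hm : 0 < 1 - 2 * rho * cos phi + rho ^ 2) by nra.
  assert (Hp : 0 < 1 + 2 * rho * cos phi + rho ^ 2) by nra.
  assert (Hw : 0 < 1 + rho ^ 2) by nra.
  set (m := (1 + rho) / (1 - rho) * exp (fac_log phi)).
  assert (HR : 0 < m) by (apply Rmult_lt_0_compat; [apply Rdiv_lt_0_compat; lra|apply exp_pos]).
  set (x := 2 * rho * sin phi / (1 - rho ^ 2)).
  assert (R2 : m ^ 2 = (1 + 2 * rho * cos phi + rho ^ 2) / (1 - 2 * rho * cos phi + rho ^ 2)).
  { unfold m. rewrite Rpow_mult_distr.
    assert (E : exp (fac_log phi) ^ 2 = (1 + q * cos phi) / (1 - q * cos phi) * ((1 - q) / (1
      + q))).
    { replace (exp (fac_log phi) ^ 2) with (exp (2 * fac_log phi)) by (simpl;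
      rewrite Rmult_1_r, <- exp_plus; f_equal; ring).
      unfold fac_log, artanh.
      replace (2 * (/ 2 * ln ((1 + q * cos phi) / (1 - q * cos phi)) - / 2 * ln ((1
        + q) / (1 - q))))
        with (ln ((1 + q * cos phi) / (1 - q * cos phi)) + - ln ((1 + q) / (1 - q))) by field.
      rewrite <- ln_Rinv, exp_plus, !exp_ln.
      - field. lra.
      - apply Rinv_0_lt_compat, Rdiv_lt_0_compat; lra.
      - apply Rdiv_lt_0_compat; lra.
      - apply Rdiv_lt_0_compat; lra. }
    rewrite E. unfold q. field. repeat split; nra. }
  assert (Hx : 1 + x ^ 2 = (1 + 2 * rho * cos phi + rho ^ 2) * (1 - 2 * rho * cos phi
    + rho ^ 2) / (1 - rho ^ 2) ^ 2).
  { unfold x. replace ((1 + 2 * rho * cos phi + rho ^ 2) * (1 - 2 * rho * cos phi + rho ^ 2))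
      with ((1 + rho ^ 2) ^ 2 - 4 * rho ^ 2 * cos phi ^ 2) by ring.
    rewrite cos2_sin2. field. lra. }
  assert (Hcv : m * cos (fac_arg phi) = (1 - rho ^ 2) / (1 - 2 * rho * cos phi + rho ^ 2)).
  { assert (P1 : 0 < cos (fac_arg phi)) by (unfold fac_arg; pose proof (atan_bound x);
    apply cos_gt_0; fold x; lra).
    assert (C2 : cos (fac_arg phi) ^ 2 = / (1 + x ^ 2)).
    { unfold fac_arg. fold x. rewrite cos_atan. unfold Rdiv. rewrite Rmult_1_l, pow_inv.
      rewrite pow2_sqrt; unfold Rsqr; [f_equal; ring|nra]. }
    apply (Rsqr_inj); [apply Rlt_le, Rmult_lt_0_compat; auto|apply Rle_mult_inv_pos; lra|].
    rewrite !Rsqr_pow2, Rpow_mult_distr, C2, R2, Hx. field. repeat split; lra. }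
  split; [exact Hcv|].
  assert (P1 : 0 < cos (fac_arg phi)) by (unfold fac_arg; pose proof (atan_bound x);
    apply cos_gt_0; fold x; lra).
  assert (T : sin (fac_arg phi) = cos (fac_arg phi) * x).
  { pose proof (tan_atan x) as T. unfold fac_arg in *. fold x in P1 |- *.
    rewrite <- T at 3. unfold tan. field. lra. }
  rewrite T, <- Rmult_assoc, Hcv. unfold x. field. split; lra.
Qed.

End Factor.

(** * Fourier coefficients of the finite products *)

Fixpoint sum1 (n : nat) (f : nat -> R) : R :=
  match n with O => 0 | S n' => sum1 n' f + f n end.

Fixpoint amplitude (r : R) (n : nat) : R :=
  match n with O => 1 | S n' => amplitude r n' * ((1 + r ^ n) / (1 - r ^ n)) end.

Definition prod_log (r : R) (n : nat) (x : R) := sum1 n (fun k => fac_log (r ^ k) (INR k * x)).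
Definition prod_arg (r : R) (n : nat) (x : R) := sum1 n (fun k => fac_arg (r ^ k) (INR k * x)).

(** [b k m] is meant to be the coefficient of [q ^ m] in [P_k], the product of
    [(1 + q^j) / (1 - q^j)] over [j <= k]; the last clause is [(1 - q^(k+1)) P_(k+1) = (1 + q^(k+1))
    P_k]. Integer indices make shifted terms below 0 vanish instead of being truncated. *)
Definition overpartition_system (b : nat -> Z -> Z) :=
  (forall m, b 0%nat m = if (m =? 0)%Z then 1%Z else 0%Z) /\
  (forall k m, (m < 0)%Z -> b k m = 0%Z) /\
  (forall k m, (b (S k) m - b (S k) (m - Z.of_nat (S k)) = b k m + b k (m - Z.of_nat (S k)))%Z).

Section Fourier.

Variable r : R.
Hypothesis Hr : 0 < r < 1.

Lemma rpow_bound k : 0 < r ^ S k < 1.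
Proof.
  split; [apply pow_lt; lra|]. simpl.
  assert (r ^ k <= 1) by (rewrite <- (pow1 k); apply pow_incr; lra).
  assert (0 < r ^ k) by (apply pow_lt; lra). nra.
Qed.

Lemma sum1_smooth n (f : nat -> R -> R) :
  (forall k, smooth (f (S k))) -> smooth (fun x => sum1 n (fun k => f k x)).
Proof.
  intros Hf; induction n as [|n IH]; intros x; cbn [sum1].
  - apply ex_derive_const.
  - apply (ex_derive_plus (V := R_NormedModule)); [apply IH|apply Hf].
Qed.

Lemma prod_log_smooth n : smooth (prod_log r n).
Proof.
  apply sum1_smooth. intros k x. apply (ex_derive_comp (fac_log (r ^ S k))).
  - eexists. apply fac_log_derive, rpow_bound.
  - auto_derive; auto.
Qed.

Lemma prod_arg_smooth n : smooth (prod_arg r n).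
Proof.
  apply sum1_smooth. intros k x. apply (ex_derive_comp (fac_arg (r ^ S k))).
  - eexists. apply fac_arg_derive, rpow_bound.
  - auto_derive; auto.
Qed.

Lemma prod_log_nonpos n x : prod_log r n x <= 0.
Proof.
  unfold prod_log; induction n as [|n IH]; cbn [sum1]; [lra|].
  pose proof (fac_log_gain _ (rpow_bound n) (INR (S n) * x)).
  pose proof (COS_bound (INR (S n) * x)). pose proof (rpow_bound n). nra.
Qed.

Lemma amplitude_pos n : 0 < amplitude r n.
Proof.
  induction n as [|n IH]; cbn [amplitude]; [lra|].
  pose proof (rpow_bound n). apply Rmult_lt_0_compat; auto. apply Rdiv_lt_0_compat; lra.
Qed.

(** The Fourier integral over the half circle only, by conjugation symmetry; this is why the factor
    in [coef_overpartitions] is [PI] and not [2 * PI]. *)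
Definition coef (n : nat) (m : Z) : R :=
  amplitude r n * RInt (fun x => exp (prod_log r n x) * cos (prod_arg r n x - IZR m * x)) 0 PI.

Lemma coef_integrand_smooth n m :
  smooth (fun x => exp (prod_log r n x) * cos (prod_arg r n x - IZR m * x)).
Proof.
  pose proof (prod_log_smooth n) as H1. pose proof (prod_arg_smooth n) as H2.
  intros x. auto_derive. split; [apply H1|split; [apply H2|easy]].
Qed.

(** Under the integral, shifting the index by [n + 1] multiplies the integrand by
    [exp (i * (n + 1) * x)], so both sides agree pointwise by
    [(1 - z) * ((1 + z) / (1 - z)) = 1 + z]. *)
Lemma coef_step n m :
  coef (S n) m - r ^ S n * coef (S n) (m - Z.of_nat (S n))
  = coef n m + r ^ S n * coef n (m - Z.of_nat (S n)).
Proof.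
  pose proof (rpow_bound n) as Hrho.
  assert (E : forall p q k m', p * (amplitude r k * RInt (fun x => exp (prod_log r k x) * cos
    (prod_arg r k x - IZR m * x)) 0 PI)
      + q * (amplitude r k * RInt (fun x => exp (prod_log r k x) * cos (prod_arg r k x - IZR m' *
        x)) 0 PI) =
      RInt (fun x => (p * amplitude r k) * (exp (prod_log r k x) * cos (prod_arg r k x - IZR m * x))
       + (q * amplitude r k) * (exp (prod_log r k x) * cos (prod_arg r k x - IZR m' * x))) 0 PI).
  { intros. rewrite RInt_lin by apply coef_integrand_smooth. ring. }
  transitivity (1 * coef (S n) m + (- r ^ S n) * coef (S n) (m - Z.of_nat (S n))); [ring|].
  transitivity (1 * coef n m + r ^ S n * coef n (m - Z.of_nat (S n))); [|ring].
  unfold coef. rewrite !E. apply RInt_eq. intros x.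
  unfold prod_log, prod_arg. cbn [sum1 amplitude].
  fold (prod_log r n x) (prod_arg r n x).
  rewrite exp_plus, minus_IZR, <- INR_IZR_INZ.
  set (rho := r ^ S n) in *. set (phi := INR (S n) * x).
  set (w := prod_arg r n x - IZR m * x).
  set (u := fac_log rho phi). set (v := fac_arg rho phi).
  replace (prod_arg r n x + v - IZR m * x) with (w + v) by (unfold w; ring).
  replace (prod_arg r n x + v - (IZR m - INR (S n)) * x) with ((w + phi) + v) by (unfold w, phi;
    ring).
  replace (prod_arg r n x - (IZR m - INR (S n)) * x) with (w + phi) by (unfold w, phi; ring).
  destruct (fac_polar rho Hrho phi) as [P Q]. fold u v in P, Q.
  rewrite (cos_plus w v), (cos_plus (w + phi) v).
  set (c1 := (1 + rho) / (1 - rho)) in *.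
  transitivity (amplitude r n * exp (prod_log r n x) *
    ((cos w * (c1 * exp u * cos v) - sin w * (c1 * exp u * sin v))
     - rho * (cos (w + phi) * (c1 * exp u * cos v) - sin (w + phi) * (c1 * exp u * sin v))));
       [ring|].
  rewrite P, Q. rewrite cos_plus, sin_plus.
  transitivity (amplitude r n * exp (prod_log r n x) * (cos w
    + rho * (cos w * cos phi - sin w * sin phi))); [|ring].
  f_equal.
  assert (Hm : 0 < 1 - 2 * rho * cos phi + rho ^ 2) by (pose proof (COS_bound phi); nra).
  apply (Rmult_eq_reg_r (1 - 2 * rho * cos phi + rho ^ 2)); [|lra].
  field_simplify; [|lra].
  replace (sin phi ^ 2) with (1 - cos phi ^ 2) by (rewrite cos2_sin2; ring).
  ring.
Qed.

Lemma coef_bound n m : Rabs (coef n m) <= amplitude r n * PI.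
Proof.
  unfold coef. rewrite Rabs_mult, (Rabs_right (amplitude r n))
    by (apply Rle_ge, Rlt_le, amplitude_pos).
  apply Rmult_le_compat_l; [apply Rlt_le, amplitude_pos|].
  pose proof PI_RGT_0.
  eapply Rle_trans; [apply abs_RInt_le_const with (M := 1);
    [lra|apply smooth_ex_RInt, coef_integrand_smooth|]|lra].
  intros x _. rewrite Rabs_mult, (Rabs_right (exp _)) by (apply Rle_ge, Rlt_le, exp_pos).
  assert (exp (prod_log r n x) <= 1).
  { rewrite <- exp_0. destruct (prod_log_nonpos n x) as [K|K]; [left; apply exp_increasing;
    auto|rewrite K; lra]. }
  assert (Rabs (cos (prod_arg r n x - IZR m * x)) <= 1) by (apply Rabs_le;
    pose proof (COS_bound (prod_arg r n x - IZR m * x)); lra).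
  pose proof (exp_pos (prod_log r n x)). pose proof (Rabs_pos (cos (prod_arg r n x - IZR m *
    x))). nra.
Qed.

Lemma coef_0 m : coef 0 m = PI * (if (m =? 0)%Z then 1 else 0).
Proof.
  unfold coef, prod_log, prod_arg; cbn [sum1 amplitude].
  rewrite Rmult_1_l.
  destruct (Z.eqb_spec m 0) as [->|Hm].
  - rewrite (RInt_eq _ (fun _ => 1)); [rewrite RInt_cst; ring|].
    intros x. rewrite exp_0. replace (0 - 0 * x) with 0 by ring. rewrite cos_0; ring.
  - assert (Hm' : IZR m <> 0) by (apply not_0_IZR; auto).
    rewrite (RInt_eq _ (fun x => cos (IZR m * x))).
    + rewrite (RInt_FTC (fun x => sin (IZR m * x) / IZR m)).
      * assert (sin (IZR m * PI) = 0) by (apply sin_eq_0_1; exists m; auto).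
        rewrite H, Rmult_0_r, sin_0. field; auto.
      * smoothness.
      * intros x; auto_derive; [auto|field; auto].
    + intros x. rewrite exp_0, Rmult_1_l. replace (0 - IZR m * x) with (- (IZR m * x)) by ring.
      apply cos_neg.
Qed.

(** Iterating the recurrence down to negative indices leaves a bounded value times [q ^ j], with [j]
    arbitrary. This uniqueness replaces Fourier inversion. *)
Lemma bounded_geometric_zero (X : Z -> R) (k : nat) (q B : R) : 0 < q < 1 ->
  (forall m, X m = q * X (m - Z.of_nat (S k))%Z) ->
  (forall m, (m < 0)%Z -> Rabs (X m) <= B) -> forall m, X m = 0.
Proof.
  intros Hq HX HB m.
  assert (It : forall j, X m = q ^ j * X (m - Z.of_nat j * Z.of_nat (S k))%Z).
  { induction j as [|j IH]; [simpl; rewrite Z.sub_0_r; ring|].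
    rewrite IH, HX. replace (m - Z.of_nat (S j) * Z.of_nat (S k))%Z
      with (m - Z.of_nat j * Z.of_nat (S k) - Z.of_nat (S k))%Z by lia.
    simpl; ring. }
  destruct (Req_dec (X m) 0) as [|Hne]; auto. exfalso.
  assert (Hpos : 0 < Rabs (X m)) by (apply Rabs_pos_lt; auto).
  assert (HB0 : 0 <= B) by (eapply Rle_trans; [apply Rabs_pos|apply (HB (-1)%Z); lia]).
  destruct (pow_lt_1_zero q ltac:(rewrite Rabs_right; lra) (Rabs (X m) / (B
    + 1)) ltac:(apply Rdiv_lt_0_compat; lra)) as [N HN].
  set (j := (N + S (Z.to_nat m))%nat).
  specialize (HN j ltac:(unfold j; lia)).
  pose proof (HB (m - Z.of_nat j * Z.of_nat (S k))%Z ltac:(unfold j; nia)) as HBj.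
  pose proof (It j) as E.
  assert (E2 : Rabs (X m) = Rabs (q ^ j) * Rabs (X (m - Z.of_nat j * Z.of_nat (S k))%Z))
    by (rewrite <- Rabs_mult; congruence).
  apply Rlt_div_r in HN; [|lra].
  pose proof (Rabs_pos (q ^ j)). nra.
Qed.

Lemma powerRZ_sub_nat (m : Z) (k : nat) : powerRZ r m = r ^ k * powerRZ r (m - Z.of_nat k).
Proof.
  rewrite pow_powerRZ, <- powerRZ_add by lra. f_equal; lia.
Qed.

(** The difference of the two sides at [n + 1] satisfies the homogeneous recurrence with ratio
    [r ^ (n + 1)]; at negative indices the counts vanish and the integral is bounded by
    [amplitude * PI]. *)
Theorem coef_overpartitions (b : nat -> Z -> Z) : overpartition_system b ->
  forall n m, coef n m = PI * powerRZ r m * IZR (b n m).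
Proof.
  intros [b0 [bneg bstep]] n. induction n as [|n IH]; intros m.
  - rewrite coef_0, b0. destruct (Z.eqb_spec m 0) as [->|]; simpl; ring.
  - apply Rminus_diag_uniq. revert m.
    apply (bounded_geometric_zero (fun m => coef (S n) m - PI * powerRZ r m * IZR (b (S n) m)) n
      (r ^ S n) (amplitude r (S n) * PI)); [apply rpow_bound| |].
    + intros m. pose proof (coef_step n m) as C. rewrite !IH in C.
      pose proof (f_equal IZR (bstep n m)) as B. rewrite minus_IZR, plus_IZR in B.
      rewrite (powerRZ_sub_nat m (S n)) in *.
      set (p := powerRZ r (m - Z.of_nat (S n))) in *.
      replace (coef (S n) m) with (r ^ S n * coef (S n) (m - Z.of_nat (S n))
        + PI * (r ^ S n * p) * (IZR (b n m) + IZR (b n (m - Z.of_nat (S n))%Z))) by lra.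
      rewrite <- B. ring.
    + intros m Hm. rewrite bneg by auto. rewrite Rmult_0_r, Rminus_0_r. apply coef_bound.
Qed.

End Fourier.

(** * Cumulants of the finite products *)

Lemma sum1_le n f g : (forall k, (1 <= k <= n)%nat -> f k <= g k) -> sum1 n f <= sum1 n g.
Proof.
  induction n as [|n IH]; intros H; cbn [sum1]; [lra|].
  apply Rplus_le_compat; [apply IH; intros; apply H; lia|apply H; lia].
Qed.

Lemma sum1_ext n f g : (forall k, (1 <= k <= n)%nat -> f k = g k) -> sum1 n f = sum1 n g.
Proof.
  intros H; apply Rle_antisym; apply sum1_le; intros; rewrite H; auto; lra.
Qed.

Lemma sum1_plus n f g : sum1 n (fun k => f k + g k) = sum1 n f + sum1 n g.
Proof. induction n as [|n IH]; cbn [sum1]; [ring|rewrite IH; ring]. Qed.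

Lemma sum1_scal n c f : sum1 n (fun k => c * f k) = c * sum1 n f.
Proof. induction n as [|n IH]; cbn [sum1]; [ring|rewrite IH; ring]. Qed.

(* [pgf i y] is the sum of [k ^ i * y ^ k] over [k >= 1], for [i <= 4] only. *)
Definition pgf (i : nat) (y : R) : R :=
  match i with
  | 0%nat => y / (1 - y)
  | 1%nat => y / (1 - y) ^ 2
  | 2%nat => y * (1 + y) / (1 - y) ^ 3
  | 3%nat => y * (1 + 4 * y + y ^ 2) / (1 - y) ^ 4
  | _ => y * (1 + 11 * y + 11 * y ^ 2 + y ^ 3) / (1 - y) ^ 5
  end.

Definition psum (i n : nat) (y : R) := sum1 n (fun k => INR k ^ i * y ^ k).

Lemma pgf_nonneg i y : 0 < y < 1 -> 0 <= pgf i y.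
Proof.
  intros Hy. assert (H : forall j, 0 < (1 - y) ^ j) by (intros; apply pow_lt; lra).
  unfold pgf; destruct i as [|[|[|[|i]]]]; apply Rle_mult_inv_pos; auto; try lra.
  all: apply Rmult_le_pos; [lra|].
  all: assert (0 < y ^ 2) by (apply pow_lt; lra); assert (0 < y ^ 3) by (apply pow_lt; lra); lra.
Qed.

(** Here and in the next four lemmas the tail beyond [n] is [y ^ n] times the sum of
    [(n + k) ^ i * y ^ k], expanded by the binomial theorem. *)
Lemma psum0_eq n y : 0 < y < 1 -> psum 0 n y = pgf 0 y - y ^ n * pgf 0 y.
Proof.
  intros Hy; unfold psum, pgf; induction n as [|n IH]; cbn [sum1]; [simpl; ring|].
  rewrite IH. cbn [pow]. field. lra.
Qed.

Lemma psum1_eq n y : 0 < y < 1 ->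
  psum 1 n y = pgf 1 y - y ^ n * (INR n * pgf 0 y + pgf 1 y).
Proof.
  intros Hy; unfold psum, pgf; induction n as [|n IH]; cbn [sum1]; [simpl; ring|].
  rewrite IH, S_INR. cbn [pow]. field. lra.
Qed.

Lemma psum2_eq n y : 0 < y < 1 ->
  psum 2 n y = pgf 2 y - y ^ n * (INR n ^ 2 * pgf 0 y + 2 * INR n * pgf 1 y + pgf 2 y).
Proof.
  intros Hy; unfold psum, pgf; induction n as [|n IH]; cbn [sum1]; [simpl; ring|].
  rewrite IH, S_INR. cbn [pow]. field. lra.
Qed.

Lemma psum3_eq n y : 0 < y < 1 ->
  psum 3 n y = pgf 3 y - y ^ n * (INR n ^ 3 * pgf 0 y + 3 * INR n ^ 2 * pgf 1 y
    + 3 * INR n * pgf 2 y + pgf 3 y).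
Proof.
  intros Hy; unfold psum, pgf; induction n as [|n IH]; cbn [sum1]; [simpl; ring|].
  rewrite IH, S_INR. cbn [pow]. field. lra.
Qed.

Lemma psum4_eq n y : 0 < y < 1 ->
  psum 4 n y = pgf 4 y - y ^ n * (INR n ^ 4 * pgf 0 y + 4 * INR n ^ 3 * pgf 1 y
    + 6 * INR n ^ 2 * pgf 2 y + 4 * INR n * pgf 3 y + pgf 4 y).
Proof.
  intros Hy; unfold psum, pgf; induction n as [|n IH]; cbn [sum1]; [simpl; ring|].
  rewrite IH, S_INR. cbn [pow]. field. lra.
Qed.

Lemma psum_le i n y : (i <= 4)%nat -> 0 < y < 1 -> psum i n y <= pgf i y.
Proof.
  intros Hi Hy.
  assert (Hn : forall j, 0 <= INR n ^ j) by (intros; apply pow_le, pos_INR).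
  assert (H1 := pos_INR n). assert (H2 := Hn 2%nat). assert (H3 := Hn 3%nat).
    assert (H4 := Hn 4%nat).
  assert (Hp : 0 < y ^ n) by (apply pow_lt; lra).
  assert (P0 := pgf_nonneg 0 y Hy). assert (P1 := pgf_nonneg 1 y Hy).
    assert (P2 := pgf_nonneg 2 y Hy).
  assert (P3 := pgf_nonneg 3 y Hy). assert (P4 := pgf_nonneg 4 y Hy).
  destruct i as [|[|[|[|[|i]]]]]; [rewrite psum0_eq|rewrite psum1_eq|rewrite psum2_eq|rewrite
    psum3_eq|rewrite psum4_eq|lia]; auto.
  all: revert P0 P1 P2 P3 P4; generalize (pgf 0 y) (pgf 1 y) (pgf 2 y) (pgf 3 y) (pgf 4 y); intros.
  all: match goal with |- _ - ?p * ?t <= _ => assert (0 <= t);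
    [|assert (0 <= p * t) by (apply Rmult_le_pos; lra); lra] end.
  all: repeat apply Rplus_le_le_0_compat; repeat apply Rmult_le_pos; auto; lra.
Qed.

(** * Power sums through the hyperbolic cotangent *)

Section SmallArg.

Variable x : R.
Hypothesis Hx : 0 < x <= / 3.

Let y := exp (- x).
Let c := (1 + y) / (1 - y).

Lemma exp_neg_bound : 0 < y < 1.
Proof.
  unfold y. split; [apply exp_pos|]. rewrite <- exp_0. apply exp_increasing; lra.
Qed.

Lemma coth_lower : 2 / x <= c.
Proof.
  pose proof exp_neg_bound as Hy. unfold c.
  pose proof (deriv_nonneg_le (fun t => t * (1 + exp (- t)) - 2 * (1 - exp (- t)))
    (fun t => 1 - exp (- t) * (1 + t)) 0 x ltac:(lra)) as H.
  cbv beta in H. fold y in H. rewrite Ropp_0, exp_0 in H.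
  cut (0 * (1 + 1) - 2 * (1 - 1) <= x * (1 + y) - 2 * (1 - y)).
  { intros K. apply Rle_div_l; [lra|]. replace ((1 + y) / (1 - y) * x)
    with (x * (1 + y) / (1 - y)) by (field; lra).
    apply Rle_div_r; lra. }
  apply H; clear H.
  - intros t _. auto_derive; [easy|ring].
  - intros t Ht. pose proof (exp_ineq1_le t). pose proof (exp_pos (- t)).
    assert (exp t * exp (- t) = 1) by (rewrite <- exp_plus, Rplus_opp_r; apply exp_0). nra.
Qed.

Lemma exp_ge_quad t : 0 <= t -> 1 + t + t ^ 2 / 2 <= exp t.
Proof.
  intros Ht.
  pose proof (deriv_nonneg_le (fun t => exp t - (1 + t + t ^ 2 / 2)) (fun t => exp t - (1
    + t)) 0 t Ht) as H.
  cbv beta in H. rewrite exp_0 in H.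
  cut (1 - (1 + 0 + 0 ^ 2 / 2) <= exp t - (1 + t + t ^ 2 / 2)); [lra|]. apply H.
  - intros z _; auto_derive; [easy|field].
  - intros z _; pose proof (exp_ineq1_le z); lra.
Qed.

(* The Pade approximant [(12 - 6 x + x^2) / (12 + 6 x + x^2)] bounds [exp (- x)] from above. *)
Lemma coth_upper : c <= 2 / x + x / 6.
Proof.
  pose proof exp_neg_bound as Hy. unfold c.
  assert (F1 : forall t, 0 <= t -> 0 <= -6 + 2 * t + exp (- t) * (6 + 4 * t + t ^ 2)).
  { intros t Ht.
    pose proof (deriv_nonneg_le (fun t => -6 + 2 * t + exp (- t) * (6 + 4 * t + t ^ 2))
      (fun t => 2 - exp (- t) * (2 + 2 * t + t ^ 2)) 0 t Ht) as H.
    cbv beta in H. rewrite Ropp_0, exp_0 in H.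
    cut (-6 + 2 * 0 + 1 * (6 + 4 * 0 + 0 ^ 2) <= -6 + 2 * t + exp (- t) * (6 + 4 * t + t ^ 2));
      [lra|]. apply H.
    - intros z _; auto_derive; [easy|ring].
    - intros z Hz. pose proof (exp_ge_quad z (proj1 Hz)). pose proof (exp_pos (- z)).
      assert (exp z * exp (- z) = 1) by (rewrite <- exp_plus, Rplus_opp_r; apply exp_0). nra. }
  pose proof (deriv_nonneg_le (fun t => 12 - 6 * t + t ^ 2 - exp (- t) * (12 + 6 * t + t ^ 2))
    (fun t => -6 + 2 * t + exp (- t) * (6 + 4 * t + t ^ 2)) 0 x ltac:(lra)) as H.
  cbv beta in H. fold y in H. rewrite Ropp_0, exp_0 in H.
  cut (12 - 6 * 0 + 0 ^ 2 - 1 * (12 + 6 * 0 + 0 ^ 2) <= 12 - 6 * x + x ^ 2 - y * (12 + 6 * x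
    + x ^ 2)).
  { intros K. apply Rle_div_l; [lra|].
    replace ((2 / x + x / 6) * (1 - y)) with (((12 + x ^ 2) * (1 - y)) / (6 * x)) by (field; lra).
    apply Rle_div_r; nra. }
  apply H.
  - intros z _; auto_derive; [easy|ring].
  - intros z Hz; apply F1; lra.
Qed.

Let w := (c ^ 2 - 1) / 4.

(** [c] is [coth (x / 2)]. The operator [y * d / dy] sends [c] to [2 * w] and [w] to [w * c], with
    [c^2 = 1 + 4 * w], so every sum is a polynomial in [c] and [w], and bounds on [c] alone
    suffice. *)
Lemma pgf_coth : pgf 0 y = (c - 1) / 2 /\ pgf 1 y = w /\ pgf 2 y = w * c /\
  pgf 3 y = w * (1 + 6 * w) /\ pgf 4 y = w * c * (1 + 12 * w).
Proof.
  pose proof exp_neg_bound as Hy. unfold pgf, w, c. repeat split; field; lra.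
Qed.

Let X := / x.

Lemma coth_bounds : 3 <= X /\ 2 * X <= c <= 2 * X + x / 6 /\ X ^ 2 - / 4 <= w <= X ^ 2.
Proof.
  assert (H0 : 3 <= X).
  { unfold X. replace 3 with (/ / 3) by field. apply Rinv_le_contravar; lra. }
  assert (Hxx : x * X = 1) by (unfold X; field; lra).
  assert (H : 2 * X <= c <= 2 * X + x / 6).
  { pose proof coth_lower. pose proof coth_upper. unfold X. unfold Rdiv in *; lra. }
  repeat split; try apply H; auto; unfold w.
  - nra.
  - assert (c ^ 2 <= (2 * X + x / 6) ^ 2) by (apply pow_incr; lra).
    replace ((2 * X + x / 6) ^ 2) with (4 * X ^ 2 + 2 / 3 * (x * X) + x ^ 2 / 36) in H1 by field.
    rewrite Hxx in H1. nra.
Qed.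

Lemma pgf_upper : pgf 0 y <= X /\ pgf 1 y <= X ^ 2 /\ pgf 2 y <= 2 * X ^ 3 * (1 + x ^ 2 / 12) /\
  pgf 3 y <= 6 * X ^ 4 * (1 + x ^ 2 / 6) /\ pgf 4 y <= 24 * X ^ 5 * (1 + x ^ 2 / 12) ^ 2.
Proof.
  destruct coth_bounds as [HX [[C1 C2] [W1 W2]]]. destruct pgf_coth as [-> [-> [-> [-> ->]]]].
  assert (Hxx : x * X = 1) by (unfold X; field; lra).
  assert (HX9 : 9 <= X ^ 2) by nra.
  assert (c2 : c <= 2 * X * (1 + x ^ 2 / 12)) by (replace (2 * X * (1 + x ^ 2 / 12))
    with (2 * X + (x * X) * x / 6) by field; rewrite Hxx; lra).
  assert (wc : w * c <= 2 * X ^ 3 * (1 + x ^ 2 / 12)).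
  { replace (2 * X ^ 3 * (1 + x ^ 2 / 12)) with (X ^ 2 * (2 * X * (1 + x ^ 2 / 12))) by ring.
    apply Rmult_le_compat; lra. }
  repeat split; auto.
  - lra.
  - replace (6 * X ^ 4 * (1 + x ^ 2 / 6)) with (X ^ 2 * (6 * X ^ 2 + (x * X) ^ 2)) by field.
    rewrite Hxx. apply Rmult_le_compat; lra.
  - replace (24 * X ^ 5 * (1 + x ^ 2 / 12) ^ 2) with ((2 * X ^ 3 * (1
    + x ^ 2 / 12)) * (12 * X ^ 2 + (x * X) ^ 2)) by field.
    rewrite Hxx. apply Rmult_le_compat; [apply Rmult_le_pos|..]; lra.
Qed.

Lemma pgf2_lower : 2 * X ^ 3 * (1 - x ^ 2 / 4) <= pgf 2 y.
Proof.
  destruct coth_bounds as [HX [[C1 C2] [W1 W2]]]. destruct pgf_coth as [_ [_ [-> _]]].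
  assert (Hxx : x * X = 1) by (unfold X; field; lra).
  replace (2 * X ^ 3 * (1 - x ^ 2 / 4)) with ((X ^ 2 - (x * X) ^ 2 / 4) * (2 * X)) by field.
  rewrite Hxx. assert (9 <= X ^ 2) by nra. apply Rmult_le_compat; lra.
Qed.

End SmallArg.

(** * Laurent bounds for the cumulants of one factor *)

Section CumulantOfFactor.

Variable x : R.
Hypothesis Hx : 0 < x.

Let rho := exp (- x).
Let X := / x.
(** [s] and [ch] are [sinh x] and [cosh x]; [v] is such that [x * (1 + v)] is the cubic Taylor
    polynomial of [sinh]. *)
Let s := (/ rho - rho) / 2.
Let ch := (/ rho + rho) / 2.
Let v := x ^ 2 / 6.

Lemma rho_bound : 0 < rho < 1.
Proof.
  unfold rho. split; [apply exp_pos|]. rewrite <- exp_0. apply exp_increasing; lra.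
Qed.

Lemma sinh_lower : x * (1 + v) <= s.
Proof.
  assert (Er : / rho = exp x) by (unfold rho; rewrite <- exp_Ropp; f_equal; ring).
  unfold s, v. rewrite Er. unfold rho.
  assert (C : forall t, 0 <= t -> 1 + t ^ 2 / 2 <= (exp t + exp (- t)) / 2).
  { intros t Ht.
    pose proof (deriv_nonneg_le (fun t => (exp t + exp (- t)) / 2 - (1 + t ^ 2 / 2))
      (fun t => (exp t - exp (- t)) / 2 - t) 0 t Ht) as H.
    cbv beta in H. rewrite Ropp_0, exp_0 in H.
    cut ((1 + 1) / 2 - (1 + 0 ^ 2 / 2) <= (exp t + exp (- t)) / 2 - (1 + t ^ 2 / 2)); [lra|].
      apply H; clear H.
    - intros z _; auto_derive; [easy|field].
    - intros z Hz.
      pose proof (deriv_nonneg_le (fun t => (exp t - exp (- t)) / 2 - t)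
        (fun t => (exp t + exp (- t)) / 2 - 1) 0 z ltac:(lra)) as H.
      cbv beta in H. rewrite Ropp_0, exp_0 in H.
      cut ((1 - 1) / 2 - 0 <= (exp z - exp (- z)) / 2 - z); [lra|]. apply H; clear H.
      + intros p _; auto_derive; [easy|field].
      + intros p Hp. pose proof (exp_ineq1_le p). pose proof (exp_ineq1_le (- p)). lra. }
  pose proof (deriv_nonneg_le (fun t => (exp t - exp (- t)) / 2 - t * (1 + t ^ 2 / 6))
      (fun t => (exp t + exp (- t)) / 2 - (1 + t ^ 2 / 2)) 0 x ltac:(lra)) as H.
  cbv beta in H. rewrite Ropp_0, exp_0 in H.
  cut ((1 - 1) / 2 - 0 * (1 + 0 ^ 2 / 6) <= (exp x - exp (- x)) / 2 - x * (1 + x ^ 2 / 6));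
    [lra|]. apply H; clear H.
  - intros z _; auto_derive; [easy|field].
  - intros z Hz. specialize (C z (proj1 Hz)); lra.
Qed.

Lemma sixth_sq_pos : 0 < v. Proof. unfold v; nra. Qed.

Lemma sinh_pos : 0 < s.
Proof. pose proof sinh_lower. pose proof sixth_sq_pos. nra. Qed.

Lemma cum_sinh : cum1 rho = / s /\ cum2 rho = ch / s ^ 2 /\ cum3 rho = 2 * (/ s) ^ 3 + / s /\
  cum4 rho = cum2 rho * (6 * (/ s) ^ 2 + 1).
Proof.
  pose proof rho_bound. unfold cum1, cum2, cum3, cum4, s, ch.
  repeat split; field; repeat split; nra.
Qed.

Lemma cosh_sq : ch ^ 2 = 1 + s ^ 2.
Proof. pose proof rho_bound. unfold ch, s. field. lra. Qed.

Lemma inv_s_le : / s <= / (x * (1 + v)).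
Proof. pose proof sixth_sq_pos. apply Rinv_le_contravar; [nra|apply sinh_lower]. Qed.

Lemma inv_s_le_X : / s <= X.
Proof. pose proof sixth_sq_pos. unfold X. apply Rinv_le_contravar; [lra|]. pose proof sinh_lower.
  nra. Qed.

Lemma cum1_le : cum1 rho <= X.
Proof. destruct cum_sinh as [-> _]. apply inv_s_le_X. Qed.

(** The bound consists of the first two Laurent terms of [cosh x / sinh^2 x]. After squaring and
    replacing [cosh^2] by [1 + sinh^2], only a lower bound on [sinh] is needed, and inserting
    [sinh_lower] leaves a polynomial inequality in [v]. *)
Lemma cum2_le : cum2 rho <= X ^ 2 + / 6.
Proof.
  destruct cum_sinh as [_ [-> _]]. pose proof sinh_pos as Hs. pose proof sixth_sq_pos as Hv.
    pose proof sinh_lower as Hl.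
  assert (Hx2 : 0 < x ^ 2) by nra.
  assert (E : X ^ 2 + / 6 = (1 + v) / x ^ 2) by (unfold X, v; field; lra).
  rewrite E. set (g := (1 + v) / x ^ 2).
  assert (Hg : 0 < g) by (apply Rdiv_lt_0_compat; lra).
  apply Rle_div_l; [nra|].
  assert (Hch : 0 <= ch) by (pose proof rho_bound; unfold ch;
    assert (0 < / rho) by (apply Rinv_0_lt_compat; lra); lra).
  assert (K : ch ^ 2 <= (g * s ^ 2) ^ 2).
  2:{ apply Rsqr_incr_0_var; [rewrite !Rsqr_pow2; auto|]. assert (0 < s ^ 2) by nra. nra. }
  rewrite cosh_sq. set (p := s ^ 2). set (p0 := (x * (1 + v)) ^ 2).
  assert (Hp : p0 <= p) by (unfold p, p0; apply pow_incr; split; [nra|auto]).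
  assert (Ep0 : p0 = 6 * v * (1 + v) ^ 2) by (unfold p0, v; field).
  assert (Eg : g ^ 2 * p0 = (1 + v) ^ 4 / (6 * v)) by (unfold g, p0, v; field; lra).
  assert (H1 : (g * p) ^ 2 >= g ^ 2 * p0 * p).
  { replace ((g * p) ^ 2) with (g ^ 2 * p * p) by ring. apply Rle_ge, Rmult_le_compat_r;
    [apply pow2_ge_0|]. apply Rmult_le_compat_l; [apply pow2_ge_0|auto]. }
  set (B := (1 + v) ^ 4 / (6 * v)) in *.
  assert (HB : B * (6 * v) = (1 + v) ^ 4) by (unfold B; field; lra).
  assert (HB1 : 1 <= B).
  { unfold B. apply Rle_div_r; [lra|]. assert (0 <= v ^ 2 /\ 0 <= v ^ 3 /\ 0 <= v ^ 4)
    by (repeat split; apply pow_le; lra). nra. }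
  assert (H2 : 1 <= p0 * (B - 1)).
  { rewrite Ep0. replace (6 * v * (1 + v) ^ 2 * (B - 1))
    with ((1 + v) ^ 2 * (B * (6 * v) - 6 * v)) by ring. rewrite HB.
    assert (0 <= v ^ 2 /\ 0 <= v ^ 3 /\ 0 <= v ^ 4 /\ 0 <= v ^ 5 /\ 0 <= v ^ 6) by (repeat split;
      apply pow_le; lra). nra. }
  rewrite Eg in H1. nra.
Qed.

Lemma cum3_le : cum3 rho <= 2 * X ^ 3 + X / 3.
Proof.
  destruct cum_sinh as [_ [_ [-> _]]]. pose proof sinh_pos as Hs. pose proof sixth_sq_pos as Hv.
  set (z := / (x * (1 + v))).
  assert (Hz : 0 < / s <= z) by (split; [apply Rinv_0_lt_compat; auto|apply inv_s_le]).
  apply Rle_trans with (2 * z ^ 3 + z).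
  { assert ((/ s) ^ 3 <= z ^ 3) by (apply pow_incr; lra). lra. }
  replace (2 * z ^ 3 + z) with ((2 + 6 * v * (1 + v) ^ 2) / (x * (1 + v)) ^ 3) by (unfold z, v;
    field; split; nra).
  replace (2 * X ^ 3 + X / 3) with ((2 * (1 + v) ^ 4) / (x * (1 + v)) ^ 3) by (unfold X, v;
    field; split; nra).
  apply Rmult_le_compat_r; [apply Rlt_le, Rinv_0_lt_compat, pow_lt; nra|].
  assert (0 <= v ^ 3 /\ 0 <= v ^ 4) by (split; apply pow_le; lra). nra.
Qed.

Lemma cum4_le : cum4 rho <= (X ^ 2 + / 6) * (6 * X ^ 2 + 1).
Proof.
  destruct cum_sinh as [_ [E2 [_ E4]]]. rewrite E4. pose proof sinh_pos as Hs.
  assert (0 < / s) by (apply Rinv_0_lt_compat; auto).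
  assert ((/ s) ^ 2 <= X ^ 2) by (apply pow_incr; pose proof inv_s_le_X; lra).
  pose proof (pow2_ge_0 (/ s)).
  apply Rmult_le_compat; [|lra|apply cum2_le|lra].
  pose proof rho_bound. rewrite E2. apply Rle_mult_inv_pos; [|apply pow_lt; auto].
  unfold ch. assert (0 < / rho) by (apply Rinv_0_lt_compat; lra); lra.
Qed.

(* Splitting off the first term of the odd-index series shifts [m] by 2. *)
Lemma cum_shift : cum1 rho = 2 * rho + rho ^ 2 * cum1 rho /\
  cum2 rho = 2 * rho + rho ^ 2 * (2 * cum1 rho + cum2 rho) /\
  cum3 rho = 2 * rho + rho ^ 2 * (4 * cum1 rho + 4 * cum2 rho + cum3 rho) /\
  cum4 rho = 2 * rho + rho ^ 2 * (8 * cum1 rho + 12 * cum2 rho + 6 * cum3 rho + cum4 rho).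
Proof.
  pose proof rho_bound. assert (1 - rho ^ 2 <> 0) by nra. unfold cum1, cum2, cum3, cum4.
  repeat split; field; auto.
Qed.

Lemma cum2_three_terms : 2 * rho + 6 * rho ^ 3 + 10 * rho ^ 5 <= cum2 rho.
Proof.
  pose proof rho_bound. unfold cum2. apply Rle_div_r; [apply Rlt_gt, pow_lt; nra|].
  assert (0 < rho ^ 7) by (apply pow_lt; lra).
  replace ((2 * rho + 6 * rho ^ 3 + 10 * rho ^ 5) * (1 - rho ^ 2) ^ 2) with
    (2 * rho * (1 + rho ^ 2) - rho ^ 7 * (14 - 10 * rho ^ 2)) by ring.
      assert (0 <= rho ^ 7 * (14 - 10 * rho ^ 2)) by (apply Rmult_le_pos; nra). lra.
Qed.

End CumulantOfFactor.

Definition kappa (a : R -> R) (i N : nat) (r : R) := sum1 N (fun k => INR k ^ i * a (r ^ k)).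

Section Cumulants.

Variables (sg : R) (N : nat).
Hypothesis Hsg : 0 < sg <= / 45.

Let r := exp (- sg).
Let Y := / sg.

Lemma r_pow k : r ^ k = exp (- (INR k * sg)).
Proof.
  unfold r. induction k as [|k IH]; [simpl; rewrite Rmult_0_l, Ropp_0, exp_0; auto|].
  rewrite S_INR. cbn [pow]. rewrite IH, <- exp_plus. f_equal. ring.
Qed.

Lemma r_pow_sq k : (r ^ k) ^ 2 = (r ^ 2) ^ k.
Proof. rewrite <- !pow_mult. f_equal. lia. Qed.

Lemma INR_ge_1 k : (1 <= k)%nat -> 1 <= INR k.
Proof. intros H. change 1 with (INR 1). apply le_INR; auto. Qed.

Lemma inv_INR_mul k : (1 <= k)%nat -> / (INR k * sg) = Y / INR k.
Proof. intros H. apply INR_ge_1 in H. unfold Y. field. lra. Qed.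

(** The Laurent bounds alone give terms that do not decay in [k]. Hence [cum_shift] comes first here
    and in the next three lemmas: the index [m = 1] is summed as it stands, and the rest acquires
    the factor [(r ^ 2) ^ k]. *)
Lemma kappa1_raw : kappa cum1 1 N r <= 2 * psum 1 N r + Y * psum 0 N (r ^ 2).
Proof.
  unfold kappa, psum. rewrite <- !sum1_scal, <- !sum1_plus. apply sum1_le. intros k Hk.
  assert (K := INR_ge_1 k ltac:(lia)). assert (Hkx : 0 < INR k * sg) by nra.
  destruct (cum_shift _ Hkx) as [E _]. pose proof (cum1_le _ Hkx) as L1.
  rewrite inv_INR_mul in L1 by lia. rewrite <- r_pow in E, L1.
  rewrite E, <- r_pow_sq. set (p := r ^ k) in *.
  assert (0 <= p ^ 2) by apply pow2_ge_0.
  replace (2 * (INR k ^ 1 * p) + Y * (INR k ^ 0 * p ^ 2))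
    with (INR k ^ 1 * (2 * p + p ^ 2 * (Y / INR k))) by (field; lra).
  apply Rmult_le_compat_l; [lra|]. apply Rplus_le_compat_l, Rmult_le_compat_l; auto.
Qed.

Lemma kappa2_raw : kappa cum2 2 N r <= 2 * psum 2 N r + 2 * Y * psum 1 N (r ^ 2)
  + Y ^ 2 * psum 0 N (r ^ 2) + / 6 * psum 2 N (r ^ 2).
Proof.
  unfold kappa, psum. rewrite <- !sum1_scal, <- !sum1_plus. apply sum1_le. intros k Hk.
  assert (K := INR_ge_1 k ltac:(lia)). assert (Hkx : 0 < INR k * sg) by nra.
  destruct (cum_shift _ Hkx) as [_ [E _]]. pose proof (cum1_le _ Hkx) as L1.
    pose proof (cum2_le _ Hkx) as L2.
  rewrite inv_INR_mul in L1, L2 by lia. rewrite <- r_pow in E, L1, L2.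
  rewrite E, <- r_pow_sq. set (p := r ^ k) in *.
  assert (0 <= p ^ 2) by apply pow2_ge_0.
  apply Rle_trans with (INR k ^ 2 * (2 * p + p ^ 2 * (2 * (Y / INR k) + ((Y / INR k) ^ 2 + / 6)))).
  - apply Rmult_le_compat_l; [apply pow2_ge_0|]. apply Rplus_le_compat_l, Rmult_le_compat_l;
    auto. lra.
  - right. field. lra.
Qed.

Lemma kappa3_raw : kappa cum3 3 N r <= 2 * psum 3 N r + 4 * Y * psum 2 N (r ^ 2)
  + 4 * Y ^ 2 * psum 1 N (r ^ 2) + 4 / 6 * psum 3 N (r ^ 2) + 2 * Y ^ 3 * psum 0 N (r ^ 2)
    + Y / 3 * psum 2 N (r ^ 2).
Proof.
  unfold kappa, psum. rewrite <- !sum1_scal, <- !sum1_plus. apply sum1_le. intros k Hk.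
  assert (K := INR_ge_1 k ltac:(lia)). assert (Hkx : 0 < INR k * sg) by nra.
  destruct (cum_shift _ Hkx) as [_ [_ [E _]]].
  pose proof (cum1_le _ Hkx) as L1. pose proof (cum2_le _ Hkx) as L2.
    pose proof (cum3_le _ Hkx) as L3.
  rewrite inv_INR_mul in L1, L2, L3 by lia. rewrite <- r_pow in E, L1, L2, L3.
  rewrite E, <- r_pow_sq. set (p := r ^ k) in *.
  assert (0 <= p ^ 2) by apply pow2_ge_0.
  apply Rle_trans with (INR k ^ 3 * (2 * p + p ^ 2 * (4 * (Y / INR k) + 4 * ((Y / INR k) ^ 2
    + / 6) + (2 * (Y / INR k) ^ 3 + Y / INR k / 3)))).
  - apply Rmult_le_compat_l; [apply pow_le; lra|]. apply Rplus_le_compat_l, Rmult_le_compat_l;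
    auto. lra.
  - right. field. lra.
Qed.

Lemma kappa4_raw : kappa cum4 4 N r <= 2 * psum 4 N r + 10 * Y * psum 3 N (r ^ 2)
  + 14 * Y ^ 2 * psum 2 N (r ^ 2) + 13 / 6 * psum 4 N (r ^ 2) + 12 * Y ^ 3 * psum 1 N (r ^ 2)
  + 6 * Y ^ 4 * psum 0 N (r ^ 2).
Proof.
  unfold kappa, psum. rewrite <- !sum1_scal, <- !sum1_plus. apply sum1_le. intros k Hk.
  assert (K := INR_ge_1 k ltac:(lia)). assert (Hkx : 0 < INR k * sg) by nra.
  destruct (cum_shift _ Hkx) as [_ [_ [_ E]]].
  pose proof (cum1_le _ Hkx) as L1. pose proof (cum2_le _ Hkx) as L2.
    pose proof (cum3_le _ Hkx) as L3. pose proof (cum4_le _ Hkx) as L4.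
  rewrite inv_INR_mul in L1, L2, L3, L4 by lia. rewrite <- r_pow in E, L1, L2, L3, L4.
  rewrite E, <- r_pow_sq. set (p := r ^ k) in *.
  assert (0 <= p ^ 2) by apply pow2_ge_0.
  apply Rle_trans with (INR k ^ 4 * (2 * p + p ^ 2 * (8 * (Y / INR k) + 12 * ((Y / INR k) ^ 2
    + / 6) + 6 * (2 * (Y / INR k) ^ 3 + Y / INR k / 3)
     + ((Y / INR k) ^ 2 + / 6) * (6 * (Y / INR k) ^ 2 + 1)))).
  - apply Rmult_le_compat_l; [apply pow_le; lra|]. apply Rplus_le_compat_l, Rmult_le_compat_l;
    auto. lra.
  - right. field. lra.
Qed.

End Cumulants.

(** * Numerical bounds on the cumulants and decay along the circle *)

Lemma cos_le_quartic x : 0 <= x -> cos x <= 1 - x ^ 2 / 2 + x ^ 4 / 24.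
Proof.
  intros Hx.
  pose proof (deriv_nonneg_le (fun y => 1 - y ^ 2 / 2 + y ^ 4 / 24 - cos y) (fun y => sin y - (y
    - y ^ 3 / 6)) 0 x Hx) as H.
  cbv beta in H. rewrite cos_0 in H.
  cut (1 - 0 ^ 2 / 2 + 0 ^ 4 / 24 - 1 <= 1 - x ^ 2 / 2 + x ^ 4 / 24 - cos x); [lra|].
  apply H.
  - intros y _; auto_derive; [easy|]; field.
  - intros y Hy; pose proof (sin_ge_cubic y); lra.
Qed.

Lemma sum_cos_geom r x n : 1 - 2 * r * cos x + r ^ 2 <> 0 ->
  sum1 n (fun k => r ^ k * cos (INR k * x)) =
  (r * cos x - r ^ 2 - r ^ S n * cos (INR (S n) * x) + r ^ S (S n) * cos (INR n * x)) / (1 - 2 *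
    r * cos x + r ^ 2).
Proof.
  intros Hd. induction n as [|n IH].
  - cbn [sum1 pow]. replace (INR 1 * x) with x by (simpl; ring).
    simpl INR. rewrite Rmult_0_l, cos_0. field. intros K; apply Hd; lra.
  - cbn [sum1]. rewrite IH.
    assert (E : cos (INR (S (S n)) * x) = 2 * cos x * cos (INR (S n) * x) - cos (INR n * x)).
    { rewrite !S_INR. replace ((INR n + 1 + 1) * x) with ((INR n + 1) * x + x) by ring.
      replace (INR n * x) with ((INR n + 1) * x - x) by ring.
      rewrite cos_plus, cos_minus. ring. }
    rewrite E. cbn [pow]. field. intros K; apply Hd; lra.
Qed.

Section Bounds.

Variables (sg : R) (N : nat).
Hypothesis Hsg : 0 < sg <= / 45.

Let r := exp (- sg).
Let Y := / sg.

Lemma r_bound : 0 < r < 1.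
Proof. apply (exp_neg_bound sg); lra. Qed.

Lemma inv_sg_ge : 45 <= Y.
Proof. unfold Y. replace 45 with (/ / 45) by field. apply Rinv_le_contravar; lra. Qed.

Lemma sg_mul_inv : sg * Y = 1. Proof. unfold Y; field; lra. Qed.

Lemma r2_exp : r ^ 2 = exp (- (2 * sg)).
Proof. unfold r. simpl. rewrite Rmult_1_r, <- exp_plus. f_equal; ring. Qed.

Lemma psum_bounds : psum 1 N r <= Y ^ 2 /\ psum 2 N r <= 20002 / 10000 * Y ^ 3 /\
  psum 3 N r <= 60007 / 10000 * Y ^ 4 /\ psum 4 N r <= 24003 / 1000 * Y ^ 5 /\
  psum 0 N (r ^ 2) <= Y / 2 /\ psum 1 N (r ^ 2) <= Y ^ 2 / 4 /\
  psum 2 N (r ^ 2) <= 20004 / 80000 * Y ^ 3 /\ psum 3 N (r ^ 2) <= 6002 / 16000 * Y ^ 4 /\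
  psum 4 N (r ^ 2) <= 2401 / 3200 * Y ^ 5.
Proof.
  assert (HY := inv_sg_ge). assert (Hr := r_bound).
  assert (Hs2 : 0 < sg ^ 2 <= / 2025) by nra.
  assert (P : forall j, 0 < Y ^ j) by (intros; apply pow_lt; lra).
  assert (P2 := P 2%nat). assert (P3 := P 3%nat). assert (P4 := P 4%nat). assert (P5 := P 5%nat).
    clear P.
  destruct (pgf_upper sg ltac:(lra)) as [A0 [A1 [A2 [A3 A4]]]].
  destruct (pgf_upper (2 * sg) ltac:(lra)) as [B0 [B1 [B2 [B3 B4]]]].
  fold r in A0, A1, A2, A3, A4. fold Y in A0, A1, A2, A3, A4.
  rewrite <- r2_exp in B0, B1, B2, B3, B4.
  assert (EY : / (2 * sg) = Y / 2) by (unfold Y; field; lra).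
  rewrite EY in B0, B1, B2, B3, B4.
  assert (Hr2 : 0 < r ^ 2 < 1) by nra.
  assert (I := fun i Hi => psum_le i N r Hi Hr). assert (J := fun i Hi => psum_le i N (r ^ 2) Hi
    Hr2).
  assert (I1 := I 1%nat ltac:(lia)). assert (I2 := I 2%nat ltac:(lia)).
    assert (I3 := I 3%nat ltac:(lia)). assert (I4 := I 4%nat ltac:(lia)).
  assert (J0 := J 0%nat ltac:(lia)). assert (J1 := J 1%nat ltac:(lia)).
    assert (J2 := J 2%nat ltac:(lia)). assert (J3 := J 3%nat ltac:(lia)).
      assert (J4 := J 4%nat ltac:(lia)).
  assert (Q1 : (1 + sg ^ 2 / 12) ^ 2 <= 10001 / 10000) by nra.
  assert (Q2 : (1 + (2 * sg) ^ 2 / 12) ^ 2 <= 10004 / 10000) by nra.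
  repeat split.
  - lra.
  - eapply Rle_trans; [apply I2|]. eapply Rle_trans; [apply A2|]. nra.
  - eapply Rle_trans; [apply I3|]. eapply Rle_trans; [apply A3|]. nra.
  - eapply Rle_trans; [apply I4|]. eapply Rle_trans; [apply A4|]. nra.
  - lra.
  - lra.
  - eapply Rle_trans; [apply J2|]. eapply Rle_trans; [apply B2|].
    replace (2 * (Y / 2) ^ 3 * (1 + (2 * sg) ^ 2 / 12)) with (Y ^ 3 / 4 * (1 + sg ^ 2 / 3))
      by field. nra.
  - eapply Rle_trans; [apply J3|]. eapply Rle_trans; [apply B3|].
    replace (6 * (Y / 2) ^ 4 * (1 + (2 * sg) ^ 2 / 6)) with (Y ^ 4 * 6 / 16 * (1
      + sg ^ 2 * 4 / 6)) by field. nra.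
  - eapply Rle_trans; [apply J4|]. eapply Rle_trans; [apply B4|].
    replace (24 * (Y / 2) ^ 5) with (Y ^ 5 * 24 / 32) by field. nra.
Qed.

(** For large [N] and small [sg] the true constants are [i! * PI^2 / 4], about 2.47, 4.93, 14.8 and
    59.2; the excess stems mainly from the Laurent bounds used for the odd indices [m >= 3]. *)
Lemma kappa_upper : kappa cum1 1 N r <= 5 / 2 * Y ^ 2 /\ kappa cum2 2 N r <= 51 / 10 * Y ^ 3 /\
  kappa cum3 3 N r <= 1535 / 100 * Y ^ 4 /\ kappa cum4 4 N r <= 63 * Y ^ 5.
Proof.
  assert (HY := inv_sg_ge).
  destruct psum_bounds as [P1 [P2 [P3 [P4 [Q0 [Q1 [Q2 [Q3 Q4]]]]]]]].
  pose proof (kappa1_raw sg N Hsg) as K1. pose proof (kappa2_raw sg N Hsg) as K2.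
  pose proof (kappa3_raw sg N Hsg) as K3. pose proof (kappa4_raw sg N Hsg) as K4.
  fold r in K1, K2, K3, K4. fold Y in K1, K2, K3, K4.
  assert (M : forall j a b, a <= b -> Y ^ j * a <= Y ^ j * b).
  { intros; apply Rmult_le_compat_l; auto. apply pow_le; lra. }
  assert (P : forall j, 0 < Y ^ j) by (intros; apply pow_lt; lra).
  assert (L2 := P 2%nat). assert (L3 := P 3%nat). assert (L4 := P 4%nat). assert (L5 := P 5%nat).
  repeat split.
  - pose proof (M 1%nat _ _ Q0). lra.
  - pose proof (M 1%nat _ _ Q1). pose proof (M 2%nat _ _ Q0). lra.
  - pose proof (M 1%nat _ _ Q2). pose proof (M 2%nat _ _ Q1). pose proof (M 3%nat _ _ Q0).
    assert (Y ^ 3 * 45 <= Y ^ 4) by (replace (Y ^ 4) with (Y ^ 3 * Y) by ring;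
      apply Rmult_le_compat_l; lra). lra.
  - pose proof (M 1%nat _ _ Q3). pose proof (M 2%nat _ _ Q2). pose proof (M 3%nat _ _ Q1).
    pose proof (M 4%nat _ _ Q0).
    lra.
Qed.

Hypothesis HN : r ^ N * (INR N + 1) ^ 2 * Y ^ 2 <= / 100000.

Lemma tail_factor_small : 0 <= r ^ N * (INR N + 1) ^ 2 <= / 100000 /\ 0 <= r ^ N * Y ^ 2
  <= / 100000.
Proof.
  assert (HY := inv_sg_ge). assert (Hr := r_bound). assert (HI := pos_INR N).
  assert (0 <= r ^ N) by (apply pow_le; lra).
  assert (1 <= (INR N + 1) ^ 2) by nra. assert (1 <= Y ^ 2) by nra.
  repeat split; try (apply Rmult_le_pos; auto; lra).
  - assert (0 <= r ^ N * (INR N + 1) ^ 2) by (apply Rmult_le_pos; lra). nra.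
  - assert (0 <= r ^ N * Y ^ 2) by (apply Rmult_le_pos; lra). nra.
Qed.

Lemma psum2_lower (m : R) : 1 <= m <= 5 -> exp (- (m * sg)) ^ N <= r ^ N ->
  (2 - m ^ 2 * sg ^ 2 / 2 - / 10000) * (Y / m) ^ 3 <= psum 2 N (exp (- (m * sg))).
Proof.
  intros Hm Hle. assert (Hx : 0 < m * sg <= / 3) by (split; nra).
  assert (HY := inv_sg_ge). assert (HI := pos_INR N).
  set (y := exp (- (m * sg))) in *.
  assert (Hy : 0 < y < 1) by (apply (exp_neg_bound (m * sg)); lra).
  destruct (pgf_upper (m * sg) Hx) as [A0 [A1 [A2 _]]]. pose proof (pgf2_lower (m * sg) Hx) as B.
  fold y in A0, A1, A2, B.
  assert (EY : / (m * sg) = Y / m) by (unfold Y; field; lra).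
  rewrite EY in A0, A1, A2, B. set (X := Y / m) in *.
  assert (HX : 9 <= X) by (unfold X; apply Rle_div_r; lra).
  rewrite psum2_eq by auto.
  assert (HX3 : 0 < X ^ 3) by (apply pow_lt; lra).
  assert (T : INR N ^ 2 * pgf 0 y + 2 * INR N * pgf 1 y + pgf 2 y <= 3 * X ^ 3 * (INR N + 1) ^ 2).
  { assert (X ^ 2 <= X ^ 3) by (replace (X ^ 3) with (X ^ 2 * X) by ring; nra).
    assert (pgf 0 y <= X ^ 3) by nra. assert (pgf 1 y <= X ^ 3) by lra.
    assert (pgf 2 y <= 3 * X ^ 3).
    { eapply Rle_trans; [apply A2|]. assert ((m * sg) ^ 2 <= 1) by nra. nra. }
    assert (INR N ^ 2 * pgf 0 y <= INR N ^ 2 * X ^ 3) by (apply Rmult_le_compat_l;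
      [apply pow2_ge_0|auto]).
    assert (2 * INR N * pgf 1 y <= 2 * INR N * X ^ 3) by (apply Rmult_le_compat_l; lra).
    assert (0 <= INR N * X ^ 3) by (apply Rmult_le_pos; lra).
    assert (0 <= INR N ^ 2 * X ^ 3) by (apply Rmult_le_pos; [apply pow2_ge_0|lra]). lra. }
  assert (T2 : y ^ N * (INR N ^ 2 * pgf 0 y + 2 * INR N * pgf 1 y + pgf 2 y) <= / 10000 * X ^ 3).
  { assert (0 <= y ^ N) by (apply pow_le; lra).
    apply Rle_trans with (r ^ N * (3 * X ^ 3 * (INR N + 1) ^ 2)).
    - apply Rmult_le_compat; auto.
      assert (0 <= pgf 0 y /\ 0 <= pgf 1 y /\ 0 <= pgf 2 y) as [? [? ?]] by (repeat split;
        apply pgf_nonneg; auto).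
      apply Rplus_le_le_0_compat; [apply Rplus_le_le_0_compat|auto]; apply Rmult_le_pos; auto;
        [apply pow2_ge_0|lra].
    - replace (r ^ N * (3 * X ^ 3 * (INR N + 1) ^ 2)) with (3 * X ^ 3 * (r ^ N * (INR N
      + 1) ^ 2)) by ring.
      destruct tail_factor_small as [[_ T1] _]. nra. }
  nra.
Qed.

Lemma exp_pow_le (m : R) : 1 <= m -> exp (- (m * sg)) ^ N <= r ^ N.
Proof.
  intros Hm. apply pow_incr. split; [apply Rlt_le, exp_pos|].
  unfold r. assert (K : - (m * sg) <= - sg) by nra.
  destruct K as [K|K]; [left; apply exp_increasing; auto|rewrite K; lra].
Qed.

(** The indices 1, 3, 5 of the odd series contribute [4 * (1 + 1/9 + 1/25)], about 4.604, times
    [Y ^ 3]; the remainder of the series is dropped. *)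
Lemma kappa2_lower : 459 / 100 * Y ^ 3 <= kappa cum2 2 N r.
Proof.
  assert (HY := inv_sg_ge).
  assert (E : 2 * psum 2 N (exp (- (1 * sg))) + 6 * psum 2 N (exp (- (3 * sg)))
    + 10 * psum 2 N (exp (- (5 * sg))) <= kappa cum2 2 N r).
  { unfold kappa, psum. rewrite <- !sum1_scal, <- !sum1_plus. apply sum1_le. intros k Hk.
    assert (K := INR_ge_1 k ltac:(lia)). assert (Hkx : 0 < INR k * sg) by nra.
    pose proof (cum2_three_terms _ Hkx) as C. rewrite <- r_pow in C. fold r in C.
    assert (Em : forall m, exp (- (INR m * sg)) ^ k = (r ^ k) ^ m).
    { intros m. rewrite <- r_pow. fold r. rewrite <- !pow_mult. f_equal; lia. }
    pose proof (Em 1%nat) as E1. pose proof (Em 3%nat) as E3. pose proof (Em 5%nat) as E5.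
    rewrite INR_IZR_INZ in E1, E3, E5. simpl IZR in E1, E3, E5. rewrite E1, E3, E5.
    assert (0 <= INR k ^ 2) by apply pow2_ge_0.
    apply (Rmult_le_compat_l _ _ _ H) in C. simpl pow in *. lra. }
  pose proof (psum2_lower 1 ltac:(lra) (exp_pow_le 1 ltac:(lra))).
  pose proof (psum2_lower 3 ltac:(lra) (exp_pow_le 3 ltac:(lra))).
  pose proof (psum2_lower 5 ltac:(lra) (exp_pow_le 5 ltac:(lra))).
  assert (Hs2 : 0 < sg ^ 2 <= / 2025) by nra.
  assert (0 < Y ^ 3) by (apply pow_lt; lra).
  eapply Rle_trans; [|apply E].
  assert ((2 - 1 ^ 2 * sg ^ 2 / 2 - / 10000) * (Y / 1) ^ 3 >= 1999 / 1000 * Y ^ 3) by nra.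
  assert ((2 - 3 ^ 2 * sg ^ 2 / 2 - / 10000) * (Y / 3) ^ 3 >= 1997 / 27000 * Y ^ 3) by nra.
  assert ((2 - 5 ^ 2 * sg ^ 2 / 2 - / 10000) * (Y / 5) ^ 3 >= 1993 / 125000 * Y ^ 3) by nra.
  lra.
Qed.

(** [fac_log_gain] leaves the single harmonic [r ^ k * (1 - cos (k x))], so the sum over [k] is
    geometric; [1 / 10000] pays for cutting it at [N]. *)
Lemma prod_log_gain x :
  prod_log r N x <= - (2 * (r * (1 + r) * (1 - cos x) / ((1 - r) * ((1 - r) ^ 2
    + 2 * r * (1 - cos x)))) - / 10000).
Proof.
  assert (HY := inv_sg_ge). assert (Hr := r_bound). pose proof (COS_bound x) as Hc.
  assert (H1 : prod_log r N x <= -2 * (sum1 N (fun k => r ^ k) - sum1 N (fun k => r ^ k * cos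
    (INR k * x)))).
  { replace (-2 * (sum1 N (fun k => r ^ k) - sum1 N (fun k => r ^ k * cos (INR k * x)))) with
      (-2 * sum1 N (fun k => r ^ k) + 2 * sum1 N (fun k => r ^ k * cos (INR k * x))) by ring.
    unfold prod_log. rewrite <- !sum1_scal, <- sum1_plus. apply sum1_le. intros k Hk.
    destruct k as [|k]; [lia|].
    pose proof (fac_log_gain (r ^ S k) (rpow_bound r Hr k) (INR (S k) * x)). lra. }
  eapply Rle_trans; [apply H1|]. clear H1.
  assert (Hd : 0 < 1 - 2 * r * cos x + r ^ 2) by nra.
  assert (Hd2 : (1 - r) ^ 2 <= 1 - 2 * r * cos x + r ^ 2) by nra.
  rewrite sum_cos_geom by lra.
  assert (E0 : sum1 N (fun k => r ^ k) = r / (1 - r) - r ^ N * (r / (1 - r))).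
  { transitivity (psum 0 N r); [apply sum1_ext; intros; simpl; ring|apply (psum0_eq N r Hr)]. }
  rewrite E0.
  assert (Hi : / (1 - r) <= 103 / 100 * Y).
  { destruct (pgf_upper sg ltac:(lra)) as [A0 _]. fold r in A0. fold Y in A0. unfold pgf in A0.
    replace (/ (1 - r)) with (r / (1 - r) + 1) by (field; lra). lra. }
  assert (Hi0 : 0 < / (1 - r)) by (apply Rinv_0_lt_compat; lra).
  assert (Hid : 0 < / (1 - 2 * r * cos x + r ^ 2) <= (103 / 100 * Y) ^ 2).
  { split; [apply Rinv_0_lt_compat; auto|]. apply Rle_trans with (/ (1 - r) ^ 2).
    - apply Rinv_le_contravar; [apply pow_lt; lra|auto].
    - rewrite <- pow_inv. apply pow_incr; lra. }
  set (D := 1 - 2 * r * cos x + r ^ 2) in *.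
  set (T := r * cos (INR (S N) * x) - r ^ 2 * cos (INR N * x)).
  replace ((r * cos x - r ^ 2 - r ^ S N * cos (INR (S N) * x) + r ^ S (S N) * cos (INR N * x)) / D)
    with ((r * cos x - r ^ 2) / D - r ^ N * (T / D)) by (unfold T; cbn [pow]; field; lra).
  assert (EG : r * (1 + r) * (1 - cos x) / ((1 - r) * ((1 - r) ^ 2
    + 2 * r * (1 - cos x))) = r / (1 - r) - (r * cos x - r ^ 2) / D).
  { replace ((1 - r) ^ 2 + 2 * r * (1 - cos x)) with D by (unfold D; ring).
    unfold D in *. field. split; lra. }
  rewrite EG.
  assert (HT : -2 <= T <= 2).
  { pose proof (COS_bound (INR (S N) * x)). pose proof (COS_bound (INR N * x)). unfold T.
    split; nra. }
  assert (HT2 : - (2 * (103 / 100 * Y) ^ 2) <= T / D <= 2 * (103 / 100 * Y) ^ 2).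
  { unfold Rdiv. split; nra. }
  destruct tail_factor_small as [_ [T1 T2]].
  assert (Hp : 0 <= r ^ N) by (apply pow_le; lra).
  assert (r ^ N * (r / (1 - r)) <= r ^ N * Y ^ 2).
  { apply Rmult_le_compat_l; auto. unfold Rdiv. nra. }
  assert (- (r ^ N * (2 * (103 / 100 * Y) ^ 2)) <= r ^ N * (T / D)) by nra.
  nra.
Qed.

Lemma one_minus_r_le : 1 - r <= sg.
Proof. unfold r. pose proof (exp_ineq1_le (- sg)). lra. Qed.

(** With [v = 1 - cos x], the gain is governed by [v / (sg^2 + 2 * v)], increasing in [v], so the
    smallest angle [a * sg] decides. The [1 / 10000] in the numerator covers the quartic term of the
    cosine, and 1.93 is a lower bound for [r * (1 + r)]. *)
Lemma prod_log_le_far (a : R) (x : R) : 0 < a <= 1 -> a * sg <= x <= PI ->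
  prod_log r N x <= - (193 / 100 * ((a ^ 2 - / 10000) / (1 + a ^ 2)) * Y - / 10000).
Proof.
  intros Ha Hx. assert (HY := inv_sg_ge). assert (Hr := r_bound). pose proof one_minus_r_le as H1.
  pose proof sg_mul_inv as HsY.
  eapply Rle_trans; [apply prod_log_gain|].
  apply Ropp_le_contravar. apply Rplus_le_compat_r.
  set (v := 1 - cos x).
  set (b := (a ^ 2 - / 10000) / 2).
  assert (Hpi : a * sg <= PI) by lra.
  assert (Has : 0 <= a * sg <= sg) by nra.
  assert (Hv : b * sg ^ 2 <= v).
  { unfold v. assert (cos x <= cos (a * sg)) by (apply cos_decr_1; lra).
    pose proof (cos_le_quartic (a * sg) ltac:(lra)) as C.
    assert ((a * sg) ^ 4 <= 1 / 2025 * sg ^ 2).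
    { replace ((a * sg) ^ 4) with ((a * sg) ^ 2 * (a * sg) ^ 2) by ring.
      assert (0 <= (a * sg) ^ 2 <= sg ^ 2) by (split; [apply pow2_ge_0|apply pow_incr; lra]).
      assert (sg ^ 2 <= 1 / 2025) by nra. nra. }
    assert ((a * sg) ^ 2 = a ^ 2 * sg ^ 2) by ring.
    assert (0 <= sg ^ 2) by apply pow2_ge_0. unfold b. nra. }
  destruct (Rle_dec b 0) as [Hb|Hb].
  - apply Rle_trans with 0.
    + replace (a ^ 2 - / 10000) with (2 * b) by (unfold b; field).
      assert (0 < / (1 + a ^ 2)) by (apply Rinv_0_lt_compat; nra). unfold Rdiv.
      assert (2 * b * / (1 + a ^ 2) <= 0) by nra. nra.
    + pose proof (COS_bound x). apply Rmult_le_pos; [lra|].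
      destruct (Req_dec v 0) as [->|]; [unfold Rdiv; rewrite Rmult_0_r, Rmult_0_l; lra|].
      assert (0 < v) by (unfold v in *; lra).
      apply Rle_mult_inv_pos; [apply Rmult_le_pos; nra|]. apply Rmult_lt_0_compat; [lra|].
      assert (0 < (1 - r) ^ 2) by (apply pow_lt; lra). nra.
  - assert (Hb0 : 0 < b) by lra.
    assert (Hs2 : 0 < sg ^ 2) by (apply pow_lt; lra).
    assert (Hv0 : 0 < v) by nra.
    assert (Hr2 : 1933 / 1000 <= r * (1 + r)).
    { assert (sg <= / 45) by lra. assert (977 / 1000 <= r) by lra. nra. }
    assert (Hq : b / (1 + a ^ 2) <= v / (sg ^ 2 + 2 * v)).
    { apply Rle_trans with (b * sg ^ 2 / (sg ^ 2 + 2 * (b * sg ^ 2))).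
      - replace (b * sg ^ 2 / (sg ^ 2 + 2 * (b * sg ^ 2))) with (b / (1 + 2 * b)) by (field;
        split; nra).
        apply Rmult_le_compat_l; [lra|]. apply Rinv_le_contravar; [lra|]. unfold b. lra.
      - apply Rle_div_l; [nra|]. replace (v / (sg ^ 2 + 2 * v) * (sg ^ 2
        + 2 * (b * sg ^ 2))) with (v * (sg ^ 2 + 2 * (b * sg ^ 2)) / (sg ^ 2 + 2 * v)) by (field;
          nra).
        apply -> Rle_div_r; [|nra]. assert (b * sg ^ 2 * sg ^ 2 <= v * sg ^ 2)
          by (apply Rmult_le_compat_r; lra). lra. }
    replace (193 / 100 * ((a ^ 2 - / 10000) / (1 + a ^ 2)) * Y)
      with (2 * (193 / 100 * (b / (1 + a ^ 2)) * Y)) by (unfold b; field; nra).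
    apply Rmult_le_compat_l; [lra|].
    apply Rle_trans with (1933 / 1000 * (v / (sg ^ 2 + 2 * v)) * Y).
    { apply Rmult_le_compat_r; [lra|]. apply Rmult_le_compat; try lra.
      apply Rle_mult_inv_pos; nra. }
    replace (1933 / 1000 * (v / (sg ^ 2 + 2 * v)) * Y) with (1933 / 1000 * v * / (sg * (sg ^ 2
      + 2 * v))) by (unfold Y; field; split; nra).
    assert (0 < (1 - r) ^ 2) by (apply pow_lt; lra).
    assert ((1 - r) ^ 2 <= sg ^ 2) by (apply pow_incr; lra).
    unfold Rdiv. apply Rmult_le_compat; [nra| | |].
    + apply Rlt_le, Rinv_0_lt_compat, Rmult_lt_0_compat; nra.
    + apply Rmult_le_compat_r; lra.
    + apply Rinv_le_contravar; [apply Rmult_lt_0_compat; nra|].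
      apply Rmult_le_compat; nra.
Qed.

End Bounds.

(** * The saddle point *)

Lemma exp_pow_lower n : 27178 / 10000 * (27178 / 10000) ^ n <= exp (INR (S n)).
Proof.
  assert (H : 27178 / 10000 <= exp 1).
  { replace 1 with (INR 32 * (/ 32)) by (simpl; field). rewrite exp_mult_INR.
    apply Rle_trans with ((1 + / 32 + (/ 32) ^ 2 / 2) ^ 32); [lra|].
    apply pow_incr. split; [lra|]. apply exp_ge_quad; lra. }
  replace (INR (S n)) with (INR (S n) * 1) by ring. rewrite exp_mult_INR.
  cbn [pow]. apply (pow_incr _ _ (S n)). lra.
Qed.

(** [Y ^ j * exp (- a * Y)] decreases beyond [j / a], which is at most 45; it is compared with its
    value at 45 through [Y / 45 <= exp ((Y - 45) / 45)]. *)
Lemma poly_exp_decay (j : nat) (a Y : R) : INR j / 45 <= a -> 45 <= Y ->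
  Y ^ j * exp (- (a * Y)) <= 45 ^ j * exp (- (a * 45)).
Proof.
  intros Ha HY.
  assert (H : Y ^ j <= 45 ^ j * exp (INR j * ((Y - 45) / 45))).
  { rewrite exp_mult_INR, <- Rpow_mult_distr. apply pow_incr. split; [lra|].
    pose proof (exp_ineq1_le ((Y - 45) / 45)). lra. }
  assert (P := exp_pos (- (a * Y))).
  apply Rle_trans with (45 ^ j * exp (INR j * ((Y - 45) / 45)) * exp (- (a * Y))).
  { apply Rmult_le_compat_r; lra. }
  rewrite Rmult_assoc, <- exp_plus. apply Rmult_le_compat_l; [apply pow_le; lra|].
  assert (K : INR j * ((Y - 45) / 45) + - (a * Y) <= - (a * 45)) by nra.
  destruct K as [K|K]; [left; apply exp_increasing; auto|rewrite K; lra].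
Qed.

Lemma exp_neg_le_inv a c : 0 < c -> c <= exp a -> exp (- a) <= / c.
Proof. intros Hc H. rewrite exp_Ropp. apply Rinv_le_contravar; auto. Qed.

Lemma near_tail_small Y : 45 <= Y -> Y ^ 2 * exp (- (3128 / 10000 * Y)) <= 158 / 100000.
Proof.
  intros HY. eapply Rle_trans; [apply (poly_exp_decay 2); simpl; lra|].
  assert (H : exp (- (3128 / 10000 * 45)) <= / 1281646).
  { apply exp_neg_le_inv; [lra|]. replace (3128 / 10000 * 45) with (INR 14 + 76 / 1000)
    by (simpl; field).
    rewrite exp_plus. apply Rle_trans with ((27178 / 10000 * (27178 / 10000) ^ 13) * (1
      + 76 / 1000 + (76 / 1000) ^ 2 / 2)); [lra|].
    apply Rmult_le_compat; [lra|lra|apply (exp_pow_lower 13)|apply exp_ge_quad; lra]. }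
  lra.
Qed.

Lemma far_tail_small Y : 45 <= Y -> Y ^ 6 * exp (- (9648 / 10000 * Y)) <= / 100000000.
Proof.
  intros HY. eapply Rle_trans; [apply (poly_exp_decay 6); simpl; lra|].
  assert (H : exp (- (9648 / 10000 * 45)) <= / 10 ^ 18).
  { apply exp_neg_le_inv; [lra|]. apply Rle_trans with (exp (INR 43)).
    - apply Rle_trans with (27178 / 10000 * (27178 / 10000) ^ 42); [lra|apply (exp_pow_lower 42)].
    - rewrite INR_IZR_INZ. simpl IZR. left; apply exp_increasing. lra. }
  lra.
Qed.

Section Saddle.

Variables (sg : R) (N : nat) (n : Z).
Hypothesis Hsg : 0 < sg <= / 45.

Let r := exp (- sg).
Let Y := / sg.

Hypothesis HN : r ^ N * (INR N + 1) ^ 2 * Y ^ 2 <= / 100000.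
Hypothesis Hsaddle : kappa cum1 1 N r = IZR n + / 2.

Let Hr : 0 < r < 1 := r_bound sg Hsg.
Let U := prod_log r N.
Let W (x : R) := prod_arg r N x - (IZR n + / 2) * x.
Let K2 := kappa cum2 2 N r.
Let K3 := kappa cum3 3 N r.
Let K4 := kappa cum4 4 N r.
Let t := sqrt K2.

Lemma pow_bound k : (1 <= k)%nat -> 0 < r ^ k < 1.
Proof. destruct k; [lia|]. intros _; apply rpow_bound; auto. Qed.

Lemma kappa_scal a i x : kappa a i N r * x ^ i = sum1 N (fun k => a (r ^ k) * (INR k * x) ^ i).
Proof.
  unfold kappa. rewrite Rmult_comm, <- sum1_scal. apply sum1_ext. intros.
    rewrite Rpow_mult_distr; ring.
Qed.

Lemma kappa2_sqrt : t ^ 2 = K2 /\ 0 < t /\ 459 / 100 * Y ^ 3 <= K2 <= 51 / 10 * Y ^ 3 /\ 45 <= Y.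
Proof.
  assert (HY : 45 <= Y) by (apply (inv_sg_ge sg Hsg)).
  pose proof (kappa2_lower sg N Hsg HN) as L. destruct (kappa_upper sg N Hsg) as [_ [H2 _]].
  fold r Y in L, H2. fold K2 in L, H2.
  assert (0 < Y ^ 3) by (apply pow_lt; lra).
  assert (0 < K2) by lra.
  repeat split; auto.
  - unfold t. apply pow2_sqrt; lra.
  - apply sqrt_lt_R0; auto.
Qed.

Lemma U_lower x : 0 <= x -> - (t ^ 2 * x ^ 2 / 2) <= U x.
Proof.
  intros Hx. destruct kappa2_sqrt as [-> _]. unfold K2. rewrite kappa_scal.
  replace (- (sum1 N (fun k => cum2 (r ^ k) * (INR k * x) ^ 2) / 2)) with
    ((- / 2) * sum1 N (fun k => cum2 (r ^ k) * (INR k * x) ^ 2)) by field.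
  rewrite <- sum1_scal. apply sum1_le. intros k Hk.
  pose proof (fac_log_lower (r ^ k) (pow_bound k ltac:(lia)) (INR k * x)) as F.
  assert (0 <= INR k * x) by (apply Rmult_le_pos; [apply pos_INR|auto]). specialize (F H). lra.
Qed.

Lemma U_upper x : 0 <= x -> U x <= - (t ^ 2 * x ^ 2 / 2) + K4 * x ^ 4 / 24.
Proof.
  intros Hx. destruct kappa2_sqrt as [-> _]. unfold K2, K4. rewrite 2!kappa_scal.
  replace (- (sum1 N (fun k => cum2 (r ^ k) * (INR k * x) ^ 2) / 2)
    + sum1 N (fun k => cum4 (r ^ k) * (INR k * x) ^ 4) / 24) with
    ((- / 2) * sum1 N (fun k => cum2 (r ^ k) * (INR k * x) ^ 2)
      + / 24 * sum1 N (fun k => cum4 (r ^ k) * (INR k * x) ^ 4)) by field.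
  rewrite <- !sum1_scal, <- sum1_plus. apply sum1_le. intros k Hk.
  pose proof (fac_log_upper (r ^ k) (pow_bound k ltac:(lia)) (INR k * x)) as F.
  assert (0 <= INR k * x) by (apply Rmult_le_pos; [apply pos_INR|auto]). specialize (F H). lra.
Qed.

Lemma U_mono x y : 0 <= x <= y -> U x + t ^ 2 * x ^ 2 / 2 <= U y + t ^ 2 * y ^ 2 / 2.
Proof.
  intros Hxy. destruct kappa2_sqrt as [-> _]. unfold K2. rewrite 2!kappa_scal.
  unfold Rdiv. rewrite !(Rmult_comm _ (/ 2)), <- !sum1_scal. unfold U, prod_log.
    rewrite <- !sum1_plus.
  apply sum1_le. intros k Hk.
  pose proof (cum2_mono (r ^ k) (pow_bound k ltac:(lia)) (INR k * x) (INR k * y)) as F.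
  assert (0 <= INR k * x <= INR k * y).
  { pose proof (pos_INR k). split; [apply Rmult_le_pos; lra|apply Rmult_le_compat_l; lra]. }
  specialize (F H). lra.
Qed.

Lemma W_bound x : 0 <= x -> Rabs (W x) <= K3 * x ^ 3 / 6.
Proof.
  intros Hx. unfold W. rewrite <- Hsaddle. rewrite <- (pow_1 x) at 2. rewrite kappa_scal.
    unfold K3. rewrite kappa_scal.
  assert (P : forall k, 0 <= INR k * x) by (intros; apply Rmult_le_pos; [apply pos_INR|auto]).
  assert (HA : prod_arg r N x <= sum1 N (fun k => cum1 (r ^ k) * (INR k * x) ^ 1)).
  { apply sum1_le. intros k Hk. rewrite pow_1. apply fac_arg_upper; auto. apply pow_bound; lia. }
  assert (HB : sum1 N (fun k => cum1 (r ^ k) * (INR k * x) ^ 1)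
    + (- / 6) * sum1 N (fun k => cum3 (r ^ k) * (INR k * x) ^ 3) <= prod_arg r N x).
  { rewrite <- sum1_scal, <- sum1_plus. apply sum1_le. intros k Hk. rewrite pow_1.
    pose proof (fac_arg_lower (r ^ k) (pow_bound k ltac:(lia)) (INR k * x) (P k)). lra. }
  rewrite Rabs_left1 by lra. lra.
Qed.

Lemma kappa_nonneg a i : (forall rho, 0 < rho < 1 -> 0 <= a rho) -> 0 <= kappa a i N r.
Proof.
  intros Ha. replace 0 with (sum1 N (fun k => 0 * 0)).
  2:{ rewrite sum1_scal; ring. }
  apply sum1_le. intros k Hk. rewrite Rmult_0_l. apply Rmult_le_pos; [apply pow_le, pos_INR|].
  apply Ha, pow_bound; lia.
Qed.

Lemma cum3_nonneg rho : 0 < rho < 1 -> 0 <= cum3 rho.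
Proof.
  intros H. unfold cum3. apply Rle_mult_inv_pos; [|apply pow_lt; nra].
  assert (0 <= rho ^ 4) by (apply pow_le; lra). apply Rmult_le_pos; nra.
Qed.

Lemma cum4_nonneg rho : 0 < rho < 1 -> 0 <= cum4 rho.
Proof.
  intros H. unfold cum4. apply Rle_mult_inv_pos; [|apply pow_lt; nra].
  assert (0 <= rho ^ 4) by (apply pow_le; lra). apply Rmult_le_pos; [apply Rmult_le_pos|]; nra.
Qed.

(** The factor 0.44 is a compromise: a larger one would widen the Gaussian too much through
    [k4 * L^2], a smaller one would slow the decay beyond [L]. The rates 0.3128 and 0.9648 are those
    of [prod_log_le_far] at [a = 0.44] and [a = 1], rounded down. *)
Let L := 44 / 100 * sg.
Let e2 := exp (- (3128 / 10000 * Y)).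
Let e3 := exp (- (9648 / 10000 * Y)).
Let tl (j : nat) := e2 * sg ^ (j + 1) + e3 * 4 ^ (j + 1).

Lemma U_tail2 x : L <= x <= sg -> exp (U x) <= e2.
Proof.
  intros Hx. destruct kappa2_sqrt as [_ [_ [_ HY]]]. pose proof PI2_1.
  pose proof (prod_log_le_far sg N Hsg HN (44 / 100) x ltac:(lra) ltac:(unfold L in Hx; lra)) as F.
  fold r Y in F. fold U in F.
  assert (F2 : U x <= - (3128 / 10000 * Y)) by lra.
  destruct F2 as [F2|F2]; [left; apply exp_increasing; auto|rewrite F2; unfold e2; lra].
Qed.

Lemma U_tail3 x : sg <= x <= PI -> exp (U x) <= e3.
Proof.
  intros Hx. destruct kappa2_sqrt as [_ [_ [_ HY]]].
  pose proof (prod_log_le_far sg N Hsg HN 1 x ltac:(lra) ltac:(lra)) as F.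
  fold r Y in F. fold U in F.
  assert (F2 : U x <= - (9648 / 10000 * Y)) by lra.
  destruct F2 as [F2|F2]; [left; apply exp_increasing; auto|rewrite F2; unfold e3; lra].
Qed.

Lemma t_large : 143 / 10 * Y <= t.
Proof.
  destruct kappa2_sqrt as [Et [Ht [[H1 H2] HY]]].
  apply Rsqr_incr_0_var; [|lra]. rewrite !Rsqr_pow2, Et.
  assert (0 < Y ^ 2) by (apply pow_lt; lra).
  assert (Y ^ 2 * 45 <= Y ^ 3) by (replace (Y ^ 3) with (Y ^ 2 * Y) by ring;
    apply Rmult_le_compat_l; lra).
  nra.
Qed.

(** As [t ^ 2] is of order [Y ^ 3], the worst case is [t ^ 4 * tl 3]: it amounts to about
    [26 * Y^2 * e2], which is why [near_tail_small] is stated with [Y ^ 2]. *)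
Lemma tails_small : t ^ 4 * tl 3 <= 44 / 1000 /\ t ^ 3 * tl 2 <= 3 / 1000 /\
  t ^ 2 * tl 1 <= 25 / 10000 /\ t * tl 0 <= 25 / 10000.
Proof.
  destruct kappa2_sqrt as [Et [Ht [[H1 H2] HY]]]. pose proof t_large as Htl.
  pose proof (near_tail_small Y HY) as E2. pose proof (far_tail_small Y HY) as E3.
  fold e2 in E2. fold e3 in E3.
  assert (P2 : 0 < e2) by apply exp_pos. assert (P3 : 0 < e3) by apply exp_pos.
  assert (sY : sg * Y = 1) by (apply (sg_mul_inv sg Hsg)).
  assert (PY : forall j, 1 <= Y ^ j) by (intros; apply pow_R1_Rle; lra).
  assert (E3' : forall j, (j <= 6)%nat -> Y ^ j * e3 <= / 100000000).
  { intros j Hj. eapply Rle_trans; [|apply E3]. apply Rmult_le_compat_r; [lra|].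
    apply Rle_pow; [lra|auto]. }
  assert (F5 := E3' 5%nat ltac:(lia)). assert (F3 := E3' 3%nat ltac:(lia)).
  assert (Y3 : 0 < Y ^ 3) by (specialize (PY 3%nat); lra).
  assert (T4 : t ^ 4 <= 2601 / 100 * Y ^ 6).
  { replace (t ^ 4) with (t ^ 2 * t ^ 2) by ring. rewrite Et.
    replace (2601 / 100 * Y ^ 6) with ((51 / 10 * Y ^ 3) * (51 / 10 * Y ^ 3)) by field.
      apply Rmult_le_compat; lra. }
  assert (tlp : forall j, 0 <= tl j).
  { intros j. unfold tl. apply Rplus_le_le_0_compat; apply Rmult_le_pos; try lra; apply pow_le;
    lra. }
  assert (S4 : Y ^ 6 * tl 3 = Y ^ 2 * e2 + 256 * (Y ^ 6 * e3)).
  { unfold tl. simpl Nat.add. replace (Y ^ 6 * (e2 * sg ^ 4 + e3 * 4 ^ 4))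
    with (Y ^ 2 * e2 * (sg * Y) ^ 4 + 256 * (Y ^ 6 * e3)) by ring.
    rewrite sY. ring. }
  assert (S3 : Y ^ 5 * tl 2 = Y ^ 2 * e2 + 64 * (Y ^ 5 * e3)).
  { unfold tl. simpl Nat.add. replace (Y ^ 5 * (e2 * sg ^ 3 + e3 * 4 ^ 3))
    with (Y ^ 2 * e2 * (sg * Y) ^ 3 + 64 * (Y ^ 5 * e3)) by ring.
    rewrite sY. ring. }
  assert (S2 : Y ^ 3 * tl 1 = Y * e2 + 16 * (Y ^ 3 * e3)).
  { unfold tl. simpl Nat.add. replace (Y ^ 3 * (e2 * sg ^ 2 + e3 * 4 ^ 2))
    with (Y * e2 * (sg * Y) ^ 2 + 16 * (Y ^ 3 * e3)) by ring.
    rewrite sY. ring. }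
  assert (S1 : Y ^ 3 * tl 0 = Y ^ 2 * e2 + 4 * (Y ^ 3 * e3)).
  { unfold tl. simpl Nat.add. replace (Y ^ 3 * (e2 * sg ^ 1 + e3 * 4 ^ 1))
    with (Y ^ 2 * e2 * (sg * Y) ^ 1 + 4 * (Y ^ 3 * e3)) by ring.
    rewrite sY. ring. }
  assert (Ye : 45 * (Y * e2) <= 158 / 100000).
  { eapply Rle_trans; [|apply E2]. replace (Y ^ 2 * e2) with (Y * (Y * e2)) by ring.
    apply Rmult_le_compat_r; nra. }
  split; [|split; [|split]].
  - apply Rle_trans with (2601 / 100 * Y ^ 6 * tl 3); [apply Rmult_le_compat_r; auto|].
    rewrite Rmult_assoc, S4. lra.
  - apply Rle_trans with (182 / 100 * (Y ^ 5 * tl 2)); [|rewrite S3; lra].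
    rewrite <- Rmult_assoc. apply Rmult_le_compat_r; auto.
    apply Rmult_le_reg_r with (143 / 10 * Y); [lra|].
    apply Rle_trans with (t ^ 3 * t). { apply Rmult_le_compat_l; [apply pow_le; lra|auto]. }
    replace (t ^ 3 * t) with (t ^ 4) by ring. replace (182 / 100 * Y ^ 5 * (143 / 10 * Y))
      with (26026 / 1000 * Y ^ 6) by field.
    specialize (PY 6%nat). lra.
  - rewrite Et. apply Rle_trans with (51 / 10 * Y ^ 3 * tl 1); [apply Rmult_le_compat_r; auto|].
    rewrite Rmult_assoc, S2. lra.
  - apply Rle_trans with (t ^ 2 / 10 * tl 0); [apply Rmult_le_compat_r; auto; nra|].
    rewrite Et. apply Rle_trans with (51 / 100 * Y ^ 3 * tl 0); [apply Rmult_le_compat_r; auto;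
      lra|].
    rewrite Rmult_assoc, S1. lra.
Qed.

Let w (y : R) : R := RInt (fun x => exp (U x) * cos (W x - y * x)) 0 PI.

Lemma saddle_turan :
  0 < 4 * (w (- (1 / 2)) ^ 2 - w (- (3 / 2)) * w (1 / 2)) * (w (1 / 2) ^ 2 - w (- (1 / 2)) * w (3
    / 2))
    - (w (- (1 / 2)) * w (1 / 2) - w (- (3 / 2)) * w (3 / 2)) ^ 2.
Proof.
  destruct kappa2_sqrt as [Et [Ht [[H1 H2] HY]]]. pose proof t_large as Htl.
  destruct (kappa_upper sg N Hsg) as [_ [_ [U3 U4]]]. fold r Y in U3, U4. fold K3 in U3.
    fold K4 in U4.
  assert (sY : sg * Y = 1) by (apply (sg_mul_inv sg Hsg)).
  assert (P : forall j, 0 < Y ^ j) by (intros; apply pow_lt; lra).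
  assert (P3 := P 3%nat). assert (P5 := P 5%nat). assert (P8 := P 8%nat). assert (P6 := P 6%nat).
    assert (P4 := P 4%nat).
  destruct tails_small as [T3 [T2 [T1 T0]]].
  assert (K3p : 0 <= K3) by (apply kappa_nonneg, cum3_nonneg).
  assert (K4p : 0 <= K4) by (apply kappa_nonneg, cum4_nonneg).
  apply (local_limit_turan U W t K3 K4 L sg e2 e3).
  - apply prod_log_smooth; auto.
  - intros x. apply (ex_derive_minus (V := R_NormedModule) (prod_arg r N)).
    + apply prod_arg_smooth; auto.
    + auto_derive; auto.
  - lra.
  - apply Rsqr_incr_0_var; [|apply Rmult_le_pos; unfold L; lra].
    rewrite !Rsqr_pow2, Rpow_mult_distr, Et. unfold L.
    apply Rle_trans with (459 / 100 * Y ^ 3 * (44 / 100 * sg) ^ 2); [|apply Rmult_le_compat_r;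
      [apply pow2_ge_0|auto]].
    replace (459 / 100 * Y ^ 3 * (44 / 100 * sg) ^ 2) with (459 / 100 * (44 / 100) ^ 2 * Y * (sg
      * Y) ^ 2) by ring.
    rewrite sY. lra.
  - unfold L. nra.
  - unfold L; lra.
  - pose proof PI2_1; lra.
  - apply U_lower.
  - apply U_upper.
  - apply U_mono.
  - apply W_bound.
  - apply U_tail2.
  - apply U_tail3.
  (* With [t^2 = K2 >= 4.59 * Y^3] the square of the claim follows from
     [15.35^2 <= 0.2328^2 * 4.59^3 * Y], almost an equality at [Y = 45]; the constant 0.0665 of the
     next case is equally tight. *)
  - split; auto. apply Rsqr_incr_0_var; [|apply Rmult_le_pos; [lra|apply pow_le; lra]].
    rewrite !Rsqr_pow2. apply Rle_trans with ((1535 / 100 * Y ^ 4) ^ 2); [apply pow_incr; lra|].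
    replace ((2328 / 10000 * t ^ 3) ^ 2) with ((2328 / 10000) ^ 2 * (t ^ 2) ^ 3) by ring.
      rewrite Et.
    apply Rle_trans with ((2328 / 10000) ^ 2 * (459 / 100 * Y ^ 3) ^ 3).
    + replace ((1535 / 100 * Y ^ 4) ^ 2) with ((1535 / 100) ^ 2 * Y ^ 8) by ring.
      replace ((2328 / 10000) ^ 2 * (459 / 100 * Y ^ 3) ^ 3)
        with ((2328 / 10000) ^ 2 * (459 / 100) ^ 3 * Y * Y ^ 8) by ring.
      apply Rmult_le_compat_r; lra.
    + apply Rmult_le_compat_l; [lra|]. apply pow_incr; lra.
  - split; auto. eapply Rle_trans; [apply U4|].
    replace (t ^ 4) with ((t ^ 2) ^ 2) by ring. rewrite Et.
    apply Rle_trans with (665 / 10000 * (459 / 100 * Y ^ 3) ^ 2).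
    + replace (665 / 10000 * (459 / 100 * Y ^ 3) ^ 2) with (665 / 10000 * (459 / 100) ^ 2 * Y * Y
      ^ 5) by ring.
      apply Rmult_le_compat_r; lra.
    + apply Rmult_le_compat_l; [lra|]. apply pow_incr; lra.
  - rewrite Et. unfold L. apply Rle_trans with (63 * Y ^ 5 * (44 / 100 * sg) ^ 2).
    + apply Rmult_le_compat_r; [apply pow2_ge_0|auto].
    + replace (63 * Y ^ 5 * (44 / 100 * sg) ^ 2) with (63 * (44 / 100) ^ 2 * Y ^ 3 * (sg * Y) ^
      2) by ring.
      rewrite sY. lra.
  - exact T3.
  - exact T2.
  - exact T1.
  - exact T0.
Qed.

(** The discriminant is homogeneous of degree 4, and of weight 6 when its arguments have weights 0,
    1, 2, 3. Hence the factors [r ^ m] relating the profile to the counts leave it as one positive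
    factor. *)
Theorem saddle_overpartitions (b : nat -> Z -> Z) : overpartition_system b ->
  (0 < 4 * (b N n ^ 2 - b N (n - 1) * b N (n + 1)) * (b N (n + 1) ^ 2 - b N n * b N (n + 2))
    - (b N n * b N (n + 1) - b N (n - 1) * b N (n + 2)) ^ 2)%Z.
Proof.
  intros Hb.
  pose proof (coef_overpartitions r Hr b Hb N) as HC.
  pose proof saddle_turan as Q.
  set (A := amplitude r N).
  assert (HA : 0 < A) by (apply amplitude_pos; auto).
  assert (Hw : forall m y, IZR m = IZR n + / 2 + y -> A * w y = PI * powerRZ r m * IZR (b N m)).
  { intros m y Hy. rewrite <- HC. unfold coef, w. fold A. f_equal. apply RInt_eq. intros x.
    unfold U, W. f_equal. f_equal. rewrite Hy. ring. }
  assert (P1 := Hw (n - 1)%Z (- (3 / 2)) ltac:(rewrite minus_IZR; lra)).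
  assert (P2 := Hw n (- (1 / 2)) ltac:(lra)).
  assert (P3 := Hw (n + 1)%Z (1 / 2) ltac:(rewrite plus_IZR; lra)).
  assert (P4 := Hw (n + 2)%Z (3 / 2) ltac:(rewrite plus_IZR; lra)).
  set (z := powerRZ r (n - 1)) in *.
  assert (E2 : powerRZ r n = r * z).
  { unfold z. replace n with (1 + (n - 1))%Z at 1 by lia. rewrite powerRZ_add by lra. simpl; ring. }
  assert (E3 : powerRZ r (n + 1) = r ^ 2 * z).
  { unfold z. replace (n + 1)%Z with (2 + (n - 1))%Z at 1 by lia. rewrite powerRZ_add by lra.
    simpl; ring. }
  assert (E4 : powerRZ r (n + 2) = r ^ 3 * z).
  { unfold z. replace (n + 2)%Z with (3 + (n - 1))%Z at 1 by lia. rewrite powerRZ_add by lra.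
    simpl; ring. }
  rewrite E2 in P2. rewrite E3 in P3. rewrite E4 in P4.
  set (a0 := IZR (b N (n - 1)%Z)) in *. set (a1 := IZR (b N n)) in *.
  set (a2 := IZR (b N (n + 1)%Z)) in *. set (a3 := IZR (b N (n + 2)%Z)) in *.
  apply lt_IZR. rewrite minus_IZR, !mult_IZR, minus_IZR, !Z.pow_2_r, !mult_IZR, !minus_IZR,
    !mult_IZR.
  fold a0 a1 a2 a3.
  set (d := 4 * (a1 * a1 - a0 * a2) * (a2 * a2 - a1 * a3) - (a1 * a2 - a0 * a3) * (a1 * a2 - a0 *
    a3)).
  assert (Hz : 0 < z) by (apply powerRZ_lt; lra). pose proof PI_RGT_0 as Hpi.
  assert (EQ : (PI * z) ^ 4 * r ^ 6 * d = A ^ 4 *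
    (4 * (w (- (1 / 2)) ^ 2 - w (- (3 / 2)) * w (1 / 2)) * (w (1 / 2) ^ 2 - w (- (1 / 2)) * w (3
      / 2))
    - (w (- (1 / 2)) * w (1 / 2) - w (- (3 / 2)) * w (3 / 2)) ^ 2)).
  { transitivity (4 * ((A * w (- (1 / 2))) ^ 2 - (A * w (- (3 / 2))) * (A * w (1 / 2))) * ((A * w
    (1 / 2)) ^ 2 - (A * w (- (1 / 2))) * (A * w (3 / 2)))
    - ((A * w (- (1 / 2))) * (A * w (1 / 2)) - (A * w (- (3 / 2))) * (A * w (3 / 2))) ^ 2); [|ring].
    rewrite P1, P2, P3, P4. unfold d. ring. }
  assert (Hpos : 0 < (PI * z) ^ 4 * r ^ 6 * d).
  { rewrite EQ. apply Rmult_lt_0_compat; [apply pow_lt; auto|exact Q]. }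
  assert (0 < (PI * z) ^ 4 * r ^ 6).
  { apply Rmult_lt_0_compat; apply pow_lt; [apply Rmult_lt_0_compat; auto|lra]. }
  apply Rmult_lt_reg_l with ((PI * z) ^ 4 * r ^ 6); auto. rewrite Rmult_0_r. exact Hpos.
Qed.

End Saddle.

(** * Existence of the saddle point *)

Lemma kappa1_continuous N sg : 0 < sg -> continuity_pt (fun s => kappa cum1 1 N (exp (- s))) sg.
Proof.
  intros Hs. apply continuity_pt_filterlim.
  apply (@ex_derive_continuous R_AbsRing R_NormedModule (fun s => kappa cum1 1 N (exp (- s))) sg).
  unfold kappa. induction N as [|N IH]; cbn [sum1].
  - apply ex_derive_const.
  - apply (ex_derive_plus (V := R_NormedModule) (fun s => sum1 N _)); [exact IH|].
    pose proof (rpow_bound (exp (- sg)) ltac:(apply rho_bound; auto) N) as H.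
    unfold cum1. auto_derive. cbn [pow] in H. set (p := exp (- sg) * exp (- sg) ^ N) in *. nra.
Qed.

Lemma kappa1_lower N sg : (1 <= N)%nat -> 0 < sg -> / sg - 1 <= kappa cum1 1 N (exp (- sg)).
Proof.
  intros HN Hs. pose proof (rho_bound sg Hs) as Hr. set (r := exp (- sg)) in *.
  assert (H1 : 1 - sg <= r) by (pose proof (exp_ineq1_le (- sg)); unfold r; lra).
  apply Rle_trans with (cum1 r).
  - unfold cum1. apply Rle_div_r; [nra|].
    assert (E : 1 - r ^ 2 <= 2 * sg) by nra.
    destruct (Rle_dec (/ sg - 1) 0) as [H|H]; [assert (0 <= (1 - / sg) * (1 - r ^ 2))
      by (apply Rmult_le_pos; nra); lra|].
    apply Rle_trans with ((/ sg - 1) * (2 * sg)); [apply Rmult_le_compat_l; lra|].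
    replace ((/ sg - 1) * (2 * sg)) with (2 * (1 - sg)) by (field; lra). lra.
  - destruct N as [|N]; [lia|]. clear HN. unfold kappa.
    induction N as [|N IH]; [simpl; right; rewrite !Rmult_1_r; ring|].
    cbn [sum1] in *. apply Rle_trans with (1 := IH).
    pose proof (cum1_nonneg (r ^ S (S N)) (rpow_bound r Hr (S N))).
    assert (0 <= INR (S (S N)) ^ 1 * cum1 (r ^ S (S N))) by (apply Rmult_le_pos; [rewrite pow_1;
      apply pos_INR|auto]). lra.
Qed.

(** The lower bound on [sg], crude since it uses only the first factor, holds for all [N >= 1]. It
    breaks a circle: [sg] depends on [N], while [N] must be large in terms of [sg]. *)
Lemma saddle_point_exists N (h : R) : (1 <= N)%nat -> 50635 / 10 <= h ->
  exists sg, / (h + 1) <= sg <= / 45 /\ kappa cum1 1 N (exp (- sg)) = h.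
Proof.
  intros HN Hh.
  assert (Hp : 0 < / (h + 2)) by (apply Rinv_0_lt_compat; lra).
  assert (Hlt : / (h + 2) < / 45) by (apply Rinv_lt_contravar; lra).
  destruct (IVT_interv (fun s => h - kappa cum1 1 N (exp (- s))) (/ (h
    + 2)) (/ 45)) as [sg [Hsg E]].
  - intros a Ha. apply (continuity_pt_minus (fun _ => h)).
    + apply continuity_pt_const. intros ? ?; auto.
    + apply kappa1_continuous; lra.
  - auto.
  - pose proof (kappa1_lower N (/ (h + 2)) HN Hp) as K. rewrite Rinv_inv in K. lra.
  (* The bound at [1/45] is [5/2 * 45 ^ 2 = 5062.5 < h]; this fixes the threshold 5063. *)
  - destruct (kappa_upper (/ 45) N ltac:(lra)) as [K _]. rewrite Rinv_inv in K. lra.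
  - exists sg. assert (Ek : kappa cum1 1 N (exp (- sg)) = h) by lra.
    assert (Hs0 : 0 < sg) by lra.
    repeat split; try lra.
    pose proof (kappa1_lower N sg HN Hs0) as K. rewrite Ek in K.
    rewrite <- (Rinv_inv sg). apply Rinv_le_contravar; [apply Rinv_0_lt_compat; auto|lra].
Qed.

Lemma exp_neg_decay s : 10000 <= s -> exp (- s) * (s ^ 2 + 1) ^ 2 * s ^ 2 <= / 100000.
Proof.
  intros Hs.
  assert (H : (s / 12) ^ 12 <= exp s).
  { replace s with (INR 12 * (s / 12)) at 2 by (simpl; field). rewrite exp_mult_INR.
    apply pow_incr. pose proof (exp_ineq1_le (s / 12)). lra. }
  assert (H12 : 0 < (s / 12) ^ 12) by (apply pow_lt; lra).
  assert (He : exp (- s) <= / (s / 12) ^ 12) by (apply exp_neg_le_inv; auto).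
  assert (P6 : 0 < s ^ 6) by (apply pow_lt; lra).
  assert (Hq : (s ^ 2 + 1) ^ 2 * s ^ 2 <= 4 * s ^ 6).
  { replace (4 * s ^ 6) with ((2 * s ^ 2) ^ 2 * s ^ 2) by ring.
    apply Rmult_le_compat_r; [apply pow2_ge_0|]. apply pow_incr; nra. }
  rewrite Rmult_assoc.
  apply Rle_trans with (/ (s / 12) ^ 12 * (4 * s ^ 6)).
  - apply Rmult_le_compat; auto; [apply Rlt_le, exp_pos|].
    apply Rmult_le_pos; apply pow2_ge_0.
  - replace (/ (s / 12) ^ 12 * (4 * s ^ 6)) with (4 * 12 ^ 12 * / s ^ 6) by (field; lra).
    assert (10000 ^ 6 <= s ^ 6) by (apply pow_incr; lra).
    assert (/ s ^ 6 <= / 10000 ^ 6) by (apply Rinv_le_contravar; lra).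
    lra.
Qed.

Theorem overpartitions_large (b : nat -> Z -> Z) (n : Z) : overpartition_system b ->
  (5063 <= n)%Z ->
  exists N, (n + 2 <= Z.of_nat N)%Z /\
  (0 < 4 * (b N n ^ 2 - b N (n - 1) * b N (n + 1)) * (b N (n + 1) ^ 2 - b N n * b N (n + 2))
    - (b N n * b N (n + 1) - b N (n - 1) * b N (n + 2)) ^ 2)%Z.
Proof.
  intros Hb Hn.
  assert (HnR : 5063 <= IZR n) by (apply (IZR_le 5063); auto).
  (* [m] exceeds [1 / sg], which is at most [n + 3/2]; with [N = m ^ 2] this gives
     [r ^ N <= exp (- m)]. *)
  set (m := (2 * n + 4)%Z). set (N := Z.to_nat (m * m)).
  assert (EN : INR N = IZR m ^ 2).
  { unfold N. rewrite INR_IZR_INZ, Z2Nat.id by nia. rewrite mult_IZR; ring. }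
  assert (Em : IZR m = 2 * IZR n + 4) by (unfold m; rewrite plus_IZR, mult_IZR; ring).
  exists N. split; [unfold N; rewrite Z2Nat.id; nia|].
  destruct (saddle_point_exists N (IZR n + / 2)) as [sg [[S1 S2] E]].
  - unfold N; nia.
  - lra.
  - assert (Hs0 : 0 < sg) by (eapply Rlt_le_trans; [|apply S1]; apply Rinv_0_lt_compat; lra).
    assert (HY : / sg <= IZR m).
    { rewrite <- (Rinv_inv (IZR m)). apply Rinv_le_contravar; [apply Rinv_0_lt_compat; lra|].
      eapply Rle_trans; [|apply S1]. apply Rinv_le_contravar; lra. }
    apply (saddle_overpartitions sg N n); auto.
    rewrite EN, r_pow, EN.
    eapply Rle_trans; [|apply (exp_neg_decay (IZR m)); lra].
    assert (Hi : 0 < / sg) by (apply Rinv_0_lt_compat; auto).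
    apply Rmult_le_compat; [|apply pow2_ge_0| |apply pow_incr; lra].
    + apply Rmult_le_pos; [apply Rlt_le, exp_pos|apply pow2_ge_0].
    + apply Rmult_le_compat_r; [apply pow2_ge_0|].
      assert (K : - (IZR m ^ 2 * sg) <= - IZR m).
      { assert (1 <= IZR m * sg). { apply Rmult_le_reg_r with (/ sg); auto.
        rewrite Rmult_assoc, Rinv_r by lra. lra. }
        assert (IZR m * 1 <= IZR m * (IZR m * sg)) by (apply Rmult_le_compat_l; lra). nra. }
      destruct K as [K|K]; [left; apply exp_increasing; auto|rewrite K; lra].
Qed.

Close Scope R_scope.
Open Scope Z_scope.

(** * Gauss' identity and the computation *)

Fixpoint zsum (n : nat) (f : nat -> Z) : Z :=
  match n with O => 0 | S n' => zsum n' f + f n end.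

Fixpoint sgn (n : nat) : Z := match n with O => 1 | S n' => - sgn n' end.

Lemma zsum_ext n f g : (forall s, (1 <= s <= n)%nat -> f s = g s) -> zsum n f = zsum n g.
Proof.
  induction n as [|n IH]; intros H; cbn [zsum]; auto.
  rewrite IH, H; auto; [lia|]. intros; apply H; lia.
Qed.

Lemma zsum_plus n f g : zsum n (fun s => f s + g s) = zsum n f + zsum n g.
Proof. induction n as [|n IH]; cbn [zsum]; lia. Qed.

Lemma zsum_opp n f : zsum n (fun s => - f s) = - zsum n f.
Proof. induction n as [|n IH]; cbn [zsum]; lia. Qed.

Lemma zsum_scal n c f : zsum n (fun s => c * f s) = c * zsum n f.
Proof. induction n as [|n IH]; cbn [zsum]; lia. Qed.

Lemma zsum_trailing_zeros q k f : (forall s, (q < s)%nat -> f s = 0) -> zsum (q + k) f = zsum q f.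
Proof.
  intros Hf. induction k as [|k IH]; [rewrite Nat.add_0_r; auto|].
  rewrite Nat.add_succ_r. cbn [zsum]. rewrite IH, Hf by lia. lia.
Qed.

Section Recurrence.

Variable b : nat -> Z -> Z.
Hypothesis Hb : overpartition_system b.

Let b0 := proj1 Hb.
Let bneg := proj1 (proj2 Hb).
Let bstep := proj2 (proj2 Hb).

Lemma b_stable k m : m <= Z.of_nat k -> b k m = b (Z.to_nat m) m.
Proof.
  destruct (Z.ltb_spec m 0) as [Hm|Hm]; [rewrite !bneg; auto|].
  induction k as [|k IH]; intros Hk; [f_equal; lia|].
  destruct (Z.eq_dec m (Z.of_nat (S k))) as [->|]; [rewrite Nat2Z.id; auto|].
  pose proof (bstep k m) as E. rewrite (bneg _ (m - Z.of_nat (S k))), (bneg _ (m - Z.of_nat (S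
    k))) in E by lia.
  rewrite <- IH by lia. lia.
Qed.

(** Coefficients of a finite form of Gauss' identity: [lhs n] of
    [P_n * (1 + 2 * sum (-1)^s q^(s^2))] and [rhs n] of [1 + sum (-1)^s q^(s(n+1)) (P_s + P_(s-1))],
    with [s] from 1 to [n]. *)
Let delta (m : Z) := b 0%nat m.
Let G (s : nat) (x : Z) := b s x + b (pred s) x.
Let lhs (n : nat) (m : Z) := b n m + zsum n (fun s => 2 * sgn s * b n (m - Z.of_nat s * Z.of_nat
  s)).
Let rhs (n : nat) (m : Z) := delta m + zsum n (fun s => sgn s * G s (m - Z.of_nat s * Z.of_nat (S
  n))).

(** The system gives [q^s (P_s + P_(s-1)) = P_s - P_(s-1)]. So the summand becomes [2 (-1)^s (q^(sK)
    P_(s-1) + q^((s+1)K) P_s)], whose two terms cancel against those of its neighbours. *)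
Lemma telescope K m i :
  zsum i (fun s => sgn s * (G s (m - Z.of_nat s * K) + G s (m - Z.of_nat (S s) * K)
     - G s (m - Z.of_nat s * K - Z.of_nat s) + G s (m - Z.of_nat (S s) * K - Z.of_nat s)))
  = 2 * sgn 1 * b 0%nat (m - K) - 2 * sgn (S i) * b i (m - Z.of_nat (S i) * K).
Proof.
  induction i as [|i IH]; cbn [zsum].
  - replace (m - Z.of_nat 1 * K) with (m - K) by lia. lia.
  - rewrite IH. unfold G; cbn [pred].
    pose proof (bstep i (m - Z.of_nat (S i) * K)) as E1.
    pose proof (bstep i (m - Z.of_nat (S (S i)) * K)) as E2.
    set (x := m - Z.of_nat (S i) * K) in *. set (y := m - Z.of_nat (S (S i)) * K) in *.
    change (sgn (S (S i))) with (- sgn (S i)). set (e := sgn (S i)).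
    transitivity (2 * sgn 1 * b 0%nat (m - K) - 2 * e * b i x +
      e * (b (S i) x + b i x + (b (S i) y + b i y) - (b (S i) x - b i x) + (b (S i) y - b i y)));
        [|ring].
    replace (b (S i) x - b i x) with (b (S i) (x - Z.of_nat (S i)) + b i (x - Z.of_nat (S i)))
      by lia.
    replace (b (S i) y - b i y) with (b (S i) (y - Z.of_nat (S i)) + b i (y - Z.of_nat (S i)))
      by lia.
    ring.
Qed.

Lemma supported_periodic_zero (X : Z -> Z) (k : nat) :
  (forall m, X m = X (m - Z.of_nat (S k))) -> (forall m, m < 0 -> X m = 0) -> forall m, X m = 0.
Proof.
  intros HX Hn.
  assert (H : forall j m, m < Z.of_nat j -> X m = 0).
  { induction j as [|j IH]; intros m Hm; [apply Hn; lia|]. rewrite HX. apply IH; lia. }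
  intros m. apply (H (S (Z.to_nat m))). lia.
Qed.

Lemma zsum_zero n f : (forall s, (1 <= s <= n)%nat -> f s = 0) -> zsum n f = 0.
Proof.
  intros H. rewrite (zsum_ext n f (fun _ => 0)) by auto. induction n as [|n IH]; cbn [zsum]; auto.
  rewrite IH; auto. intros; apply H; lia.
Qed.

(** Induction on [n]: after multiplication by [1 - q^(n+1)] both sides change in the same way, so
    their difference is periodic. It vanishes at negative indices, hence everywhere. *)
Lemma gauss_finite n : forall m, lhs n m = rhs n m.
Proof.
  induction n as [|n IH]; intros m; [unfold lhs, rhs, delta; simpl; lia|].
  set (K := Z.of_nat (S n)).
  apply Zminus_eq. revert m.
  apply (supported_periodic_zero (fun m => lhs (S n) m - rhs (S n) m) n).
  2:{ intros m Hm. unfold lhs, rhs, delta, G. rewrite !bneg by auto.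
      rewrite !zsum_zero; [lia| |]; intros s Hs; rewrite !bneg by nia; lia. }
  intros m. fold K.
  assert (HL : lhs (S n) m - lhs (S n) (m - K) =
     lhs n m + lhs n (m - K) + 2 * sgn (S n) * (b n (m - K * K) + b n (m - K - K * K))).
  { unfold lhs. cbn [zsum]. fold K.
    pose proof (bstep n m) as E0. fold K in E0.
    pose proof (bstep n (m - K * K)) as E1. fold K in E1.
    replace (m - K * K - K) with (m - K - K * K) in E1 by lia.
    assert (E2 : zsum n (fun s => 2 * sgn s * b (S n) (m - Z.of_nat s * Z.of_nat s))
        + - zsum n (fun s => 2 * sgn s * b (S n) (m - K - Z.of_nat s * Z.of_nat s))
      = zsum n (fun s => 2 * sgn s * b n (m - Z.of_nat s * Z.of_nat s))
        + zsum n (fun s => 2 * sgn s * b n (m - K - Z.of_nat s * Z.of_nat s))).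
    { rewrite <- zsum_opp, <- !zsum_plus. apply zsum_ext. intros s _.
      pose proof (bstep n (m - Z.of_nat s * Z.of_nat s)) as E. fold K in E.
      replace (m - Z.of_nat s * Z.of_nat s - K) with (m - K - Z.of_nat s * Z.of_nat s) in E by lia.
      transitivity (2 * sgn s * (b (S n) (m - Z.of_nat s * Z.of_nat s) - b (S n) (m - K -
        Z.of_nat s * Z.of_nat s))); [ring|].
      rewrite E. ring. }
    transitivity ((b (S n) m - b (S n) (m - K)) + (zsum n (fun s => 2 * sgn s * b (S n) (m -
      Z.of_nat s * Z.of_nat s))
        + - zsum n (fun s => 2 * sgn s * b (S n) (m - K - Z.of_nat s * Z.of_nat s)))
        + 2 * sgn (S n) * (b (S n) (m - K * K) - b (S n) (m - K - K * K))); [ring|].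
    rewrite E0, E1, E2. ring. }
  assert (HR : rhs (S n) m - rhs (S n) (m - K) =
     rhs n m + rhs n (m - K) + 2 * sgn (S n) * (b n (m - K * K) + b n (m - K - K * K))).
  { unfold rhs. cbn [zsum]. fold K.
    pose proof (telescope K m n) as T.
    set (f1 := fun s => sgn s * G s (m - Z.of_nat s * K)).
    set (f2 := fun s => sgn s * G s (m - K - Z.of_nat s * K)).
    set (f3 := fun s => sgn s * G s (m - Z.of_nat s * Z.of_nat (S (S n)))).
    set (f4 := fun s => sgn s * G s (m - K - Z.of_nat s * Z.of_nat (S (S n)))).
    assert (T2 : zsum n f1 + zsum n f2 + - zsum n f3 + zsum n f4 =
      2 * sgn 1 * b 0%nat (m - K) - 2 * sgn (S n) * b n (m - Z.of_nat (S n) * K)).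
    { rewrite <- T, <- zsum_opp, <- !zsum_plus. apply zsum_ext. intros s _. unfold f1, f2, f3, f4.
      replace (m - K - Z.of_nat s * K) with (m - Z.of_nat (S s) * K) by lia.
      replace (m - Z.of_nat s * Z.of_nat (S (S n))) with (m - Z.of_nat s * K - Z.of_nat s) by lia.
      replace (m - K - Z.of_nat s * Z.of_nat (S (S n)))
        with (m - Z.of_nat (S s) * K - Z.of_nat s) by lia.
      ring. }
    fold K in T2. simpl sgn in T2. fold (delta (m - K)) in T2.
    assert (E3 : f3 (S n) = - sgn n * (b (S n) (m - K * K) - b n (m - K * K))).
    { unfold f3, G; cbn [pred]. fold K. pose proof (bstep n (m - K * K)) as E. fold K in E.
      replace (m - K * Z.of_nat (S (S n))) with (m - K * K - K) by lia.
        change (sgn (S n)) with (- sgn n). nia. }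
    assert (E4 : f4 (S n) = - sgn n * (b (S n) (m - K - K * K) - b n (m - K - K * K))).
    { unfold f4, G; cbn [pred]. fold K. pose proof (bstep n (m - K - K * K)) as E. fold K in E.
      replace (m - K - K * Z.of_nat (S (S n))) with (m - K - K * K - K) by lia.
        change (sgn (S n)) with (- sgn n). nia. }
    pose proof (bstep n (m - K * K)) as E. fold K in E.
    replace (m - K * K - K) with (m - K - K * K) in E by lia.
    change (sgn (S n) * G (S n) (m - K * Z.of_nat (S (S n)))) with (f3 (S n)).
    change (sgn (S n) * G (S n) (m - K - K * Z.of_nat (S (S n)))) with (f4 (S n)).
    fold f3 f4. rewrite E3, E4. change (sgn (S n)) with (- sgn n). nia. }
  rewrite <- !IH in HR. lia.
Qed.

Definition pbar (m : Z) := b (Z.to_nat m) m.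

Theorem gauss_recurrence m : 1 <= m ->
  pbar m = zsum (Z.to_nat m) (fun s => - 2 * sgn s * pbar (m - Z.of_nat s * Z.of_nat s)).
Proof.
  intros Hm. pose proof (gauss_finite (Z.to_nat m) m) as E. unfold lhs, rhs, delta in E.
  rewrite b0 in E. destruct (Z.eqb_spec m 0) as [|_]; [lia|].
  (* With [n = m] every correction term sits at index [m - s * (m + 1) < 0]. *)
  rewrite (zsum_zero _ (fun s => sgn s * _)) in E.
  2:{ intros s Hs. unfold G. rewrite !bneg by nia. lia. }
  fold (pbar m) in E.
  transitivity (- zsum (Z.to_nat m) (fun s => 2 * sgn s * b (Z.to_nat m) (m - Z.of_nat s *
    Z.of_nat s))); [lia|].
  rewrite <- zsum_opp. apply zsum_ext. intros s Hs. unfold pbar. rewrite b_stable by nia. ring.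
Qed.

Lemma pbar_neg m : m < 0 -> pbar m = 0.
Proof. apply bneg. Qed.

Lemma pbar_0 : pbar 0 = 1.
Proof. unfold pbar. simpl. rewrite b0. reflexivity. Qed.

End Recurrence.

(* On the list [p (n - 1); ...; p 0], the sum p (n - s^2) - p (n - (s + 1)^2) + ...,
   with the first [s^2 - 1] entries already dropped. *)
Fixpoint theta_sum (fuel s : nat) (l : list Z) : Z :=
  match fuel, l with
  | S f, x :: l' => x - theta_sum f (S s) (skipn (2 * s) l')
  | _, _ => 0
  end.

(** Fuel 75 covers every square that occurs: [76 ^ 2 = 5776] is beyond the range 5700 of
    [pbar_list_correct]. *)
Fixpoint pbar_list (n : nat) : list Z :=
  match n with
  | O => [1]
  | S n' => let l := pbar_list n' in 2 * theta_sum 75 1 l :: l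
  end.

(** * Certified evaluation of the discriminant *)

Definition turan_disc (a b c d : Z) : Z :=
  4 * (b ^ 2 - a * c) * (c ^ 2 - b * d) - (b * c - a * d) ^ 2.

(* Decides positivity from the leading bits: every number is only known to lie
   between [x * 2^s] and [(x + 1) * 2^s]. *)
Definition check_trunc (s a b c d : Z) : bool :=
  let a := Z.shiftr a s in let b := Z.shiftr b s in
  let c := Z.shiftr c s in let d := Z.shiftr d s in
  let x := b * b - (a + 1) * (c + 1) in
  let y := c * c - (b + 1) * (d + 1) in
  let z := Z.max ((b + 1) * (c + 1) - a * d) ((a + 1) * (d + 1) - b * c) in
  (0 <=? a) && (0 <? x) && (0 <? y) && (z * z <? 4 * x * y).

Definition check4 (a b c d : Z) : bool :=
  let s := Z.log2 a - 70 in
  if s <=? 0 then 0 <? turan_disc a b c d else check_trunc s a b c d.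

Fixpoint check_list (n : nat) (l : list Z) : bool :=
  match n, l with
  | O, _ => true
  | S n', d :: ((c :: b :: a :: _) as l') => check4 a b c d && check_list n' l'
  | _, _ => false
  end.

Lemma shiftr_bounds a s : 0 <= s ->
  Z.shiftr a s * 2 ^ s <= a < (Z.shiftr a s + 1) * 2 ^ s.
Proof.
  intros Hs. rewrite Z.shiftr_div_pow2 by auto.
  assert (0 < 2 ^ s) by (apply Z.pow_pos_nonneg; lia).
  pose proof (Z.mul_div_le a (2 ^ s)). pose proof (Z.mul_succ_div_gt a (2 ^ s)). lia.
Qed.

(** In units of [4 ^ s], [x] and [y] round the two Turan differences down, and [z] bounds the
    absolute value of [b * c - a * d] from above. *)
Lemma check_trunc_sound s a b c d : 0 < s -> 0 <= a -> 0 <= b -> 0 <= c -> 0 <= d ->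
  check_trunc s a b c d = true -> 0 < turan_disc a b c d.
Proof.
  intros Hs Ha Hb Hc Hd. unfold check_trunc.
  pose proof (shiftr_bounds a s ltac:(lia)) as A. pose proof (shiftr_bounds b s ltac:(lia)) as B.
  pose proof (shiftr_bounds c s ltac:(lia)) as C. pose proof (shiftr_bounds d s ltac:(lia)) as D.
  assert (A0 : 0 <= Z.shiftr a s) by (apply Z.shiftr_nonneg; auto).
  assert (B0 : 0 <= Z.shiftr b s) by (apply Z.shiftr_nonneg; auto).
  assert (C0 : 0 <= Z.shiftr c s) by (apply Z.shiftr_nonneg; auto).
  assert (D0 : 0 <= Z.shiftr d s) by (apply Z.shiftr_nonneg; auto).
  assert (HS : 0 < 2 ^ s) by (apply Z.pow_pos_nonneg; lia).
  set (S := 2 ^ s) in *.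
  set (a' := Z.shiftr a s) in *. set (b' := Z.shiftr b s) in *.
  set (c' := Z.shiftr c s) in *. set (d' := Z.shiftr d s) in *.
  clearbody S a' b' c' d'.
  rewrite !Bool.andb_true_iff, !Z.ltb_lt. intros [[[_ X] Y] Zz].
  set (x := b' * b' - (a' + 1) * (c' + 1)) in *. set (y := c' * c' - (b' + 1) * (d' + 1)) in *.
  set (z := Z.max ((b' + 1) * (c' + 1) - a' * d') ((a' + 1) * (d' + 1) - b' * c')) in *.
  assert (M : forall u v u' v', 0 <= u' -> 0 <= v' -> u' * S <= u -> v' * S <= v ->
    u' * v' * (S * S) <= u * v).
  { intros u v u' v' H1 H2 H3 H4. replace (u' * v' * (S * S)) with ((u' * S) * (v' * S)) by ring.
    apply Z.mul_le_mono_nonneg; auto; apply Z.mul_nonneg_nonneg; lia. }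
  assert (M' : forall u v u' v', 0 <= u -> 0 <= v -> u <= u' * S -> v <= v' * S ->
    u * v <= u' * v' * (S * S)).
  { intros u v u' v' H1 H2 H3 H4. replace (u' * v' * (S * S)) with ((u' * S) * (v' * S)) by ring.
    apply Z.mul_le_mono_nonneg; auto. }
  assert (HX : x * (S * S) <= b ^ 2 - a * c).
  { rewrite Z.pow_2_r. pose proof (M b b b' b'). pose proof (M' a c (a' + 1) (c' + 1)). unfold x.
    lia. }
  assert (HY : y * (S * S) <= c ^ 2 - b * d).
  { rewrite Z.pow_2_r. pose proof (M c c c' c'). pose proof (M' b d (b' + 1) (d' + 1)). unfold y.
    lia. }
  assert (HZ1 : b * c - a * d <= z * (S * S)).
  { pose proof (M' b c (b' + 1) (c' + 1)). pose proof (M a d a' d').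
    assert (((b' + 1) * (c' + 1) - a' * d') * (S * S) <= z * (S * S))
      by (apply Z.mul_le_mono_nonneg_r; unfold z; lia). lia. }
  assert (HZ2 : a * d - b * c <= z * (S * S)).
  { pose proof (M' a d (a' + 1) (d' + 1)). pose proof (M b c b' c').
    assert (((a' + 1) * (d' + 1) - b' * c') * (S * S) <= z * (S * S))
      by (apply Z.mul_le_mono_nonneg_r; unfold z; lia). lia. }
  assert (HS2 : 0 < S * S) by (apply Z.mul_pos_pos; auto). clearbody x y z. clear M M' A B C D.
  set (S2 := S * S) in *. clearbody S2.
  unfold turan_disc. set (X1 := b ^ 2 - a * c) in *. set (Y1 := c ^ 2 - b * d) in *.
    set (Z1 := b * c - a * d) in *.
  assert (HZ0 : a * d - b * c = - Z1) by (unfold Z1; lia). rewrite HZ0 in HZ2. clearbody X1 Y1 Z1.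
  clear - HX HY HZ1 HZ2 X Y Zz HS2.
  assert (HZ3 : Z1 ^ 2 <= (z * S2) ^ 2) by (rewrite !Z.pow_2_r; nia).
  assert (HXY : (x * S2) * (y * S2) <= X1 * Y1).
  { apply Z.mul_le_mono_nonneg; auto; apply Z.mul_nonneg_nonneg; lia. }
  assert (z * z * (S2 * S2) < 4 * x * y * (S2 * S2)).
  { apply Z.mul_lt_mono_pos_r; auto. apply Z.mul_pos_pos; auto. }
  lia.
Qed.

Lemma check4_sound a b c d : 0 <= a -> 0 <= b -> 0 <= c -> 0 <= d ->
  check4 a b c d = true -> 0 < turan_disc a b c d.
Proof.
  unfold check4. intros Ha Hb Hc Hd. destruct (Z.leb_spec (Z.log2 a - 70) 0); [apply Z.ltb_lt|].
  apply check_trunc_sound; auto.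
Qed.

Section Computation.

Variable b : nat -> Z -> Z.
Hypothesis Hb : overpartition_system b.
Hypothesis Hnonneg : forall k m, 0 <= b k m.

Let p := pbar b.

Fixpoint down (n : nat) : list Z :=
  match n with O => [p 0] | S n' => p (Z.of_nat n) :: down n' end.

Lemma nth_down n i : nth i (down n) 0 = p (Z.of_nat n - Z.of_nat i).
Proof.
  assert (Hneg := pbar_neg b Hb). fold p in Hneg.
  revert i; induction n as [|n IH]; intros [|i]; cbn [down nth].
  - reflexivity.
  - destruct i; cbn [nth]; rewrite Hneg by lia; reflexivity.
  - f_equal; lia.
  - rewrite IH. f_equal; lia.
Qed.

(** The hypothesis [S i = s * s] reflects that the head of the list is [p n] while the recurrence is
    for [p (n + 1)]: the entry at distance [s^2] has position [s^2 - 1]. An exhausted list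
    corresponds to negative indices, where [p] is 0. *)
Lemma theta_sum_spec f : forall s n i, (1 <= s)%nat -> (S i = s * s)%nat ->
  theta_sum f s (skipn i (down n)) = zsum f (fun j => sgn (pred j) * p (Z.of_nat n - Z.of_nat i -
    ((Z.of_nat s + Z.of_nat j - 1) * (Z.of_nat s + Z.of_nat j - 1) - Z.of_nat s * Z.of_nat s))).
Proof.
  assert (Hneg := pbar_neg b Hb). fold p in Hneg.
  assert (Shift : forall f g, zsum (S f) g = g 1%nat + zsum f (fun j => g (S j))).
  { induction f0 as [|f0 IH]; intros g; cbn [zsum] in *; [lia|]. rewrite IH. lia. }
  induction f as [|f IH]; intros s n i Hs Hi; [reflexivity|].
  rewrite Shift. cbn [pred sgn].
  pose proof (nth_down n i) as Hn.
  destruct (skipn i (down n)) as [|x l] eqn:E.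
  - cbn [theta_sum].
    assert (Hlen : (length (down n) <= i)%nat).
    { pose proof (length_skipn i (down n)) as L. rewrite E in L. simpl in L. lia. }
    assert (Ld : forall k, length (down k) = S k) by (induction k; simpl; auto).
    rewrite Ld in Hlen.
    rewrite Hneg by nia. rewrite zsum_zero; [lia|]. intros j Hj. rewrite Hneg by nia. lia.
  - assert (Hx : x = nth i (down n) 0).
    { pose proof (nth_skipn i (down n) 0 0) as K. rewrite E in K. simpl in K.
      rewrite Nat.add_0_r in K. auto. }
    assert (El : skipn (2 * s) l = skipn (i + (2 * s + 1)) (down n)).
    { rewrite Nat.add_comm, <- skipn_skipn, E. rewrite Nat.add_1_r. reflexivity. }
    change (theta_sum (S f) s (x :: l)) with (x - theta_sum f (S s) (skipn (2 * s) l)).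
    rewrite El, (IH (S s)) by lia. rewrite Hx, Hn, <- Z.add_opp_r, <- zsum_opp.
    f_equal; [rewrite Z.mul_1_l; f_equal; lia|].
    apply zsum_ext. intros j Hj. destruct j as [|j]; [lia|]. cbn [pred].
      change (sgn (S j)) with (- sgn j).
    rewrite Z.mul_opp_l. do 3 f_equal. rewrite !Nat2Z.inj_add, !Nat2Z.inj_succ, Nat2Z.inj_mul.
      simpl (Z.of_nat 2). ring.
Qed.

Lemma pbar_list_correct n : Z.of_nat n < 5700 -> pbar_list n = down n.
Proof.
  assert (Hneg := pbar_neg b Hb). fold p in Hneg.
  induction n as [|n IH]; intros Hn; cbn [pbar_list down].
  - unfold p. rewrite (pbar_0 b Hb). reflexivity.
  - rewrite IH by lia. f_equal.
    pose proof (theta_sum_spec 75 1 n 0 ltac:(lia) ltac:(lia)) as T. cbn [skipn] in T. rewrite T.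
    unfold p at 2. rewrite (gauss_recurrence b Hb) by lia. fold p.
    set (g := fun s => - 2 * sgn s * p (Z.of_nat (S n) - Z.of_nat s * Z.of_nat s)).
    assert (Hg : forall s, (Z.to_nat (Z.of_nat (S n)) < s \/ 75 < s)%nat -> g s = 0).
    { intros s Hs. rewrite Nat2Z.id in Hs. unfold g. rewrite Hneg; [lia|].
      assert (Z.of_nat (S n) < Z.of_nat s \/ 75 < Z.of_nat s) as [H|H] by lia; nia. }
    assert (E : zsum (Z.to_nat (Z.of_nat (S n))) g = zsum 75 g).
    { rewrite Nat2Z.id in *. rewrite <- (zsum_trailing_zeros (S n) 75), <- (zsum_trailing_zeros
      75 (S n));
        [rewrite Nat.add_comm; auto|intros; apply Hg; lia|intros; apply Hg; lia]. }
    rewrite E.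
    transitivity (zsum 75 (fun j => 2 * (sgn (pred j) * p (Z.of_nat n - Z.of_nat 0 - ((Z.of_nat 1
      + Z.of_nat j - 1) * (Z.of_nat 1 + Z.of_nat j - 1) - Z.of_nat 1 * Z.of_nat 1))))).
    + symmetry. apply zsum_scal.
    + apply zsum_ext. intros j Hj. unfold g. destruct j as [|j]; [lia|]. cbn [pred].
      change (sgn (S j)) with (- sgn j).
      replace (Z.of_nat n - Z.of_nat 0 - ((Z.of_nat 1 + Z.of_nat (S j) - 1) * (Z.of_nat 1
        + Z.of_nat (S j) - 1) - Z.of_nat 1 * Z.of_nat 1))
        with (Z.of_nat (S n) - Z.of_nat (S j) * Z.of_nat (S j)) by lia. ring.
Qed.

Lemma p_nonneg m : 0 <= p m. Proof. apply Hnonneg. Qed.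

Lemma check_list_sound k : forall n, (k <= n)%nat -> check_list k (down (n + 2)) = true ->
  forall i, (n - k < i <= n)%nat ->
  0 < turan_disc (p (Z.of_nat i - 1)) (p (Z.of_nat i)) (p (Z.of_nat i + 1)) (p (Z.of_nat i + 2)).
Proof.
  induction k as [|k IH]; intros n Hn Hc i Hi; [lia|].
  destruct n as [|n]; [lia|].
  assert (E : down (S n + 2) = p (Z.of_nat n + 3) :: p (Z.of_nat n + 2) :: p (Z.of_nat n
    + 1) :: p (Z.of_nat n) :: tl (down n)).
  { replace (S n + 2)%nat with (S (S (S n))) by lia. cbn [down].
    replace (down n) with (p (Z.of_nat n) :: tl (down n)) at 1 by (destruct n; reflexivity).
    repeat f_equal; lia. }
  rewrite E in Hc. cbn [check_list] in Hc. apply Bool.andb_true_iff in Hc. destruct Hc as [H1 H2].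
  destruct (Nat.eq_dec i (S n)) as [->|].
  - apply check4_sound in H1; auto using p_nonneg.
    replace (Z.of_nat (S n) - 1) with (Z.of_nat n) by lia.
      replace (Z.of_nat (S n)) with (Z.of_nat n + 1) by lia.
    replace (Z.of_nat n + 1 + 1) with (Z.of_nat n + 2) by lia.
      replace (Z.of_nat n + 1 + 2) with (Z.of_nat n + 3) by lia. auto.
  - apply (IH n); [lia| |lia].
    replace (down (n + 2)) with (p (Z.of_nat n + 2) :: p (Z.of_nat n
      + 1) :: p (Z.of_nat n) :: tl (down n)); auto.
    replace (n + 2)%nat with (S (S n)) by lia. cbn [down].
    replace (down n) with (p (Z.of_nat n) :: tl (down n)) at 2 by (destruct n; reflexivity).
    repeat f_equal; lia.
Qed.

End Computation.

(** The 5047 quadruples are those of [n = 5062] down to [n = 16]; the first one reaches up to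
    [p 5064]. *)
Lemma check_5062 : check_list (Z.to_nat 5047) (pbar_list (Z.to_nat 5064)) = true.
Proof. vm_cast_no_check (eq_refl true). Qed.

Theorem overpartitions_small (b : nat -> Z -> Z) (n : Z) : overpartition_system b ->
  (forall k m, 0 <= b k m) -> 16 <= n <= 5062 ->
  0 < turan_disc (pbar b (n - 1)) (pbar b n) (pbar b (n + 1)) (pbar b (n + 2)).
Proof.
  intros Hb Hp Hn. pose proof check_5062 as C.
  rewrite (pbar_list_correct b Hb) in C by lia.
  replace (Z.to_nat 5064) with (Z.to_nat 5062 + 2)%nat in C by lia.
  pose proof (check_list_sound b Hp (Z.to_nat 5047) (Z.to_nat 5062) ltac:(lia) C (Z.to_nat n)
    ltac:(lia)) as K.
  rewrite Z2Nat.id in K by lia. exact K.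
Qed.

(** * From a recurrence for counts to the inequality *)

Section Counts.

Variable B : nat -> nat -> nat.

(** [B k n] stands for the overpartitions of [n] with parts at most [k] in which [k] is not
    overlined; adding those that begin with an overlined [k] gives all with parts at most [k]. The
    test [0 < k] excludes a part 0. *)
Definition with_overlined (k n : nat) : nat :=
  (B k n + if ((0 <? k) && (k <=? n))%bool then B k (n - k) else 0)%nat.

Hypothesis B0 : forall n, B 0 n = if (n =? 0)%nat then 1%nat else 0%nat.
Hypothesis Bstep : forall k n,
  (B (S k) n = with_overlined k n + if S k <=? n then B (S k) (n - S k) else 0)%nat.

Definition count (k : nat) (m : Z) : Z :=
  if m <? 0 then 0 else Z.of_nat (with_overlined k (Z.to_nat m)).

Let Bz (k : nat) (m : Z) : Z := if m <? 0 then 0 else Z.of_nat (B k (Z.to_nat m)).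

Lemma count_Bz k m : count (S k) m = Bz (S k) m + Bz (S k) (m - Z.of_nat (S k)).
Proof.
  unfold count, Bz, with_overlined. destruct (Z.ltb_spec m 0);
    [destruct (Z.ltb_spec (m - Z.of_nat (S k)) 0); lia|].
  change (0 <? S k)%nat with true. cbn [andb].
  destruct (Nat.leb_spec (S k) (Z.to_nat m)); destruct (Z.ltb_spec (m - Z.of_nat (S k)) 0); try lia.
  rewrite Nat2Z.inj_add. do 3 f_equal. lia.
Qed.

Lemma Bz_step k m : Bz (S k) m = count k m + Bz (S k) (m - Z.of_nat (S k)).
Proof.
  unfold count, Bz. destruct (Z.ltb_spec m 0); [destruct (Z.ltb_spec (m - Z.of_nat (S k)) 0); lia|].
  rewrite Bstep.
  destruct (Nat.leb_spec (S k) (Z.to_nat m)); destruct (Z.ltb_spec (m - Z.of_nat (S k)) 0); try lia.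
  rewrite Nat2Z.inj_add. do 3 f_equal. lia.
Qed.

Lemma count_system : overpartition_system count.
Proof.
  split; [|split].
  - intros m. unfold count, with_overlined. simpl andb. destruct (Z.ltb_spec m 0);
    destruct (Z.eqb_spec m 0); try lia.
    + subst; rewrite B0; reflexivity.
    + rewrite B0. destruct (Nat.eqb_spec (Z.to_nat m) 0); lia.
  - intros k m Hm. unfold count. destruct (Z.ltb_spec m 0); lia.
  - intros k m. rewrite !count_Bz. pose proof (Bz_step k m).
    pose proof (Bz_step k (m - Z.of_nat (S k))). lia.
Qed.

Lemma count_nonneg k m : 0 <= count k m.
Proof. unfold count; destruct (m <? 0); lia. Qed.

Theorem turan_disc_pos (n : Z) : 16 <= n ->
  0 < turan_disc (pbar count (n - 1)) (pbar count n) (pbar count (n + 1)) (pbar count (n + 2)).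
Proof.
  intros Hn. destruct (Z.le_gt_cases n 5062) as [H|H].
  - apply overpartitions_small; auto using count_system, count_nonneg.
  - destruct (overpartitions_large count n count_system ltac:(lia)) as [N [HN Q]].
    rewrite !(b_stable count count_system N) in Q by lia. exact Q.
Qed.

(* With every subtraction moved across, this is the inequality in [nat]. *)
Corollary turan_nat (n : nat) : (16 <= n)%nat ->
  let p m := with_overlined m m in
  let a := p (n - 1)%nat in let b := p n in let c := p (S n) in let d := p (S (S n)) in
  (4 * (b * b * b * d) + 4 * (a * c * c * c) + a * a * d * d < 3 * (b * b * c * c)
    + 6 * (a * b * c * d))%nat.
Proof.
  intros Hn p a b c d. pose proof (turan_disc_pos (Z.of_nat n) ltac:(lia)) as Q.
  assert (E : forall m, 0 <= m -> pbar count m = Z.of_nat (p (Z.to_nat m))).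
  { intros m Hm. unfold pbar, count, p. destruct (Z.ltb_spec m 0); [lia|auto]. }
  rewrite !E in Q by lia.
  replace (Z.to_nat (Z.of_nat n - 1)) with (n - 1)%nat in Q by lia.
  replace (Z.to_nat (Z.of_nat n)) with n in Q by lia.
  replace (Z.to_nat (Z.of_nat n + 1)) with (S n) in Q by lia.
  replace (Z.to_nat (Z.of_nat n + 2)) with (S (S n)) in Q by lia.
  fold a b c d in Q. unfold turan_disc in Q. clearbody a b c d.
  apply Nat2Z.inj_lt. rewrite !Nat2Z.inj_add, !Nat2Z.inj_mul. simpl (Z.of_nat 4).
    simpl (Z.of_nat 3). simpl (Z.of_nat 6). lia.
Qed.

End Counts.

Close Scope Z_scope.

Require Import Defs.
From mathcomp Require Import all_boot all_order all_algebra.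
From mathcomp Require Import ring.
Import Order.TTheory GRing.Theory Num.Theory.

(** * Counting overpartitions *)

Section Counting.

Implicit Types (k n : nat) (s : seq (nat * bool)).

Lemma mem_cands n k s :
  (s \in cands n k) = (size s == k) && all (fun x => 0 < x.1 <= n) s.
Proof.
elim: k s => [|k IH] s /=; first by rewrite inE; case: s.
apply/idP/idP => [/allpairsP[[x t] [Hx Ht ->]]|].
  have /allpairsP[[i c] [Hi _ /= ->]] : x \in [seq (i, b) | i <- iota 1 n, b <- [:: true;
    false]] by exact: Hx.
  by rewrite mem_iota add1n ltnS /= in Hi; rewrite Hi -IH.
case: s => [|x t] // /andP[Hsz Ha]; rewrite eqSS in Hsz.
have /andP[Hx Ht] : (0 < x.1 <= n) && all (fun x => 0 < x.1 <= n) t by exact: Ha.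
apply/allpairsP; exists (x, t); split=> //; last by rewrite IH Hsz.
suff: x \in [seq (i, b) | i <- iota 1 n, b <- [:: true; false]] by [].
apply/allpairsP; exists x; split; last by case: x Hx {Ha}.
  by rewrite mem_iota add1n ltnS.
by case: (x.2); rewrite !inE.
Qed.

Definition weight s := sumn (map fst s).
Definition positive s := all (fun x : nat * bool => 0 < x.1) s.

Lemma part_le_weight s x : x \in s -> x.1 <= weight s.
Proof.
elim: s => [|y s IH] //=; rewrite inE => /orP[/eqP ->|/IH H]; first exact: leq_addr.
exact: leq_trans H (leq_addl _ _).
Qed.

Lemma size_le_weight s : positive s -> size s <= weight s.
Proof.
elim: s => [|y s IH] //= /andP[Hy /IH H].
by rewrite /weight /= -addn1 addnC leq_add.
Qed.

Lemma mem_all_cands n s : positive s -> weight s = n -> s \in all_cands n.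
Proof.
move=> Hp Hw; apply/flattenP; exists (cands n (size s)).
  by apply/mapP; exists (size s) => //; rewrite mem_iota add0n ltnS -Hw size_le_weight.
rewrite mem_cands eqxx /=; apply/allP => x Hx.
by rewrite (allP Hp _ Hx) -Hw part_le_weight.
Qed.

(* The sequences that may follow a non-overlined part [k]. *)
Definition below k n s := [&& path op_rel (k, false) s, positive s & weight s == n].
Definition belows k n := [seq s <- undup (all_cands n) | below k n s].
Definition nbelow k n := size (belows k n).

Lemma mem_belows k n s : (s \in belows k n) = below k n s.
Proof.
rewrite mem_filter mem_undup; case H: (below k n s) => //=.
by case/and3P: H => _ Hp /eqP Hw; rewrite mem_all_cands.
Qed.

Lemma uniq_belows k n : uniq (belows k n).
Proof. by rewrite filter_uniq ?undup_uniq. Qed.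

Lemma below_cons k n x s : below k n (x :: s) =
  [&& op_rel (k, false) x, 0 < x.1, x.1 <= n & below x.1 (n - x.1) s].
Proof.
(* [op_rel] ignores the overline of its first argument, so what may follow a part depends on its
   size alone. *)
have Hpath : path op_rel x s = path op_rel (x.1, false) s by case: x; case: s.
rewrite /below /= Hpath /weight /=; case: (op_rel _ _) => //=; case: (0 < x.1) => /=;
  last by rewrite andbF.
case: (leqP x.1 n) => Hn /=.
  by do 2 f_equal; rewrite -[n in LHS](subnKC Hn) eqn_add2l.
by rewrite (gtn_eqF (leq_trans Hn (leq_addr _ _))) !andbF.
Qed.

Definition branch (c : bool) (x : nat * bool) n : seq (seq (nat * bool)) :=
  if c && (x.1 <= n) then map (cons x) (belows x.1 (n - x.1)) else [::].

Lemma mem_branch c x n s : (s \in branch c x n) =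
  if s is y :: t then [&& c, y == x, x.1 <= n & below x.1 (n - x.1) t] else false.
Proof.
rewrite /branch; case: c => /=; last by case: s => // y t; rewrite andbF.
case: (leqP x.1 n) => Hn /=; last by case: s => // y t; rewrite andbF.
case: s => [|y t]; first by apply/mapP => -[].
apply/mapP/andP => [[t' Ht' [-> ->]]|[/eqP -> Ht]].
  by rewrite eqxx -mem_belows.
by exists t; rewrite ?mem_belows.
Qed.

(** A sequence allowed after a plain [k + 1] is allowed after a plain [k], or begins with an
    overlined [k], or begins with a plain [k + 1]; the three cases exclude one another. *)
Lemma perm_belows_step k n : perm_eq (belows k.+1 n)
  ((belows k n ++ branch (0 < k) (k, true) n) ++ branch true (k.+1, false) n).
Proof.
apply: uniq_perm; first exact: uniq_belows.
  rewrite !cat_uniq uniq_belows /=.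
  have Ub c x : uniq (branch c x n).
    by rewrite /branch; case: ifP => // _; rewrite map_inj_uniq ?uniq_belows // => ? ? [].
  rewrite !Ub andbT /=; apply/and3P; split=> //.
    apply/hasPn => s; rewrite mem_branch; case: s => // y t /and4P[_ /eqP -> _ _].
    by rewrite /= mem_belows below_cons /op_rel /= ltnn eqxx.
  apply/hasPn => s; rewrite mem_branch; case: s => // y t /and4P[_ /eqP -> _ _].
  rewrite /= mem_cat mem_belows below_cons mem_branch negb_or /op_rel /= ltnNge leqnSn /=.
  by rewrite (ltn_eqF (ltnSn k)) /= xpair_eqE /= !andbF.
move=> s; rewrite !mem_cat !mem_belows !mem_branch.
case: s => [|[i c] t]; first by rewrite /below /= !orbF.
rewrite !below_cons /op_rel /= !xpair_eqE ltnS.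
case: (ltngtP i k) => [Hik|Hik|->].
- by rewrite (ltn_eqF (leq_trans Hik (leqnSn k))) !andbF !orbF.
- rewrite /= andbF /= eq_sym; case: (i =P k.+1) => [->|_] //=.
  by case: c.
- by rewrite /= (ltn_eqF (ltnSn k)); case: c; rewrite /= ?andbF ?orbF.
Qed.

Lemma nbelow_step k n : nbelow k.+1 n =
  nbelow k n + (if (0 < k) && (k <= n) then nbelow k (n - k) else 0)
  + (if k.+1 <= n then nbelow k.+1 (n - k.+1) else 0).
Proof.
rewrite /nbelow (perm_size (perm_belows_step k n)) !size_cat /branch /=.
by do 2 f_equal; case: ifP => //; rewrite size_map.
Qed.

Lemma nbelow_0 n : nbelow 0 n = (n == 0).
Proof.
rewrite /nbelow; have -> : size (belows 0 n) = size (if n == 0 then [:: [::]] : seq (seq (nat *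
  bool)) else [::]).
  apply: perm_size; apply: uniq_perm; [exact: uniq_belows|by case: ifP|].
  move=> s; rewrite mem_belows; case: s => [|x t].
    by rewrite /below /= /weight /= eq_sym; case: (n == 0).
  rewrite below_cons /op_rel /= eq_sym andbA.
  have -> : ((x.1 == 0) && ~~ x.2) && (0 < x.1) = false by case: (x.1) => [|m];
    rewrite ?ltnn ?andbF.
  by case: ifP.
by case: (n == 0).
Qed.

(** Parts are at most [n], so a fictitious preceding part [n + 1] imposes no restriction. *)
Lemma overpbar_nbelow n : overpbar n = nbelow n.+1 n.
Proof.
apply: perm_size; apply: uniq_perm; rewrite ?undup_uniq ?uniq_belows // => s.
rewrite mem_undup mem_filter mem_belows /is_overpartition /below.
have E : [&& sorted op_rel s, positive s & weight s == n] =
         [&& path op_rel (n.+1, false) s, positive s & weight s == n].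
  case: s => [|x t] //; case Hw: (weight (x :: t) == n); last by rewrite !andbF.
  rewrite /= /op_rel /= ltnS -(eqP Hw) part_le_weight //.
  by rewrite inE eqxx.
rewrite -E /positive /weight; case H: [&& sorted op_rel s, _ & _] => //=.
by case/and3P: H => _ Hp /eqP Hw; rewrite (mem_all_cands n s Hp Hw).
Qed.

End Counting.

(** * Transfer to MathComp arithmetic and the theorem *)

Lemma Nat_lebE m n : Nat.leb m n = (m <= n).
Proof. by elim: m n => [|m IH] [|n] //=; rewrite IH. Qed.

Lemma overpbar_count n : overpbar n = with_overlined nbelow n n.
Proof.
rewrite overpbar_nbelow nbelow_step ltnn addn0 /with_overlined.
by rewrite -[Nat.ltb 0 n]/(Nat.leb 1 n) !Nat_lebE.
Qed.

Lemma nbelow_step_nat k n : nbelow k.+1 n =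
  with_overlined nbelow k n + (if Nat.leb k.+1 n then nbelow k.+1 (n - k.+1) else 0).
Proof.
by rewrite nbelow_step /with_overlined -[Nat.ltb 0 k]/(Nat.leb 1 k) !Nat_lebE.
Qed.

Lemma nbelow_0_nat n : nbelow 0 n = if Nat.eqb n 0 then 1%N else 0%N.
Proof. by rewrite nbelow_0; case: n. Qed.

Local Open Scope ring_scope.

Theorem theorem1p2 (n : nat) (hn : (16 <= n)%N) :
  0 < 4 * (1 - u n) * (1 - u n.+1) - (1 - u n * u n.+1) ^+ 2 :> rat.
Proof.
have /ssrnat.ltP H := turan_nat nbelow nbelow_0_nat nbelow_step_nat n (elimT ssrnat.leP hn).
rewrite -!overpbar_count [(n - 1)%coq_nat]subn1 plusE multE in H.
rewrite /u /=; move: H.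
set a := overpbar n.-1; set b := overpbar n; set c := overpbar n.+1; set d := overpbar n.+2 => H.
(* Every term on the larger side of [H] contains both [b] and [c]; if either were 0, a natural
   number would lie strictly below 0. *)
have b0 : b%:R != 0 :> rat.
  by rewrite pnatr_eq0; apply/eqP => b0; move: H; rewrite b0 !(mul0n, muln0).
have c0 : c%:R != 0 :> rat.
  by rewrite pnatr_eq0; apply/eqP => c0; move: H; rewrite c0 !(mul0n, muln0).
move: H; rewrite -(ltr_nat rat) !natrD !natrM => H.
set A := a%:R in H *; set B := b%:R in H b0 *; set C := c%:R in H c0 *; set D := d%:R in H *.
have -> : 4 * (1 - A * C / B ^+ 2) * (1 - B * D / C ^+ 2) - (1 - A * C / B ^+ 2 * (B * D / C ^+
  2)) ^+ 2 =
  (3 * (B * B * C * C) + 6 * (A * B * C * D) - (4 * (B * B * B * D) + 4 * (A * C * C * C)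
    + A * A * D * D)) / (B ^+ 2 * C ^+ 2).
  by field; rewrite b0 c0.
apply: divr_gt0; first by move: H; rewrite -subr_gt0; congr (is_true (0 < _)); ring.
by apply: mulr_gt0; rewrite exprn_even_gt0 //= ?b0 ?c0.
Qed.
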